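(* Let $\phi\in C^1(\mathbb R)$ and $u^0\in L^\infty(\mathbb R)\cap BV(\mathbb R)$, with $\alpha=\operatorname{ess\,inf}u^0$, $\beta=\operatorname{ess\,sup}u^0$ and $M=\max_{\xi\in[\alpha,\beta]}|\phi'(\xi)|$. Fix $s\in(0,1]$ and $\lambda>0$ with $\lambda\ge M$. For each $\Delta x>0$, with $\Delta t=\Delta x/\lambda$, let $(u_\Delta,v_\Delta)$ be the piecewise constant functions built from the D1Q2 scheme with relaxation parameter $s$ and initial data $u_j^0=\frac1{\Delta x}\int_{x_j}^{x_{j+1}}u^0(x)\,dx$, $v_j^0=\phi(u_j^0)$. Let $u$ be a function such that $u\in L^\infty(\mathbb R^+\times\mathbb R)\cap BV([0,T]\times\mathbb R)$ for all $T>0$, $u$ is a weak solution on $[0,+\infty[\times\mathbb R$ of the Cauchy problem $$\partial_t u+\partial_x\phi(u)=0\ (t>0,\ x\in\mathbb R),\qquad u(0,x)=u^0(x)\ (x\in\mathbb R),$$ and, along some sequence $\Delta x\to0$ (with $\Delta t=\Delta x/\lambda$), $(u_\Delta,v_\Delta)\to(u,\phi(u))$ in $L^1_{\rm loc}([0,+\infty[\times\mathbb R)\times L^1_{\rm loc}([0,+\infty[\times\mathbb R)$. Then $u$ is the unique entropy solution of this Cauchy problem.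
   Context: Bounded variation: for $\Omega\subset\mathbb R^d$ open and $g\in L^1_{\rm loc}(\Omega)$, $TV_\Omega(g)=\sup\{\int_\Omega g\,\operatorname{div}\varphi:\ \varphi\in C^1_c(\Omega;\mathbb R^d),\ \|\varphi\|_\infty\le1\}$, and $BV(\Omega)=\{g\in L^1_{\rm loc}(\Omega):TV_\Omega(g)<+\infty\}$ (integrability over all of $\Omega$ is not required). $BV([0,T]\times\mathbb R)$ means $BV$ of the interior $(0,T)\times\mathbb R$. D1Q2 scheme. $\mathbb N=\{0,1,2,\dots\}$; $x_j=j\Delta x$ ($j\in\mathbb Z$), $t^n=n\Delta t$ ($n\in\mathbb N$), $\Delta t=\Delta x/\lambda$. The scheme computes moments $(u_j^n,v_j^n)$, equivalently particle distributions $f_j^{\pm,n}$, linked by $u_j^n=f_j^{+,n}+f_j^{-,n}$, $v_j^n=\lambda(f_j^{+,n}-f_j^{-,n})$, i.e. $f_j^{\pm,n}=\frac12u_j^n\pm\frac1{2\lambda}v_j^n$. Starting from $(u_j^0,v_j^0)_{j\in\mathbb Z}$, one time step consists, for all $j\in\mathbb Z$, of - relaxation: $u_j^{n+1/2}=u_j^n$, $v_j^{n+1/2}=(1-s)v_j^n+s\,\phi(u_j^n)$, $f_j^{\pm,n+1/2}=\frac12u_j^{n}\pm\frac1{2\lambda}v_j^{n+1/2}$; - transport: $f_j^{+,n+1}=f_{j-1}^{+,n+1/2}$, $f_j^{-,n+1}=f_{j+1}^{-,n+1/2}$. Approximate solutions: $u_\Delta(t,x)=u_j^n$ and $v_\Delta(t,x)=v_j^n$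 for $(t,x)\in[t^n,t^{n+1})\times[x_j,x_{j+1})$. Weak solution: $u$ is a weak solution of the Cauchy problem on $[0,+\infty[\times\mathbb R$ if for every $\varphi\in C_c^\infty([0,+\infty[\times\mathbb R)$, $\int_0^\infty\int_{\mathbb R}\big(u\,\partial_t\varphi+\phi(u)\,\partial_x\varphi\big)\,dx\,dt+\int_{\mathbb R}u^0(x)\varphi(0,x)\,dx=0$. Entropy solution (standard sense): a weak solution $u$, bounded and with $u(t,\cdot)\in BV(\mathbb R)$, such that for every entropy–entropy flux pair $(\eta,q)$ with $\eta$ of class $C^2$ and strictly convex ($\eta''>0$, $\eta'\phi'=q'$) and every $\psi\in C_c^\infty(]0,+\infty[\times\mathbb R)$, $\psi\ge0$, one has $\int_0^\infty\int_{\mathbb R}\big(\eta(u)\,\partial_t\psi+q(u)\,\partial_x\psi\big)\,dx\,dt\ge0$. It is well known that for $u^0\in L^\infty(\mathbb R)\cap BV(\mathbb R)$ the Cauchy problem has a unique entropy solution. *)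

(* Defs.v *)
From HB Require Import structures.
From mathcomp Require Import all_boot all_order all_algebra.
From mathcomp Require Import all_classical all_reals all_analysis.

Set Implicit Arguments.
Unset Strict Implicit.
Unset Printing Implicit Defensive.

Import Order.TTheory GRing.Theory Num.Theory.
Import numFieldNormedType.Exports.

Local Open Scope ring_scope.
Local Open Scope classical_set_scope.

Section Smoothness.
Context {R : realType}.

Definition C1 (f : R -> R) : Prop :=
  (forall x, derivable f x 1) /\ continuous f^`().

Definition C2 (f : R -> R) : Prop := C1 f /\ C1 f^`().

(* Points of R * R are pairs (t, x). *)
Definition partial_t (f : R * R -> R) : R * R -> R := 'D_(1, 0) f.
Definition partial_x (f : R * R -> R) : R * R -> R := 'D_(0, 1) f.

Fixpoint Ck2 (k : nat) (f : R * R -> R) : Prop :=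
  continuous f /\
  if k is k'.+1 then
    [/\ forall p, derivable f p (1, 0), forall p, derivable f p (0, 1),
        Ck2 k' (partial_t f) & Ck2 k' (partial_x f)]
  else True.

Definition smooth2 (f : R * R -> R) : Prop := forall k, Ck2 k f.

Definition supp {T : topologicalType} (f : T -> R) : set T :=
  closure [set x | f x != 0].

Definition csupp_in {T : topologicalType} (Om : set T) (f : T -> R) : Prop :=
  compact (supp f) /\ supp f `<=` Om.

End Smoothness.

Section BoundedVariation.
Context {R : realType}.
Local Open Scope ereal_scope.

Definition leb2 := (@lebesgue_measure R \x @lebesgue_measure R)%E.

(* f is only looked at on D: L^oo(D), for the measure mu restricted to D. *)
Definition Linfty d (T : measurableType d) (mu : {measure set T -> \bar R})
    (D : set T) (f : T -> R) : Prop :=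
  measurable_fun D f /\ finite_norm mu +oo (f \_ D).

(* A C^1 function with compact support in Om is identified with its extension by
   0, which is C^1 on the whole space. *)
Definition TV1 (Om : set R) (g : R -> R) : \bar R :=
  ereal_sup [set \int[lebesgue_measure]_(x in Om) (g x * phi^`()%classic x)%:E
            | phi in [set phi : R -> R |
                [/\ C1 phi, csupp_in Om phi & forall x, (`|phi x| <= 1)%R]]].

Definition BV1 (Om : set R) (g : R -> R) : Prop :=
  locally_integrable Om g /\ TV1 Om g < +oo.

(* The library only has locally_integrable for functions of one variable. *)
Definition locally_integrable2 (Om : set (R * R)) (g : R * R -> R) : Prop :=
  [/\ measurable_fun Om g, open Om &
      forall K, K `<=` Om -> compact K ->
        \int[leb2]_(p in K) `|g p|%:E < +oo].

(* phi = (phi.1, phi.2) is a vector field, with the Euclidean norm on R^2. *)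
Definition TV2 (Om : set (R * R)) (g : R * R -> R) : \bar R :=
  ereal_sup
    [set \int[leb2]_(p in Om)
           (g p * (partial_t phi.1 p + partial_x phi.2 p))%:E
    | phi in [set phi : (R * R -> R) * (R * R -> R) |
        [/\ Ck2 1 phi.1 /\ Ck2 1 phi.2,
            csupp_in Om phi.1 /\ csupp_in Om phi.2 &
            forall p, (Num.sqrt (phi.1 p ^+ 2 + phi.2 p ^+ 2) <= 1)%R]]].

Definition BV2 (Om : set (R * R)) (g : R * R -> R) : Prop :=
  locally_integrable2 Om g /\ TV2 Om g < +oo.

End BoundedVariation.

Section ConservationLaw.
Context {R : realType}.

(* [0, +oo[ x R *)
Definition halfplane : set (R * R) := `[0, +oo[ `*` setT.

(* A test function on [0, +oo[ x R is the restriction of a smooth compactly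
   supported function on R^2; it need not vanish at t = 0. *)
Definition weak_solution (phi u0 : R -> R) (u : R * R -> R) : Prop :=
  forall psi : R * R -> R, smooth2 psi -> compact (supp psi) ->
    \int[leb2]_(p in halfplane)
       (u p * partial_t psi p + phi (u p) * partial_x psi p) +
    \int[lebesgue_measure]_x (u0 x * psi (0, x)) = 0.

Definition entropy_pair (phi eta q : R -> R) : Prop :=
  [/\ C2 eta, forall xi, 0 < eta^`(2)%classic xi,
      forall xi, derivable q xi 1 &
      forall xi, eta^`()%classic xi * phi^`()%classic xi = q^`() xi].

(* u stands for an element of L^oo, that is, a class modulo equality almost
   everywhere; accordingly u(t, .) is required to be BV for almost every t. *)
Definition entropy_solution (phi u0 : R -> R) (u : R * R -> R) : Prop :=
  [/\ Linfty leb2 halfplane u,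
      weak_solution phi u0 u,
      {ae lebesgue_measure, forall t, 0 < t -> BV1 setT (fun x => u (t, x))} &
      forall (eta q : R -> R) (psi : R * R -> R), entropy_pair phi eta q ->
        smooth2 psi -> csupp_in (`]0, +oo[ `*` setT : set (R * R)) psi ->
        (forall p, 0 <= psi p) ->
        0 <= \int[leb2]_(p in halfplane)
               (eta (u p) * partial_t psi p + q (u p) * partial_x psi p)].

Definition unique_entropy_solution (phi u0 : R -> R) (u : R * R -> R) : Prop :=
  entropy_solution phi u0 u /\
  forall w, entropy_solution phi u0 w ->
    {ae leb2, forall p, halfplane p -> w p = u p}.

End ConservationLaw.

Section D1Q2.
Context {R : realType}.
Variables (phi u0 : R -> R) (s lambda dx : R).

Definition lattice := int -> R.

Definition space_node (j : int) : R := j%:~R * dx.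

Definition u_init : lattice := fun j =>
  dx^-1 * \int[lebesgue_measure]_(x in `[space_node j, space_node (j + 1)]) u0 x.

Definition v_init : lattice := fun j => phi (u_init j).

Definition f_plus (uv : lattice * lattice) : lattice := fun j =>
  2^-1 * uv.1 j + (2 * lambda)^-1 * uv.2 j.

Definition f_minus (uv : lattice * lattice) : lattice := fun j =>
  2^-1 * uv.1 j - (2 * lambda)^-1 * uv.2 j.

Definition moments (fp fm : lattice) : lattice * lattice :=
  (fun j => fp j + fm j, fun j => lambda * (fp j - fm j)).

Definition relaxation (uv : lattice * lattice) : lattice * lattice :=
  (uv.1, fun j => (1 - s) * uv.2 j + s * phi (uv.1 j)).

Definition transport (uv : lattice * lattice) : lattice * lattice :=
  moments (fun j => f_plus uv (j - 1)) (fun j => f_minus uv (j + 1)).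

Definition d1q2 (n : nat) : lattice * lattice :=
  iter n (fun uv => transport (relaxation uv)) (u_init, v_init).

Definition dt : R := dx / lambda.

(* For t >= 0, t lies in [n dt, (n + 1) dt[ iff n = truncn (t / dt), and x lies
   in [j dx, (j + 1) dx[ iff j = floor (x / dx). *)
Definition u_approx (p : R * R) : R :=
  (d1q2 (Num.truncn (p.1 / dt))).1 (Num.floor (p.2 / dx)).

Definition v_approx (p : R * R) : R :=
  (d1q2 (Num.truncn (p.1 / dt))).2 (Num.floor (p.2 / dx)).

End D1Q2.

Definition cvg_L1loc {R : realType} (D : set (R * R))
    (f_ : nat -> R * R -> R) (f : R * R -> R) : Prop :=
  forall K, K `<=` D -> compact K ->
    (\int[leb2]_(p in K) `|f_ k p - f p|%:E)%E @[k --> \oo] --> 0%E.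

(* Main.v *)
(** Let c = 1/lambda or -1/lambda and h_c(w) = (w + c phi(w))/2, which is nondecreasing on
    [alpha, beta] by the condition M <= lambda.  The entropy eta splits as g_c + g_(-c), where
    g_c = (eta + c q)/2 has derivative eta' h_c', so that g_c o h_c^-1 is convex; let S_c be its
    extension as the supremum of its tangents.  Then S_c(h_c(w)) = g_c(w) and, comparing with the
    tangents at w = f + f', S_c(f) + S_(-c)(f') >= eta(f + f').  Hence relaxation does not increase
    S_c(f+) + S_(-c)(f-), transport only shifts each term, and in the L^1_loc limit one obtains the
    entropy inequality.

    The total variation of almost every slice u(t, .) is finite by Fatou's lemma, since the
    mollifications of u satisfy a uniform bound on the integral of |d_x u_eps|.

    For uniqueness let d be the difference of two entropy solutions and e that of the fluxes.
    Doubling of variables gives |d|_t + F_x <= 0 with |d| e = F d, and d_t + e_x = 0 with zero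
    initial datum.  No L^1 theory and no trace at t = 0 of |d| is needed: d = D_x and e = - D_t up
    to mollification for a potential D with |D| <= C t, and D^2 |d| satisfies the same inequality
    as |d| because |d| D_t + F D_x = 0.  As D^2 vanishes at t = 0, integration over a backward
    cone gives D^2 |d| = 0, then (D^4)_t = 0, hence D = 0 and d = 0. *)

Require Import Defs.
From HB Require Import structures.
From mathcomp Require Import all_boot all_order all_algebra.
From mathcomp Require Import all_classical all_reals all_analysis ess_sup_inf.
From mathcomp Require Import measurable_realfun ring lra.
Import Order.TTheory GRing.Theory Num.Theory.
Import numFieldNormedType.Exports.

Set Implicit Arguments.
Unset Strict Implicit.
Unset Printing Implicit Defensive.

Local Open Scope ring_scope.
Local Open Scope classical_set_scope.

(** * Smooth functions of one and two variables *)

Section SmoothFunctions.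
Context {R : realType}.
Implicit Types (f g : R * R -> R) (a b : R -> R).

(** Entropy inequalities are tested in t > 0 only and solutions are merely bounded, so neither the
    behaviour of |d| as t tends to 0 nor its integrability in x is under control, and the usual L^1
    contraction has no starting point. The initial datum is present in the weak formulation, whose
    test functions may be nonzero at t = 0; the potential carries this information over. It vanishes
    linearly in t, so D^2 is of order eps^2 on the layer where a time cutoff has slope of order 1 /
    eps, and the layer contributes O(eps). The fourth power appears because D_t = - e with |e| <=
    Lam |d|: the derivative of D^4 contains D^3 d, which the bound on D^2 |d| controls, whereas the
    derivative of a lower power would not contain enough factors D. On the scheme side h_c may be
    flat where |phi'| = lambda, so h_c^-1 need not be a smooth function. The envelope of tangents
    avoids the inverse, and it is convex and Lipschitz by construction. The monotonicity of h_c also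
    keeps f+ and f- between the equilibria of alpha and beta, hence u in [alpha, beta], the interval
    on which phi' is bounded by lambda. *)

Fixpoint Ck1 (k : nat) a : Prop :=
  continuous a /\
  if k is k'.+1 then (forall x, derivable a x 1) /\ Ck1 k' a^`() else True.

Definition smooth1 a : Prop := forall k, Ck1 k a.

Lemma Ck1W k a : Ck1 k.+1 a -> Ck1 k a.
Proof.
by elim: k a => [|k IH] a [ca [da Da]]; split => //; split => //; exact: IH.
Qed.

Lemma Ck1_cst k (c : R) : Ck1 k (cst c).
Proof.
elim: k c => [|k IH] c; (split; first by move=> x; exact: cvg_cst) => //.
split=> [x|]; first exact: derivable_cst.
have -> : (cst c : R -> R)^`() = cst 0 by apply/funext => x; rewrite derive1_cst.
exact: IH.
Qed.

Lemma Ck1_id k : Ck1 k (@id R).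
Proof.
case: k => [|k]; split => //; try by move=> x; exact: cvg_id.
split=> [x|]; first exact: derivable_id.
have -> : (@id R)^`() = cst 1 by apply/funext => x; rewrite derive1_id.
exact: Ck1_cst.
Qed.

Lemma Ck1D k a b : Ck1 k a -> Ck1 k b -> Ck1 k (a \+ b).
Proof.
elim: k a b => [|k IH] a b [ca Ha] [cb Hb].
  by split => // x; apply: cvgD; [exact: ca|exact: cb].
split; first by move=> x; apply: cvgD; [exact: ca|exact: cb].
case: Ha Hb => da Da [db Db]; split=> [x|]; first exact: (derivableD (da x) (db x)).
have -> : (a \+ b)^`() = derive1 a \+ derive1 b.
  by apply/funext => x; rewrite /= !derive1E (deriveD (da x) (db x)).
exact: IH.
Qed.

Lemma Ck1M k a b : Ck1 k a -> Ck1 k b -> Ck1 k (a \* b).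
Proof.
elim: k a b => [|k IH] a b Ca Cb; have [ca Ha] := Ca; have [cb Hb] := Cb.
  by split => // x; apply: cvgM; [exact: ca|exact: cb].
split; first by move=> x; apply: cvgM; [exact: ca|exact: cb].
case: Ha Hb => da Da [db Db]; split=> [x|]; first exact: (derivableM (da x) (db x)).
have -> : (a \* b)^`() = (a \* derive1 b) \+ (b \* derive1 a).
  by apply/funext => x; rewrite /= !derive1E (deriveM (da x) (db x)).
by apply: Ck1D; apply: IH => //; exact: Ck1W.
Qed.

Lemma smooth1_cst (c : R) : smooth1 (cst c).
Proof. by move=> k; exact: Ck1_cst. Qed.
Lemma smooth1_id : smooth1 id.
Proof. by move=> k; exact: Ck1_id. Qed.
Lemma smooth1D a b : smooth1 a -> smooth1 b -> smooth1 (a \+ b).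
Proof. by move=> ha hb k; exact: Ck1D. Qed.
Lemma smooth1M a b : smooth1 a -> smooth1 b -> smooth1 (a \* b).
Proof. by move=> ha hb k; exact: Ck1M. Qed.
Lemma smooth1_derivable a : smooth1 a -> forall x, derivable a x 1.
Proof. by move=> /(_ 1%N)[_ []]. Qed.
Lemma smooth1_derive a : smooth1 a -> smooth1 a^`().
Proof. by move=> ha k; have [_ []] := ha k.+1. Qed.
Lemma smooth1_continuous a : smooth1 a -> continuous a.
Proof. by move=> /(_ 0%N)[]. Qed.

Lemma derive1_affine a (c d : R) x : derivable a (c * x + d) 1 ->
  derivable (fun y => a (c * y + d)) x 1 /\
  (fun y => a (c * y + d))^`() x = c * derive1 a (c * x + d).
Proof.
move=> da.
have dl : is_derive x 1 (fun y : R => c * y + d) c.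
  by apply: is_derive_eq; rewrite addr0 /GRing.scale/= mulr1.
have [? H] := @realfun.is_derive1_comp R a (fun y => c * y + d) x _ _ (derivableP da) dl.
by split; [|rewrite derive1E [LHS]H mulrC -derive1E].
Qed.

Lemma Ck1_affine k a (c d : R) : Ck1 k a -> Ck1 k (fun x => a (c * x + d)).
Proof.
elim: k a => [|k IH] a [ca Ha].
  split => // x; apply: (@continuous_comp _ _ _ (fun y : R => c * y + d) a); last exact: ca.
  by apply: cvgD; [apply: cvgM; [exact: cvg_cst|exact: cvg_id]|exact: cvg_cst].
split.
  move=> x; apply: (@continuous_comp _ _ _ (fun y : R => c * y + d) a); last exact: ca.
  by apply: cvgD; [apply: cvgM; [exact: cvg_cst|exact: cvg_id]|exact: cvg_cst].
case: Ha => da Da; split=> [x|]; first exact: (derive1_affine _).1.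
have -> : (fun x => a (c * x + d))^`() = (cst c) \* (fun x => derive1 a (c * x + d)).
  by apply/funext => x; rewrite (derive1_affine (da _)).2.
by apply: Ck1M; [exact: Ck1_cst|exact: IH].
Qed.

Lemma smooth1_affine a (c d : R) : smooth1 a -> smooth1 (fun x => a (c * x + d)).
Proof. by move=> ha k; exact: Ck1_affine. Qed.

Lemma Ck2S k f : Ck2 k.+1 f -> [/\ continuous f, forall p, derivable f p (1, 0),
  forall p, derivable f p (0, 1), Ck2 k (partial_t f) & Ck2 k (partial_x f)].
Proof. by case=> ? [*]; split. Qed.

Lemma Ck2_continuous k f : Ck2 k f -> continuous f.
Proof. by case: k => [|k] []. Qed.

Lemma Ck2W k f : Ck2 k.+1 f -> Ck2 k f.
Proof.
elim: k f => [|k IH] f /Ck2S[cf d1 d2 D1 D2]; first by split.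
by split; [exact: cf|split; [exact: d1|exact: d2|exact: (IH _ D1)|exact: (IH _ D2)]].
Qed.

Lemma Ck2D k f g : Ck2 k f -> Ck2 k g -> Ck2 k (f \+ g).
Proof.
elim: k f g => [|k IH] f g.
  by case=> cf _ [cg _]; split => // x; apply: cvgD; [exact: cf|exact: cg].
move=> /Ck2S[cf df1 df2 Df1 Df2] /Ck2S[cg dg1 dg2 Dg1 Dg2].
split; first by move=> x; apply: cvgD; [exact: cf|exact: cg].
split=> [x|x||]; [exact: (derivableD (df1 x) (dg1 x))|exact: (derivableD (df2 x) (dg2 x))| |].
- have -> : partial_t (f \+ g) = partial_t f \+ partial_t g.
    by apply/funext => x; rewrite /partial_t (deriveD (df1 x) (dg1 x)).
  exact: IH.
- have -> : partial_x (f \+ g) = partial_x f \+ partial_x g.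
    by apply/funext => x; rewrite /partial_x (deriveD (df2 x) (dg2 x)).
  exact: IH.
Qed.

Lemma Ck2M k f g : Ck2 k f -> Ck2 k g -> Ck2 k (f \* g).
Proof.
elim: k f g => [|k IH] f g.
  by case=> cf _ [cg _]; split => // x; apply: cvgM; [exact: cf|exact: cg].
move=> Cf Cg; have [cf df1 df2 Df1 Df2] := Ck2S Cf; have [cg dg1 dg2 Dg1 Dg2] := Ck2S Cg.
split; first by move=> x; apply: cvgM; [exact: cf|exact: cg].
split=> [x|x||]; [exact: (derivableM (df1 x) (dg1 x))|exact: (derivableM (df2 x) (dg2 x))| |].
- have -> : partial_t (f \* g) = (f \* partial_t g) \+ (g \* partial_t f).
    by apply/funext => x; rewrite /partial_t (deriveM (df1 x) (dg1 x)).
  by apply: Ck2D; apply: IH; [exact: Ck2W| |exact: Ck2W|].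
- have -> : partial_x (f \* g) = (f \* partial_x g) \+ (g \* partial_x f).
    by apply/funext => x; rewrite /partial_x (deriveM (df2 x) (dg2 x)).
  by apply: Ck2D; apply: IH; [exact: Ck2W| |exact: Ck2W|].
Qed.

(** The two difference quotients are the same function of the increment, so that one-variable
    calculus applies to partial derivatives. *)
Lemma derive_tE f (p : R * R) :
  (derivable f p (1, 0) <-> derivable (fun t => f (t, p.2)) p.1 1) /\
  partial_t f p = (fun t => f (t, p.2))^`() p.1.
Proof.
pose g := (fun t => f (t, p.2)).
have E : (fun h : R => h^-1 *: ((f \o shift p) (h *: ((1, 0) : R * R)) - f p)) =
         (fun h : R => h^-1 *: ((g \o shift p.1) (h *: (1 : R)) - g p.1)).
  apply/funext => h; rewrite /g /=; congr (_ *: (f _ - f _)); last by rewrite -surjective_pairing.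
  by apply/eqP; rewrite xpair_eqE /= !eqxx /= ?andbT scaler0 add0r.
split; first by rewrite /derivable -/g E.
rewrite /partial_t /derive -/g.
rewrite E.
by rewrite [RHS]derive1E.
Qed.
Lemma derive_xE f (p : R * R) :
  (derivable f p (0, 1) <-> derivable (fun x => f (p.1, x)) p.2 1) /\
  partial_x f p = (fun x => f (p.1, x))^`() p.2.
Proof.
pose g := (fun x => f (p.1, x)).
have E : (fun h : R => h^-1 *: ((f \o shift p) (h *: ((0, 1) : R * R)) - f p)) =
         (fun h : R => h^-1 *: ((g \o shift p.2) (h *: (1 : R)) - g p.2)).
  apply/funext => h; rewrite /g /=; congr (_ *: (f _ - f _)); last by rewrite -surjective_pairing.
  by apply/eqP; rewrite xpair_eqE /= !eqxx /= ?andbT scaler0 add0r.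
split; first by rewrite /derivable -/g E.
rewrite /partial_x /derive -/g E.
by rewrite [RHS]derive1E.
Qed.

Lemma Ck2_cst k (c : R) : Ck2 k (cst c).
Proof.
elim: k c => [|k IH] c; (split; first by move=> x; exact: cvg_cst) => //.
split=> [x|x||]; [exact: derivable_cst|exact: derivable_cst| |].
- have -> : partial_t (cst c) = cst 0 by apply/funext => x; exact: derive_cst.
  exact: IH.
- have -> : partial_x (cst c) = cst 0 by apply/funext => x; exact: derive_cst.
  exact: IH.
Qed.

Lemma Ck2_fst k a : Ck1 k a -> Ck2 k (fun p => a p.1).
Proof.
elim: k a => [|k IH] a [ca Ha].
  by split => // p; apply: (@continuous_comp _ _ _ fst a); [exact: cvg_fst|exact: ca].
split.
  by move=> p; apply: (@continuous_comp _ _ _ fst a); [exact: cvg_fst|exact: ca].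
case: Ha => da Da; split=> [p|p||].
- by apply/(derive_tE _ p).1; exact: da.
- by apply/(derive_xE _ p).1; exact: (@derivable_cst R R R (a p.1)).
- have -> : partial_t (fun p => a p.1) = (fun p => a^`() p.1).
    by apply/funext => p; rewrite (derive_tE _ _).2.
  exact: IH.
- have -> : partial_x (fun p => a p.1) = cst 0.
    by apply/funext => p; rewrite (derive_xE _ p).2; exact: (@derive1_cst R R (a p.1) p.2).
  exact: Ck2_cst.
Qed.

Lemma Ck2_snd k a : Ck1 k a -> Ck2 k (fun p => a p.2).
Proof.
elim: k a => [|k IH] a [ca Ha].
  by split => // p; apply: (@continuous_comp _ _ _ snd a); [exact: cvg_snd|exact: ca].
split.
  by move=> p; apply: (@continuous_comp _ _ _ snd a); [exact: cvg_snd|exact: ca].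
case: Ha => da Da; split=> [p|p||].
- by apply/(derive_tE _ p).1; exact: (@derivable_cst R R R (a p.2)).
- by apply/(derive_xE _ p).1; exact: da.
- have -> : partial_t (fun p => a p.2) = cst 0.
    by apply/funext => p; rewrite (derive_tE _ p).2; exact: (@derive1_cst R R (a p.2) p.1).
  exact: Ck2_cst.
- have -> : partial_x (fun p => a p.2) = (fun p => a^`() p.2).
    by apply/funext => p; rewrite (derive_xE _ _).2.
  exact: IH.
Qed.

Lemma smooth2M f g : smooth2 f -> smooth2 g -> smooth2 (f \* g).
Proof. by move=> hf hg k; exact: Ck2M. Qed.
Lemma smooth2_tensor a b : smooth1 a -> smooth1 b ->
  smooth2 (fun p => a p.1 * b p.2).
Proof. by move=> ha hb k; apply: Ck2M; [exact: Ck2_fst|exact: Ck2_snd]. Qed.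
Lemma smooth2_derivable_t f : smooth2 f -> forall p, derivable f p (1, 0).
Proof. by move=> /(_ 1%N)[_ []]. Qed.
Lemma smooth2_derivable_x f : smooth2 f -> forall p, derivable f p (0, 1).
Proof. by move=> /(_ 1%N)[_ []]. Qed.
Lemma smooth2_partial_t f : smooth2 f -> smooth2 (partial_t f).
Proof. by move=> hf k; have [_ []] := hf k.+1. Qed.
Lemma smooth2_partial_x f : smooth2 f -> smooth2 (partial_x f).
Proof. by move=> hf k; have [_ []] := hf k.+1. Qed.
Lemma smooth2_continuous f : smooth2 f -> continuous f.
Proof. by move=> /(_ 0%N)[]. Qed.

Lemma partial_tM f g p : smooth2 f -> smooth2 g ->
  partial_t (f \* g) p = f p * partial_t g p + g p * partial_t f p.
Proof. by move=> hf hg; rewrite /partial_t deriveM//; exact: smooth2_derivable_t. Qed.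
Lemma partial_xM f g p : smooth2 f -> smooth2 g ->
  partial_x (f \* g) p = f p * partial_x g p + g p * partial_x f p.
Proof. by move=> hf hg; rewrite /partial_x deriveM//; exact: smooth2_derivable_x. Qed.

Lemma partial_t_tensor a b p : smooth1 a ->
  partial_t (fun p => a p.1 * b p.2) p = derive1 a p.1 * b p.2.
Proof.
move=> ha; rewrite (derive_tE _ _).2/= derive1E deriveMr; last exact: smooth1_derivable.
by rewrite derive1E mulrC.
Qed.
(** A convolution kernel, seen as a function of the integration variable, has the form [f (z - p)].
    The sign in this rule is the one that appears whenever a derivative of a mollified function is
    moved onto a test function. *)
Lemma partial_t_refl f (z p : R * R) : (forall q, derivable f q (1, 0)) ->
  derivable (fun p => f (z - p)) p (1, 0) /\
  partial_t (fun p => f (z - p)) p = - partial_t f (z - p).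
Proof.
move=> hf; pose a (s : R) := f (s, z.2 - p.2).
have E : (fun t : R => f (z - (t, p.2))) = (fun t : R => a (- 1 * t + z.1)).
  by apply/funext => t; congr (f (_, _)); rewrite mulN1r addrC.
have Ez : - 1 * p.1 + z.1 = (z - p).1 by rewrite mulN1r addrC.
have da : derivable a (- 1 * p.1 + z.1) 1.
  by rewrite Ez; exact: ((derive_tE f (z - p)).1.1 (hf _)).
have [D1 D2] := derive1_affine da; split.
  by apply/(derive_tE _ p).1; rewrite E.
rewrite (derive_tE _ p).2 E.
by rewrite [LHS]D2 mulN1r Ez (derive_tE f (z - p)).2.
Qed.

Lemma partial_x_refl f (z p : R * R) : (forall q, derivable f q (0, 1)) ->
  derivable (fun p => f (z - p)) p (0, 1) /\
  partial_x (fun p => f (z - p)) p = - partial_x f (z - p).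
Proof.
move=> hf; pose a (s : R) := f (z.1 - p.1, s).
have E : (fun t : R => f (z - (p.1, t))) = (fun t : R => a (- 1 * t + z.2)).
  by apply/funext => t; congr (f (_, _)); rewrite mulN1r addrC.
have Ez : - 1 * p.2 + z.2 = (z - p).2 by rewrite mulN1r addrC.
have da : derivable a (- 1 * p.2 + z.2) 1.
  by rewrite Ez; exact: ((derive_xE f (z - p)).1.1 (hf _)).
have [D1 D2] := derive1_affine da; split.
  by apply/(derive_xE _ p).1; rewrite E.
rewrite (derive_xE _ p).2 E.
by rewrite [LHS]D2 mulN1r Ez (derive_xE f (z - p)).2.
Qed.

Lemma Ck2_refl k f (z : R * R) : Ck2 k f -> Ck2 k (fun p => f (z - p)).
Proof.
have cc (g : R * R -> R) : continuous g -> continuous (fun p : R * R => g (z - p)).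
  move=> cg p; apply: (@continuous_comp _ _ _ (fun p : R * R => z - p) g); last exact: cg.
  by apply: cvgB; [exact: cvg_cst|exact: cvg_id].
elim: k f => [|k IH] f; first by case=> cf _; split; [exact: cc|].
move=> /Ck2S[cf d1 d2 D1 D2]; split; first exact: cc.
split=> [p|p||].
- exact: (partial_t_refl z p d1).1.
- exact: (partial_x_refl z p d2).1.
- rewrite (_ : partial_t _ = (cst (-1)) \* (fun p => partial_t f (z - p))); last first.
    by apply/funext => p /=; rewrite (partial_t_refl z p d1).2 mulN1r.
  by apply: Ck2M; [exact: Ck2_cst|exact: IH].
- rewrite (_ : partial_x _ = (cst (-1)) \* (fun p => partial_x f (z - p))); last first.
    by apply/funext => p /=; rewrite (partial_x_refl z p d2).2 mulN1r.
  by apply: Ck2M; [exact: Ck2_cst|exact: IH].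
Qed.

Lemma smooth2_refl f (z : R * R) : smooth2 f -> smooth2 (fun p => f (z - p)).
Proof. by move=> hf k; exact: Ck2_refl. Qed.

End SmoothFunctions.

(** * A smooth step function *)

Section Bump.
Context {R : realType}.

(** A quadratic remainder is more than differentiability asks for, but it is what a bounded second
    derivative provides, and it survives integration: convolutions are differentiated in this way,
    and so is [flat] at the origin. *)
Lemma is_derive_quad (f : R -> R) (x l C : R) :
  (forall h, `|h| <= 1 -> `|f (x + h) - f x - h * l| <= C * h ^+ 2) ->
  is_derive x 1 f l.
Proof.
move=> H.
have cv : (fun h : R => h^-1 *: ((f \o shift x) (h *: (1 : R)) - f x)) @ 0^' --> l.
  have C0 : 0 <= C.
    have := H 1; rewrite normr1 lexx expr1n mulr1 => /(_ isT); apply: le_trans.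
    exact: normr_ge0.
  apply/cvgrPdist_le => e e0.
  near=> h.
  have h0 : h != 0 by near: h; exact: nbhs_dnbhs_neq.
  have h1 : `|h| <= 1.
    near: h; apply: dnbhs0_le; exact: ltr01.
  have he : `|h| <= e / (C + 1).
    near: h; apply: dnbhs0_le; rewrite divr_gt0// ltr_wpDl//.
  have -> : l - h^-1 *: ((f \o shift x) (h *: (1 : R)) - f x) = - (h^-1 * (f (x + h) - f x - h * l)).
    rewrite /= /GRing.scale/= mulr1 [h + x]addrC.
    by field.
  rewrite normrN normrM normfV.
  rewrite ler_pdivrMl ?normr_gt0//.
  apply: (le_trans (H _ h1)).
  rewrite -(real_normK (num_real h)) expr2 mulrCA ler_wpM2l ?normr_ge0//.
  rewrite (le_trans (ler_wpM2l C0 he))// mulrCA ger_pMr// ler_pdivrMr ?mul1r ?lerDl//.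
  by rewrite ltr_wpDl.
apply: DeriveDef; first by apply: cvgP; exact: cv.
by apply: cvg_lim => //; exact: cv.
Unshelve. all: by end_near.
Qed.

(** [flat 0] is the classical exp (-1/x). The negative powers of x make the family closed under
    differentiation, the derivative of [flat n] being a combination of [flat n.+1] and [flat n.+2],
    so that smoothness of all members follows by one induction. *)
Definition flat (n : nat) (x : R) : R :=
  if 0 < x then x^-1 ^+ n * expR (- x^-1) else 0.

(** The term of degree n + 2 of the exponential series at 1/x absorbs the pole of order n and leaves
    the factor x ^ 2 that [is_derive_quad] asks for at the origin. *)
Lemma flat_le n x : `|flat n x| <= n.+2`!%:R * x ^+ 2.
Proof.
rewrite /flat; case: ifPn => [x0|]; last by rewrite normr0 mulr_ge0// sqr_ge0.
have y0 : 0 < x^-1 by rewrite invr_gt0.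
rewrite ger0_norm; last by rewrite mulr_ge0 ?expR_ge0// exprn_ge0// ltW.
rewrite expRN ler_pdivrMr ?expR_gt0//.
have := expR_ge1Dxn n.+1 (ltW y0) => H.
have {}H : x^-1 ^+ n.+2 <= n.+2`!%:R * expR x^-1.
  rewrite -ler_pdivrMl ?ltr0n ?fact_gt0// mulrC; apply: le_trans H.
  by rewrite lerDr.
rewrite mulrAC; apply: le_trans (ler_wpM2r (sqr_ge0 x) H).
rewrite -addn2 exprD -mulrA -exprMn mulVf ?gt_eqF//.
by rewrite expr1n mulr1.
Qed.

Lemma flat_is_derive (n : nat) (x : R) :
  is_derive x 1 (flat n) (- n%:R * flat n.+1 x + flat n.+2 x).
Proof.
have [x0|x0|->] := ltgtP x 0.
- have -> : - n%:R * flat n.+1 x + flat n.+2 x = 0.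
    by rewrite /flat ltNge (ltW x0)/= mulr0 addr0.
  apply: near_eq_is_derive (is_derive_cst (0 : R) x 1).
  near=> y; rewrite /flat ifN// -leNgt ltW//; near: y; exact: lt_nbhsl.
- have iV : is_derive x 1 (fun y : R => y^-1) (- x ^- 2 *: 1).
    by apply: is_deriveV; rewrite gt_eqF.
  have iE : is_derive x 1 (fun y : R => expR (- y^-1)) (expR (- x^-1) * (x ^- 2)).
    apply: is_derive_eq; rewrite scaleNr opprK /GRing.scale/= mulr1; ring.
  have iX : is_derive x 1 ((fun y : R => y^-1) ^+ n) ((n%:R * x^-1 ^+ n.-1) *: (- x ^- 2 *: 1)).
    exact: is_deriveX.
  apply: (@near_eq_is_derive _ _ _ (((fun y : R => y^-1) ^+ n) * (fun y : R => expR (- y^-1)))).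
    near=> y; rewrite /flat ifT ?fctE//; near: y; exact: lt_nbhsr.
  apply: (is_derive_eq (is_deriveM iX iE)).
  rewrite /flat x0 fctE /GRing.scale /=.
  rewrite -[x ^- 2]exprVn; set y := x^-1; set E := expR _.
  clear; case: n => [|n] /=; first by rewrite mulr0n; ring.
  by rewrite !exprS; ring.
- apply: (@is_derive_quad _ _ _ (n.+2`!)%:R) => h _.
  rewrite add0r.
  have E m : flat m 0 = 0 by rewrite /flat ltxx.
  by rewrite !E mulr0 addr0 mulr0 !subr0 flat_le.
Unshelve. all: by end_near.
Qed.

Lemma smooth1_flat n : smooth1 (flat n).
Proof.
have D m x := flat_is_derive m x.
have ex m x : derivable (flat m) x 1 by have [] := D m x.
have c m : continuous (flat m).
  by move=> x; apply: differentiable_continuous; apply/derivable1_diffP; exact: ex.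
move=> k; elim: k n => [|k IH] n; split => //; split => //.
have -> : (flat n)^`() = (cst (- n%:R) \* flat n.+1) \+ flat n.+2.
  by apply/funext => x; rewrite derive1E; have [_ ->] := D n x.
by apply: Ck1D => //; apply: Ck1M => //; exact: Ck1_cst.
Qed.

End Bump.

Section Primitive.
Context {R : realType}.
Notation mu := (@lebesgue_measure R).

Lemma continuous_integrable_itv (f : R -> R) (a b : R) : continuous f ->
  mu.-integrable `[a, b] (EFin \o f).
Proof.
move=> cf; apply: continuous_compact_integrable; first exact: segment_compact.
by apply: continuous_subspaceT => x; exact: cf.
Qed.

Lemma exists_primitive (f : R -> R) : continuous f ->
  exists F : R -> R, forall x : R, is_derive x 1 F (f x).
Proof.
move=> cf; pose G (a x : R) := \int[mu]_(t in `[a, x]) f t.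
(* The integral over [[a, x]] carries no orientation, so the base point has to lie to the left of
   both 0 and x. The difference [G a x - G a 0] does not depend on it, which allows a base point
   that varies with x. *)
have indep (a b x : R) : a <= 0 -> a <= x -> b <= 0 -> b <= x ->
    G a x - G a 0 = G b x - G b 0.
  move=> a0 ax b0 bx.
  have H (c y z : R) : c <= y -> y <= z -> G c z - G c y = \int[mu]_(t in `]y, z]) f t.
    by move=> cy yz; rewrite /G Rintegral_itvB// ?bnd_simp//; exact: continuous_integrable_itv.
  have [x0|x0] := leP 0 x; first by rewrite !H.
  by apply: oppr_inj; rewrite !opprB !H// ltW.
exists (fun x => G (- (`|x| + 1)) x - G (- (`|x| + 1)) 0) => x.
pose c : R := - (`|x| + 2).
have cx : c < x by rewrite /c; have := ler_norm (- x); rewrite normrN; lra.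
have c0 : c < 0 by rewrite /c; have := normr_ge0 x; lra.
have [D1 D2] := @continuous_FTC1_closed R f c x (x + 1) (ltr_pwDr ltr01 (lexx x))
  (continuous_integrable_itv c (x + 1) cf) cx (cf x).
apply: (@near_eq_is_derive _ _ _ ((fun y => G c y) - cst (G c 0))).
  near=> y.
  have yx : `|y - x| < 1 by rewrite distrC; near: y; exact: (@nbhsx_ballx _ _ x 1 ltr01).
  have yx' : `|y| <= `|x| + 1 by have := ler_normD (y - x) x; rewrite subrK; lra.
  rewrite !fctE; apply: indep; first exact: ltW.
  - by rewrite /c; have := ler_norm (- y); rewrite normrN; lra.
  - by have := normr_ge0 y; lra.
  - by have := ler_norm (- y); rewrite normrN; lra.
have D : is_derive x 1 (fun y => G c y) (f x).
  by apply: (DeriveDef D1); rewrite -derive1E.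
by apply: (is_derive_eq (is_deriveB D (is_derive_cst (G c 0) x 1))); rewrite subr0.
Unshelve. all: by end_near.
Qed.

End Primitive.

Section Step.
Context {R : realType}.

Lemma is_derive_mvt (F f : R -> R) (a b : R) : (forall x : R, is_derive x 1 F (f x)) ->
  a < b -> exists2 c, a < c < b & F b - F a = f c * (b - a).
Proof.
move=> D ab.
have cF x : {for x, continuous F}.
  by apply: differentiable_continuous; apply/derivable1_diffP; have [] := D x.
have [c cab E] := @MVT R F f a b ab (fun x _ => D x) (continuous_subspaceT cF).
by exists c => //; move: cab; rewrite in_itv.
Qed.

Lemma is_derive_mvtW (F f : R -> R) (a b : R) : (forall x : R, is_derive x 1 F (f x)) ->
  exists c, [/\ Num.min a b <= c, c <= Num.max a b & F b - F a = f c * (b - a)].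
Proof.
move=> D; have [ab|ba|->] := ltgtP a b.
- have [c /andP[ac cb] E] := is_derive_mvt D ab.
  by exists c; rewrite !ltW.
- have [c /andP[ac cb] E] := is_derive_mvt D ba.
  by exists c; rewrite !ltW//; split => //; rewrite -[LHS]opprB E; ring.
- by exists b; rewrite lexx !subrr mulr0.
Qed.

(** The normalised primitive of the bump flat(x) flat(1 - x), supported in [0, 1]. Mollifiers, time
    and space cutoffs and the approximate sign functions below are all built from this single
    step. *)
Lemma exists_smooth_step : exists th : R -> R,
  [/\ smooth1 th, forall x, x <= 0 -> th x = 0, forall x, 1 <= x -> th x = 1 &
      forall x, 0 <= derive1 th x].
Proof.
pose r (x : R) := flat 0 x * flat 0 (- 1 * x + 1).
have sr : smooth1 r.
  by apply: smooth1M; [exact: smooth1_flat|apply: smooth1_affine; exact: smooth1_flat].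
have f0 (x : R) : 0 <= flat 0 x.
  by rewrite /flat; case: ifP => // _; rewrite mul1r expR_ge0.
have r0 x : 0 <= r x by exact: mulr_ge0.
have [F DF] := exists_primitive (smooth1_continuous sr).
have [c /andP[c0 c1] E] := is_derive_mvt DF ltr01.
have m0 : 0 < F 1 - F 0.
  rewrite E subr0 mulr1 /r /flat c0 ifT; last by lra.
  by rewrite !mul1r mulr_gt0 ?expR_gt0.
pose m := F 1 - F 0.
have D (x : R) : is_derive x 1 (fun x => m^-1 * F x + (- F 0 / m)) (m^-1 * r x).
  by apply: is_derive_eq; rewrite addr0.
have E0 : (fun x => m^-1 * F x + (- F 0 / m))^`() = (cst m^-1) \* r.
  by apply/funext => x; rewrite derive1E; have [_ ->] := D x.
have rle0 x : x <= 0 -> r x = 0 by move=> x0; rewrite /r /flat ltNge x0 mul0r.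
have rge1 x : 1 <= x -> r x = 0.
  by move=> x1; rewrite /r mulrC /flat ltNge (_ : _ <= 0) ?mul0r//; lra.
exists (fun x => m^-1 * F x + (- F 0 / m)); split.
- have c2 : continuous (fun x => m^-1 * F x + (- F 0 / m)).
    by move=> x; apply: differentiable_continuous; apply/derivable1_diffP; have [] := D x.
  case=> [|k]; split => //; split; first by move=> x; have [] := D x.
  by rewrite E0; apply: Ck1M; [exact: Ck1_cst|exact: sr].
- move=> x; rewrite le_eqVlt => /predU1P[->|x0]; first by field; rewrite gt_eqF.
  have [d /andP[d0 d1] Ed] := is_derive_mvt DF x0.
  have : F x = F 0 by apply/eqP; rewrite eq_sym -subr_eq0 Ed rle0 ?mul0r// ltW.
  by move=> ->; field; rewrite gt_eqF.
- move=> x; rewrite le_eqVlt => /predU1P[<-|x0]; first by rewrite /m; field; rewrite gt_eqF.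
  have [d /andP[d0 d1] Ed] := is_derive_mvt DF x0.
  have : F x = F 1 by apply/eqP; rewrite -subr_eq0 Ed rge1 ?mul0r// ltW.
  by move=> ->; rewrite /m; field; rewrite gt_eqF.
- by move=> x; rewrite E0 /= mulr_ge0// invr_ge0 ltW.
Qed.

End Step.

(** * Integrals of bounded functions of bounded support *)

Section Tame.
Local Open Scope ereal_scope.
Context d (T : measurableType d) (R : realType) (mu : {measure set T -> \bar R}).
Implicit Types f g : T -> R.

(** Such functions are integrable, and stable under sums and under products with [bmeas] functions.
    Solutions are bounded and test functions have bounded support, so this class disposes of the
    integrability conditions in the computations below. *)
Definition tame f := measurable_fun setT f /\
  exists D (C : R), [/\ measurable D, mu D < +oo & forall x, (`|f x| <= C * \1_D x)%R].

Definition bmeas f := measurable_fun setT f /\ exists C : R, forall x, (`|f x| <= C)%R.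

Lemma tame_integrable f : tame f -> mu.-integrable setT (EFin \o f).
Proof.
move=> [mf [D [C [mD Doo fC]]]].
have iD : mu.-integrable setT (EFin \o (fun x => C * \1_D x)%R).
  rewrite (_ : _ \o _ = fun x => C%:E * (EFin \o \1_D) x); last first.
    by apply/funext => x /=; rewrite EFinM.
  apply: integrableZl => //; apply/integrableP; split.
    exact/measurable_EFinP/measurable_indic.
  rewrite (eq_integral (EFin \o \1_D)); last first.
    by move=> x _ /=; rewrite ger0_norm// indicE.
  by rewrite integral_indic// setIT.
apply: (le_integrable measurableT _ _ iD).
  by apply/measurable_EFinP.
move=> x _ /=; rewrite lee_fin; apply: (le_trans (fC x)); exact: ler_norm.
Qed.

Lemma tame_measurable f : tame f -> measurable_fun setT f. Proof. by case. Qed.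

Lemma tame_bmeas f : tame f -> bmeas f.
Proof.
move=> [mf [D [C [mD Doo fC]]]]; split => //; exists `|C|%R => x.
apply: (le_trans (fC x)); rewrite (le_trans (ler_norm _))// normrM.
by rewrite ler_piMr// ger0_norm ?indicE// lern1 leq_b1.
Qed.

Lemma bmeas_gt0 f : bmeas f -> exists2 C : R, (0 < C)%R & forall x, (`|f x| <= C)%R.
Proof.
move=> [_ [C fC]]; exists (`|C| + 1)%R; first by rewrite ltr_wpDl.
by move=> x; rewrite (le_trans (fC x))// (le_trans (ler_norm C))// lerDl.
Qed.

Lemma tame_norm f : tame f -> tame (fun x => `|f x|)%R.
Proof.
move=> [mf [D [C [mD Doo fC]]]]; split; first exact: measurableT_comp.
by exists D, C; split => // x; rewrite normr_id.
Qed.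

Lemma tameM f g : tame f -> bmeas g -> tame (fun x => f x * g x)%R.
Proof.
move=> [mf [D [C [mD Doo fC]]]] [mg [C' gC']]; split; first exact: measurable_funM.
exists D, (C * C')%R; split => // x.
by rewrite normrM mulrAC ler_pM.
Qed.

Lemma tameMr f g : bmeas f -> tame g -> tame (fun x => f x * g x)%R.
Proof.
by move=> bf tg; under eq_fun do rewrite mulrC; exact: tameM.
Qed.

Lemma tameD f g : tame f -> tame g -> tame (fun x => f x + g x)%R.
Proof.
move=> tf tg; have [C C0 fC] := bmeas_gt0 (tame_bmeas tf).
have [C' C'0 gC] := bmeas_gt0 (tame_bmeas tg).
case: tf => mf [D [c [mD Doo fc]]]; case: tg => mg [D' [c' [mD' D'oo gc]]].
split; first exact: measurable_funD.
exists (D `|` D'), (C + C')%R; split.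
- exact: measurableU.
- apply: le_lt_trans (measureU2 _ mD mD') _; exact: lte_add_pinfty.
- move=> x; rewrite indicE in_setU.
  have [xD|xD] := boolP (x \in D).
    by rewrite /= mulr1 (le_trans (ler_normD _ _))// lerD.
  have [xD'|xD'] := boolP (x \in D').
    by rewrite /= mulr1 (le_trans (ler_normD _ _))// lerD.
  rewrite /= mulr0.
  have := fc x; rewrite indicE (negbTE xD) mulr0 normr_le0 => /eqP ->.
  have := gc x; rewrite indicE (negbTE xD') mulr0 normr_le0 => /eqP ->.
  by rewrite addr0 normr0.
Qed.

Lemma tameZ (k : R) f : tame f -> tame (fun x => k * f x)%R.
Proof.
by move=> tf; apply: tameMr => //; split; [exact: measurable_cst|exists `|k|%R].
Qed.

Lemma tameN f : tame f -> tame (fun x => - f x)%R.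
Proof. by move=> /(tameZ (-1)); under eq_fun do rewrite mulN1r. Qed.

Lemma tameB f g : tame f -> tame g -> tame (fun x => f x - g x)%R.
Proof. by move=> tf /tameN; exact: tameD. Qed.

Lemma tame_le f g : measurable_fun setT f -> tame g ->
  (forall x, `|f x| <= g x)%R -> tame f.
Proof.
move=> mf [mg [D [C [mD Doo gC]]]] fg; split => //; exists D, C; split => // x.
by rewrite (le_trans _ (gC x))// (le_trans (fg x))// ler_norm.
Qed.

Lemma tame_indic D : measurable D -> mu D < +oo -> tame (\1_D : T -> R).
Proof.
move=> mD Doo; split; first exact: measurable_indic.
by exists D, 1%R; split => // x; rewrite mul1r indicE ger0_norm.
Qed.

Lemma bmeasM f g : bmeas f -> bmeas g -> bmeas (fun x => f x * g x)%R.
Proof.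
move=> [mf [C fC]] [mg [C' gC]]; split; first exact: measurable_funM.
by exists (C * C')%R => x; rewrite normrM ler_pM.
Qed.

Lemma bmeasD f g : bmeas f -> bmeas g -> bmeas (fun x => f x + g x)%R.
Proof.
move=> [mf [C fC]] [mg [C' gC]]; split; first exact: measurable_funD.
by exists (C + C')%R => x; rewrite (le_trans (ler_normD _ _))// lerD.
Qed.

Lemma bmeas_cst (c : R) : bmeas (fun=> c).
Proof. by split; [exact: measurable_cst|exists `|c|%R]. Qed.

Lemma bmeasB f g : bmeas f -> bmeas g -> bmeas (fun x => f x - g x)%R.
Proof.
move=> bf bg; apply: bmeasD => //.
by have := bmeasM (bmeas_cst (-1)) bg; under eq_fun do rewrite mulN1r.
Qed.

Lemma bmeas_norm f : bmeas f -> bmeas (fun x => `|f x|)%R.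
Proof.
move=> [mf [C fC]]; split; first exact: measurableT_comp.
by exists C => x; rewrite normr_id.
Qed.

End Tame.

Section TameIntegral.
Context d (T : measurableType d) (R : realType) (mu : {measure set T -> \bar R}).
Implicit Types f g : T -> R.
Notation I f := (\int[mu]_x f x).

Lemma tame_RintD f g : tame mu f -> tame mu g -> I (fun x => f x + g x) = I f + I g.
Proof. by move=> tf tg; rewrite RintegralD//; exact: tame_integrable. Qed.

Lemma tame_RintB f g : tame mu f -> tame mu g -> I (fun x => f x - g x) = I f - I g.
Proof. by move=> tf tg; rewrite RintegralB//; exact: tame_integrable. Qed.

Lemma tame_RintZ (k : R) f : tame mu f -> I (fun x => k * f x) = k * I f.
Proof. by move=> tf; rewrite RintegralZl//; exact: tame_integrable. Qed.

Lemma tame_le_Rint f g : tame mu f -> tame mu g -> (forall x, f x <= g x) -> I f <= I g.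
Proof. by move=> tf tg fg; apply: le_Rintegral => //; exact: tame_integrable. Qed.

Lemma tame_le_norm_Rint f : tame mu f -> `|I f| <= I (fun x => `|f x|).
Proof. by move=> tf; apply: le_normr_Rintegral => //; exact: tame_integrable. Qed.

Lemma tame_EFin_Rint f : tame mu f -> (\int[mu]_x (f x)%:E = (I f)%:E)%E.
Proof.
move=> tf; rewrite /Rintegral fineK//; apply: integrable_fin_num => //.
exact: tame_integrable.
Qed.

Lemma Rint_indic (D : set T) : measurable D -> I \1_D = fine (mu D).
Proof. by move=> mD; rewrite /Rintegral integral_indic// setIT. Qed.

End TameIntegral.

Section Plane.
Context {R : realType}.
Implicit Types (f g : R * R -> R).
Notation mu := (@lebesgue_measure R).

(** Preimages are countable unions of grid rectangles. This serves twice: to sample continuous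
    functions, and for the piecewise constant functions of the scheme. *)
Lemma measurable_step2 (G : int -> int -> R) (a b : R) :
  measurable_fun setT (fun p : R * R => G (Num.floor (p.1 * a)) (Num.floor (p.2 * b))).
Proof.
move=> _ Y mY; rewrite setTI.
pose E (ij : int * int) : set (R * R) :=
  if G ij.1 ij.2 \in Y then
    ((fun t : R => t * a) @^-1` `[ij.1%:~R, (ij.1 + 1)%:~R[) `*`
    ((fun t : R => t * b) @^-1` `[ij.2%:~R, (ij.2 + 1)%:~R[) else set0.
have -> : (fun p : R * R => G (Num.floor (p.1 * a)) (Num.floor (p.2 * b))) @^-1` Y = \bigcup_ij E ij.
  apply/seteqP; split=> [p Yp|p [[i j] _]].
    exists (Num.floor (p.1 * a), Num.floor (p.2 * b)); first by [].
    by rewrite /E /= mem_set//; split; rewrite /preimage /= in_itv/= floor_itv.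
  rewrite /E; case: ifPn => // /set_mem Yij [] /=.
  rewrite !in_itv/= => hi hj.
  by rewrite /preimage/= (floor_def hi) (floor_def hj).
apply: countable_bigcupT_measurable => [|[i j]]; first exact: countableP.
rewrite /E; case: ifP => // _; apply: measurableX.
  rewrite -[X in measurable X]setTI; apply: measurable_funM => //.
by rewrite -[X in measurable X]setTI; apply: measurable_funM.
Qed.

Lemma floor_grid_cvg (x : R) : (Num.floor (x * n.+1%:R))%:~R / n.+1%:R @[n --> \oo] --> x.
Proof.
apply/cvgrPdist_lt => e e0.
near=> n.
have n0 : 0 < n.+1%:R :> R by rewrite ltr0n.
have /andP[h1 h2] := floor_itv (x * n.+1%:R).
have {}h1 : (Num.floor (x * n.+1%:R))%:~R / n.+1%:R <= x by rewrite ler_pdivrMr.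
rewrite intrD in h2.
have {}h2 : x < (Num.floor (x * n.+1%:R))%:~R / n.+1%:R + n.+1%:R^-1.
  by rewrite -[X in _ + X]mul1r -mulrDl ltr_pdivlMr.
rewrite ger0_norm ?subr_ge0//.
rewrite ltrBlDl (lt_trans h2)// ltrD2l.
by near: n; exact: near_infty_natSinv_lt (PosNum e0).
Unshelve. all: by end_near.
Qed.

(** Measurability is meant for the product sigma-algebra. The function is the pointwise limit of its
    samples at the nodes of grids of mesh 1 / (n + 1), which are step functions. *)
Lemma continuous2_measurable f : continuous f -> measurable_fun setT f.
Proof.
move=> cf; pose G (n : nat) (i j : int) : R := f (i%:~R / n.+1%:R, j%:~R / n.+1%:R).
apply: (@measurable_fun_cvg _ _ _ setT (fun n (p : R * R) => G n (Num.floor (p.1 * n.+1%:R)) (Num.floor (p.2 * n.+1%:R))) f).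
  by move=> n; exact: measurable_step2.
move=> [x y] _; rewrite /G /=.
apply: continuous_cvg; first exact: cf.
exact: (cvg_pair (@floor_grid_cvg x) (@floor_grid_cvg y)).
Qed.

Definition square (N : R) : set (R * R) := `[- N, N] `*` `[- N, N].

Lemma squareP N p : square N p <-> `|p.1| <= N /\ `|p.2| <= N.
Proof. by rewrite /square /= !in_itv/= !ler_norml. Qed.

Lemma measurable_square N : measurable (square N).
Proof. by apply: measurableX; exact: measurable_itv. Qed.

Lemma compact_square N : compact (square N).
Proof. by apply: compact_setX; exact: segment_compact. Qed.

Lemma closed_square N : closed (square N).
Proof. apply: compact_closed; [exact: norm_hausdorff|exact: compact_square]. Qed.

Lemma leb2_rect (a b c d : R) : leb2 (`[a, b] `*` `[c, d]) = (mu `[a, b] * mu `[c, d])%E.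
Proof. by rewrite /leb2 product_measure1E. Qed.

Lemma leb2_square_lty N : (leb2 (square N) < +oo)%E.
Proof.
by rewrite leb2_rect lte_mul_pinfty// ?ge0_fin_numE// lebesgue_measure_itv/=; case: ifP => // _; rewrite ltry.
Qed.

Definition supp_square N f := forall p, ~ square N p -> f p = 0.

Lemma supp_squareP N f : supp_square N f <->
  forall p, f p != 0 -> `|p.1| <= N /\ `|p.2| <= N.
Proof.
split=> [H p fp|H p np]; first by apply/squareP; apply: contrapT => /H; exact/eqP.
by apply/eqP; apply/negPn/negP => /H /squareP.
Qed.

Lemma supp_square_indic N f (C : R) : supp_square N f -> (forall p, `|f p| <= C) ->
  forall p, `|f p| <= C * \1_(square N) p.
Proof.
move=> H fC p; rewrite indicE; have [/set_mem pN|/negP pN] := boolP (p \in square N).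
  by rewrite mulr1.
by rewrite mulr0 H ?normr0// => h; apply: pN; exact/mem_set.
Qed.

Lemma supp_square_tame N f : bmeas f -> supp_square N f -> tame leb2 f.
Proof.
move=> bf H; have [C C0 fC] := bmeas_gt0 bf; case: bf => mf _.
split => //; exists (square N), C; split.
- exact: measurable_square.
- exact: leb2_square_lty.
- exact: supp_square_indic.
Qed.

Lemma continuous_supp_bounded N f : continuous f -> supp_square N f ->
  exists2 C, 0 < C & forall p, `|f p| <= C.
Proof.
move=> cf H.
have /compact_bounded[M [Mr HM]] : compact (f @` square N).
  apply: continuous_compact; last exact: compact_square.
  exact: continuous_subspaceT.
exists (`|M| + 1); first by rewrite ltr_wpDl.
move=> p; have [pN|pN] := pselect (square N p); last by rewrite H// normr0 addr_ge0.
apply: (HM (`|M| + 1)); last by exists p.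
by rewrite (le_lt_trans (ler_norm _))// ltrDl.
Qed.

Lemma continuous_supp_bmeas N f : continuous f -> supp_square N f -> bmeas f.
Proof.
move=> cf H; have [C _ fC] := continuous_supp_bounded cf H.
by split; [exact: continuous2_measurable|exists C].
Qed.

Lemma continuous_supp_tame N f : continuous f -> supp_square N f -> tame leb2 f.
Proof. by move=> cf H; apply: (supp_square_tame _ H); exact: continuous_supp_bmeas H. Qed.

Lemma supp_square_compact N f : supp_square N f -> compact (supp f).
Proof.
move=> H; apply: (@subclosed_compact _ _ (square N)).
- exact: closed_closure.
- exact: compact_square.
- rewrite /supp [X in _ `<=` X](closure_id _).1; last exact: closed_square.
  apply: closure_subset => p /= fp; apply: contrapT => /H /eqP.
  by rewrite (negbTE fp).
Qed.

Lemma compact_supp_square f : compact (supp f) -> exists2 N, 0 < N & supp_square N f.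
Proof.
move=> /compact_bounded[M [Mr HM]]; exists (`|M| + 1); first by rewrite ltr_wpDl.
apply/supp_squareP => p fp.
have : `|p| <= `|M| + 1.
  apply: HM; last exact: subset_closure.
  by rewrite (le_lt_trans (ler_norm _))// ltrDl.
by rewrite prod_normE ge_max => /andP[].
Qed.

Lemma supp_square_partial N f : supp_square N f ->
  supp_square N (partial_t f) /\ supp_square N (partial_x f).
Proof.
have on : open (~` square N) by apply: closed_openC; exact: closed_square.
move=> H; split => p np.
- rewrite /partial_t (@near_eq_derive _ _ _ _ (cst 0)) ?derive_cst//.
  by apply: filterS (open_nbhs_nbhs (conj on np)) => q /H.
- rewrite /partial_x (@near_eq_derive _ _ _ _ (cst 0)) ?derive_cst//.
  by apply: filterS (open_nbhs_nbhs (conj on np)) => q /H.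
Qed.

End Plane.

(** * Iterated integrals of bounded functions *)

Section TameProdDef.
Context d1 d2 (T1 : measurableType d1) (T2 : measurableType d2) (R : realType).
Variables (m1 : {measure set T1 -> \bar R}) (m2 : {measure set T2 -> \bar R}).
Implicit Types f : T1 * T2 -> R.

(** The dominating set is a rectangle: every slice and every partial integral is then [tame] again,
    at all points and not only almost all. *)
Definition tame_prod f := measurable_fun setT f /\
  exists D1 D2 (C : R), [/\ measurable D1, (m1 D1 < +oo)%E, measurable D2, (m2 D2 < +oo)%E &
    forall p, `|f p| <= C * (\1_D1 p.1 * \1_D2 p.2)].

End TameProdDef.

Section FubiniTame.
Context d1 d2 (T1 : measurableType d1) (T2 : measurableType d2) (R : realType).
Variables (m1 : {sigma_finite_measure set T1 -> \bar R})
          (m2 : {sigma_finite_measure set T2 -> \bar R}).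
Implicit Types f : T1 * T2 -> R.

Lemma tame_prod_tame f : tame_prod m1 m2 f -> tame (m1 \x m2)%E f.
Proof.
move=> [mf [D1 [D2 [C [mD1 f1 mD2 f2 fC]]]]]; split => //; exists (D1 `*` D2), C; split.
- exact: measurableX.
- by rewrite [X in (X < _)%E](product_measure1E m1 m2 mD1 mD2) lte_mul_pinfty// ge0_fin_numE.
- move=> p; rewrite (le_trans (fC p))//.
  by rewrite !indicE in_setX -natrM mulnb.
Qed.

Lemma tame_prod_fst f x : tame_prod m1 m2 f -> tame m2 (fun y => f (x, y)).
Proof.
move=> [mf [D1 [D2 [C [mD1 f1 mD2 f2 fC]]]]].
split; first exact: measurable_fun_pair2.
exists D2, `|C|; split => // y; rewrite (le_trans (fC _))//= mulrA ler_wpM2r//.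
by rewrite (le_trans (ler_norm _))// normrM ler_piMr// indicE normr_nat lern1 leq_b1.
Qed.

Lemma tame_prod_snd f y : tame_prod m1 m2 f -> tame m1 (fun x => f (x, y)).
Proof.
move=> [mf [D1 [D2 [C [mD1 f1 mD2 f2 fC]]]]].
split; first exact: measurable_fun_pair1.
exists D1, `|C|; split => // x; rewrite (le_trans (fC _))//= [_ * \1_D2 _]mulrC mulrA ler_wpM2r//.
by rewrite (le_trans (ler_norm _))// normrM ler_piMr// indicE normr_nat lern1 leq_b1.
Qed.

Lemma tame_prod_FE f : tame_prod m1 m2 f ->
  fubini_F m2 (EFin \o f) = EFin \o (fun x => \int[m2]_y f (x, y)).
Proof.
move=> tf; apply/funext => x; rewrite /fubini_F /=.
by rewrite -tame_EFin_Rint//; exact: tame_prod_fst.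
Qed.

Lemma tame_prod_GE f : tame_prod m1 m2 f ->
  fubini_G m1 (EFin \o f) = EFin \o (fun y => \int[m1]_x f (x, y)).
Proof.
move=> tf; apply/funext => x; rewrite /fubini_G /=.
by rewrite -tame_EFin_Rint//; exact: tame_prod_snd.
Qed.

Lemma tame_prod_Rint12 f : tame_prod m1 m2 f ->
  \int[m1]_x \int[m2]_y f (x, y) = \int[(m1 \x m2)%E]_z f z.
Proof.
move=> tf; rewrite /Rintegral -(integral12_prod_meas1 (tame_integrable (tame_prod_tame tf))).
by rewrite tame_prod_FE.
Qed.

Lemma tame_prod_Rint21 f : tame_prod m1 m2 f ->
  \int[m2]_y \int[m1]_x f (x, y) = \int[(m1 \x m2)%E]_z f z.
Proof.
move=> tf; rewrite /Rintegral -(integral21_prod_meas1 (tame_integrable (tame_prod_tame tf))).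
by rewrite tame_prod_GE.
Qed.

Lemma tame_prod_swap f : tame_prod m1 m2 f ->
  \int[m1]_x \int[m2]_y f (x, y) = \int[m2]_y \int[m1]_x f (x, y).
Proof. by move=> tf; rewrite tame_prod_Rint12// tame_prod_Rint21. Qed.

Lemma tame_prod_int_fst f : tame_prod m1 m2 f -> tame m1 (fun x => \int[m2]_y f (x, y)).
Proof.
move=> tf; split.
  have := measurable_fubini_F (tame_integrable (tame_prod_tame tf)).
  by rewrite tame_prod_FE// => /measurable_EFinP.
have [mf [D1 [D2 [C [mD1 f1 mD2 f2 fC]]]]] := tf.
exists D1, (C * fine (m2 D2)); split => // x.
have tx := tame_prod_fst x tf.
rewrite (le_trans (tame_le_norm_Rint tx))//.
have tD : tame m2 (\1_D2 : T2 -> R) by exact: tame_indic.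
rewrite (_ : _ * _ = \int[m2]_y (C * \1_D1 x * \1_D2 y)); last first.
  by rewrite (tame_RintZ _ tD) Rint_indic// mulrAC.
apply: tame_le_Rint; [exact: tame_norm|exact: tameZ|move=> y].
by rewrite -mulrA; exact: fC.
Qed.

Lemma tame_prod_int_snd f : tame_prod m1 m2 f -> tame m2 (fun y => \int[m1]_x f (x, y)).
Proof.
move=> tf; split.
  have := measurable_fubini_G (tame_integrable (tame_prod_tame tf)).
  by rewrite tame_prod_GE// => /measurable_EFinP.
have [mf [D1 [D2 [C [mD1 f1 mD2 f2 fC]]]]] := tf.
exists D2, (C * fine (m1 D1)); split => // y.
have ty := tame_prod_snd y tf.
rewrite (le_trans (tame_le_norm_Rint ty))//.
have tD : tame m1 (\1_D1 : T1 -> R) by exact: tame_indic.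
rewrite (_ : _ * _ = \int[m1]_x (C * \1_D2 y * \1_D1 x)); last first.
  by rewrite (tame_RintZ _ tD) Rint_indic// mulrAC.
apply: tame_le_Rint; [exact: tame_norm|exact: tameZ|move=> x].
by rewrite -mulrA [\1_D2 y * _]mulrC; exact: fC.
Qed.

End FubiniTame.

Section PlaneFubini.
Context {R : realType}.

Lemma leb2_sigma_finite : sigma_finite setT (@leb2 R).
Proof.
exists (fun n => square n%:R).
  apply/seteqP; split => // p _.
  exists (Num.truncn (`|p.1| + `|p.2|)).+1 => //.
  have h := truncnS_gt (`|p.1| + `|p.2|).
  by apply/squareP; rewrite !ltW// (le_lt_trans _ h)// ?lerDl ?lerDr.
by move=> n; split; [exact: measurable_square|exact: leb2_square_lty].
Qed.

(* The sigma-finite structure is put on an alias, so that leb2 keeps the measure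
   structure of the product. *)
Definition plane_measure := @leb2 R.
HB.instance Definition _ := Measure.on plane_measure.
HB.instance Definition _ :=
  Measure_isSigmaFinite.Build _ _ _ plane_measure leb2_sigma_finite.

Lemma leb2_tame_prod_swap (f : (R * R) * (R * R) -> R) : tame_prod leb2 leb2 f ->
  \int[leb2]_p \int[leb2]_q f (p, q) = \int[leb2]_q \int[leb2]_p f (p, q).
Proof. exact: (@tame_prod_swap _ _ _ _ _ plane_measure plane_measure). Qed.

Lemma leb2_tame_prod_int_fst (f : (R * R) * (R * R) -> R) : tame_prod leb2 leb2 f ->
  tame leb2 (fun p => \int[leb2]_q f (p, q)).
Proof. exact: (@tame_prod_int_fst _ _ _ _ _ plane_measure plane_measure). Qed.

Lemma leb2_tame_prod_int_snd (f : (R * R) * (R * R) -> R) : tame_prod leb2 leb2 f ->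
  tame leb2 (fun q => \int[leb2]_p f (p, q)).
Proof. exact: (@tame_prod_int_snd _ _ _ _ _ plane_measure plane_measure). Qed.

Lemma leb2_tame_prod_fst (f : (R * R) * (R * R) -> R) p : tame_prod leb2 leb2 f ->
  tame leb2 (fun q => f (p, q)).
Proof. exact: (@tame_prod_fst _ _ _ _ _ plane_measure plane_measure). Qed.

Lemma leb2_tame_prod_snd (f : (R * R) * (R * R) -> R) q : tame_prod leb2 leb2 f ->
  tame leb2 (fun p => f (p, q)).
Proof. exact: (@tame_prod_snd _ _ _ _ _ plane_measure plane_measure). Qed.

End PlaneFubini.

Section DCT.
Context d (T : measurableType d) (R : realType) (mu : {measure set T -> \bar R}).
Lemma tame_dct (f_ : nat -> T -> R) (f g : T -> R) :
  (forall n, measurable_fun setT (f_ n)) -> measurable_fun setT f -> tame mu g ->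
  (forall n x, `|f_ n x| <= g x) ->
  {ae mu, forall x, f_ n x @[n --> \oo] --> f x} ->
  \int[mu]_x f_ n x @[n --> \oo] --> \int[mu]_x f x.
Proof.
move=> mf_ mf tg fg ff.
have tf_ n : tame mu (f_ n) by exact: tame_le tg (fg n).
have [] := @dominated_convergence _ T R mu setT measurableT (fun n => EFin \o f_ n)
   (EFin \o f) (EFin \o g).
- by move=> n; exact/measurable_EFinP.
- exact/measurable_EFinP.
- apply: filterS ff => x ffx _; apply: cvg_EFin; last exact: ffx.
  by near=> n.
- exact: tame_integrable.
- by apply: aeW => x n _ /=; rewrite lee_fin.
move=> int_f _ cv.
rewrite /Rintegral; apply: fine_cvg.
rewrite fineK; first exact: cv.
exact: integrable_fin_num.
Unshelve. all: by end_near.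
Qed.

Lemma tame_dct0 (f_ : nat -> T -> R) (g : T -> R) :
  (forall n, measurable_fun setT (f_ n)) -> tame mu g ->
  (forall n x, `|f_ n x| <= g x) ->
  {ae mu, forall x, f_ n x @[n --> \oo] --> 0} ->
  \int[mu]_x f_ n x @[n --> \oo] --> 0.
Proof.
move=> mf_ tg fg ff.
have := @tame_dct f_ (cst 0) g mf_ (measurable_cst _) tg fg ff.
by rewrite Rintegral_cst// mul0r.
Qed.
End DCT.

(** * Mollification *)

Section Mollify1.
Context {R : realType}.
Notation mu := (@lebesgue_measure R).

Lemma lebesgue_itv_lty (a b : R) : (mu `[a, b] < +oo)%E.
Proof. by rewrite /= lebesgue_measure_itv/=; case: ifP => // _; rewrite ltry. Qed.

(** The box kernel, left without normalisation. Averages against it are those of the Lebesgue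
    differentiation theorem, and the smooth kernels below are dominated by it. *)
Definition near_ind (e s : R) : R := \1_(ball (0 : R) e) s.

Lemma near_indE e s : near_ind e s = (`|s| < e)%R%:R.
Proof.
rewrite /near_ind indicE; congr (_%:R); congr nat_of_bool.
by apply/idP/idP => [/set_mem|h]; rewrite ?inE /ball/= sub0r normrN.
Qed.

Lemma measurable_near_ind e : measurable_fun setT (near_ind e).
Proof. by apply: measurable_indic; exact: measurable_ball. Qed.

Lemma near_indC e (x y : R) : near_ind e (x - y) = near_ind e (y - x).
Proof. by rewrite !near_indE distrC. Qed.

Lemma near_ind_tame e (x : R) : 0 <= e -> tame mu (fun y => near_ind e (x - y)).
Proof.
move=> e0; rewrite (_ : (fun _ => _) = \1_(ball x e)).
  apply: tame_indic; first exact: measurable_ball.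
  by have := lebesgue_measure_ball x e0 => /= ->; rewrite ltry.
apply/funext => y; rewrite near_indE indicE; congr (_%:R); congr nat_of_bool.
by apply/idP/idP => [h|/set_mem]; rewrite ?inE.
Qed.

Lemma Rint_near_ind e (x : R) : 0 <= e -> \int[mu]_y near_ind e (x - y) = e *+ 2.
Proof.
move=> e0; rewrite (_ : (fun _ => _) = \1_(ball x e)).
  rewrite Rint_indic; last exact: measurable_ball.
  by have := lebesgue_measure_ball x e0 => /= ->.
apply/funext => y; rewrite near_indE indicE; congr (_%:R); congr nat_of_bool.
by apply/idP/idP => [h|/set_mem]; rewrite ?inE.
Qed.

Lemma tame_prod_osc (h : R -> R) (N e : R) : bmeas h -> 0 < e ->
  tame_prod mu mu (fun p : R * R => \1_(`[- N, N] : set R) p.1 *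
    (e^-1 * (`|h p.2 - h p.1| * near_ind e (p.1 - p.2)))).
Proof.
move=> bh e0; have [C C0 hC] := bmeas_gt0 bh; have [mh _] := bh.
split.
  apply: measurable_funM.
    by apply: measurableT_comp => //; apply: measurable_indic; exact: measurable_itv.
  apply: measurable_funM => //; apply: measurable_funM.
    apply: measurableT_comp => //; apply: measurable_funB; exact: measurableT_comp.
  apply: measurableT_comp; first exact: measurable_near_ind.
  by apply: measurable_funB.
exists `[- N, N], `[- (N + e), N + e], (e^-1 * (C + C)); split => //.
- exact: lebesgue_itv_lty.
- exact: lebesgue_itv_lty.
- move=> [x y] /=; rewrite !indicE !mem_setE !in_itv/= -!ler_norml near_indE.
  have [xN|_] := leP `|x| N; last by rewrite !mul0r mulr0 normr0.
  rewrite mul1r mul1r.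
  have [xy|_] := ltP `|x - y| e; last first.
    by rewrite !mulr0 normr0 mulr_ge0 ?ler0n// mulr_ge0 ?invr_ge0 ?(ltW e0)// addr_ge0 ?ltW.
  have -> : `|y| <= N + e.
    by rewrite -(subrK x y) (le_trans (ler_normD _ _))// addrC lerD// distrC ltW.
  rewrite !mulr1 normrM ger0_norm ?invr_ge0 ?(ltW e0)// ler_wpM2l ?invr_ge0 ?(ltW e0)//.
  by rewrite normr_id (le_trans (ler_normB _ _))// lerD.
Qed.

Definition osc1 (h : R -> R) (N e : R) : R :=
  \int[mu]_x (\1_(`[- N, N] : set R) x * \int[mu]_y (e^-1 * (`|h y - h x| * near_ind e (x - y)))).

(** The inner integral is twice the averaged deviation of the Lebesgue differentiation theorem, so
    it tends to 0 at almost every x; the bound on h provides the dominating function. *)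
Lemma osc1_cvg0 (h : R -> R) (N : R) (e : nat -> R) : bmeas h ->
  (forall n, 0 < e n) -> e n @[n --> \oo] --> 0 -> osc1 h N (e n) @[n --> \oo] --> 0.
Proof.
move=> bh e0 ecv.
have [C C0 hC] := bmeas_gt0 bh; have [mh _] := bh.
have loc : locally_integrable setT h.
  split => //; first exact: openT.
  move=> K _ cK; apply: (@le_lt_trans _ _ (\int[mu]_(x in K) C%:E)%E).
    apply: ge0_le_integral => //.
    - exact: compact_measurable.
    - by apply/measurable_EFinP; apply: measurableT_comp => //; exact: measurable_funS mh.
    - by move=> x _; rewrite lee_fin.
  rewrite integral_cst; last exact: compact_measurable.
  by rewrite lte_mul_pinfty// ?lee_fin 1?ltW// compact_finite_measure.
have inner n x : \int[mu]_y ((e n)^-1 * (`|h y - h x| * near_ind (e n) (x - y))) = 2 * fine (davg h x (e n)).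
  have tx : tame mu (fun y => `|h y - h x| * near_ind (e n) (x - y)).
    apply: tameMr; last by apply: near_ind_tame; exact: ltW.
    by apply: bmeas_norm; apply: bmeasB => //; exact: bmeas_cst.
  rewrite tame_RintZ// /davg /iavg.
  have eb : mu (ball x (e n)) = (e n *+ 2)%:E by exact: (lebesgue_measure_ball x (ltW (e0 n))).
  rewrite [X in fine (X^-1 * _)]eb.
  have -> : (\int[mu]_(y in ball x (e n)) `|((center (h x) \o h) y)%:E| =
     (\int[mu]_y (`|h y - h x| * near_ind (e n) (x - y)))%:E)%E.
    rewrite -tame_EFin_Rint// [LHS]integral_mkcond; apply: eq_integral => y _.
    rewrite patchE near_indE /=.
    have [xy|xy] := ltP `|x - y| (e n); first by rewrite mem_set//= mulr1.
    by rewrite memNset ?mulr0//; apply/negP; rewrite -leNgt.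
  rewrite inver mulrn_eq0/= gt_eqF// -EFinM /= -mulr_natr.
  by field; rewrite gt_eqF.
rewrite /osc1.
pose F n := fun p : R * R => \1_(`[- N, N] : set R) p.1 *
    ((e n)^-1 * (`|h p.2 - h p.1| * near_ind (e n) (p.1 - p.2))).
have tF n : tame_prod mu mu (F n) by exact: tame_prod_osc.
have FE n x : \int[mu]_y F n (x, y) = \1_(`[- N, N] : set R) x *
   \int[mu]_y ((e n)^-1 * (`|h y - h x| * near_ind (e n) (x - y))).
  rewrite /F /= tame_RintZ//; apply: tameZ; apply: tameMr; last by apply: near_ind_tame; exact: ltW.
  by apply: bmeas_norm; apply: bmeasB => //; exact: bmeas_cst.
under eq_fun do under eq_Rintegral do rewrite -FE.
have mN : measurable (`[- N, N] : set R) by [].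
have mNoo := lebesgue_itv_lty (- N) N.
apply: (@tame_dct0 _ _ R mu (fun n x => \int[mu]_y F n (x, y)) (fun x : R => 4 * C * \1_(`[- N, N] : set R) x)).
- by move=> n; apply: tame_measurable; exact: tame_prod_int_fst (tF n).
- by apply: tameZ; exact: tame_indic.
- move=> n x; have tx := tame_prod_fst x (tF n).
  apply: (le_trans (tame_le_norm_Rint tx)).
  have tg : tame mu (fun y => (2 * C * (e n)^-1 * \1_(`[- N, N] : set R) x) * near_ind (e n) (x - y)).
    by apply: tameZ; apply: near_ind_tame; exact: ltW.
  apply: (@le_trans _ _ (\int[mu]_y ((2 * C * (e n)^-1 * \1_(`[- N, N] : set R) x) * near_ind (e n) (x - y)))).
    apply: tame_le_Rint => //; first exact: tame_norm.
    move=> y; rewrite /F /= !normrM normr_id.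
    rewrite [X in X * _]ger0_norm ?indicE// [X in _ * (X * _)]ger0_norm ?invr_ge0 ?(ltW (e0 n))//.
    rewrite [X in _ * (_ * (_ * X))]ger0_norm; last by rewrite near_indE.
    have b0 : 0 <= near_ind (e n) (x - y) by rewrite near_indE.
    have a0 : 0 <= (x \in `[- N, N]%classic)%:R :> R by [].
    have k0 : 0 <= (e n)^-1 by rewrite invr_ge0 ltW.
    have d0 : `|h y - h x| <= 2 * C.
      by rewrite (le_trans (ler_normB _ _))// mulr_natl mulr2n lerD.
    move: a0 k0 b0 d0; set a := (x \in _)%:R; set k := (e n)^-1; set b := near_ind _ _.
    set dd := `|_| => a0 k0 b0 d0.
    rewrite (_ : a * _ = (a * k * b) * dd); last by ring.
    rewrite [leRHS](_ : _ = (a * k * b) * (2 * C)); last by ring.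
    by rewrite ler_wpM2l// !mulr_ge0.
  rewrite tame_RintZ; last by apply: near_ind_tame; exact: ltW.
  rewrite Rint_near_ind ?(ltW (e0 n))// -mulr_natr.
  by rewrite le_eqVlt; apply/orP; left; apply/eqP; field; rewrite gt_eqF.
- move: (lebesgue_differentiation loc); apply: filterS.
    exact: (ae_filter_ringOfSetsType mu).
  move=> x lx.
  under eq_fun do rewrite FE inner.
  rewrite -(mulr0 (\1_(`[- N, N] : set R) x)); apply: cvgM; first exact: cvg_cst.
  rewrite -[X in _ --> X](mulr0 2); apply: cvgM; first exact: cvg_cst.
  apply: fine_cvg.
  apply: (cvg_comp e (davg h x) _ lx).
  (* The differentiation theorem concerns radii tending to 0 from the right; the sequence belongs to
     this filter because its terms are positive. *)
  move=> A [r /= r0 rA]; have H : \forall n \near \oo, ball (0 : R) r (e n) := ecv _ (nbhsx_ballx 0 r r0).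
  by apply: (@filterS _ (nbhs \oo) _ _ _ _ H) => n en; exact: (rA (e n) en (e0 n)).
Qed.
End Mollify1.
Section Mollify2.
Context {R : realType}.
Notation mu := (@lebesgue_measure R).
Implicit Types (g : R * R -> R).

Lemma leb2_Rint12 (f : R * R -> R) : tame_prod mu mu f ->
  \int[leb2]_z f z = \int[mu]_x \int[mu]_y f (x, y).
Proof. by move=> tf; rewrite tame_prod_Rint12. Qed.

Lemma leb2_Rint21 (f : R * R -> R) : tame_prod mu mu f ->
  \int[leb2]_z f z = \int[mu]_y \int[mu]_x f (x, y).
Proof. by move=> tf; rewrite tame_prod_Rint21. Qed.

Lemma square_indicE N (p : R * R) :
  \1_(square N) p = \1_(`[- N, N] : set R) p.1 * \1_(`[- N, N] : set R) p.2 :> R.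
Proof. by case: p => x y; rewrite !indicE in_setX -natrM mulnb. Qed.

Lemma near_ind_ge0 (e s : R) : 0 <= near_ind e s.
Proof. by rewrite near_indE. Qed.

Lemma tame_prod_supp_square (f : R * R -> R) N (C : R) : measurable_fun setT f ->
  (forall p, `|f p| <= C * \1_(square N) p) -> tame_prod mu mu f.
Proof.
move=> mf fC; split => //; exists `[- N, N], `[- N, N], C.
split => //; [exact: lebesgue_itv_lty|exact: lebesgue_itv_lty|].
by move=> p; rewrite -square_indicE.
Qed.

Lemma tame_avg (k : R -> R) (e x : R) : 0 < e -> bmeas k ->
  tame mu (fun y => e^-1 * (k y * near_ind e (x - y))).
Proof.
by move=> e0 bk; apply: tameZ; apply: tameMr => //; apply: near_ind_tame; exact: ltW.
Qed.

Lemma avg_le (k : R -> R) (C e x : R) : 0 < e -> measurable_fun setT k ->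
  (forall y, `|k y| <= C) -> `|\int[mu]_y (e^-1 * (k y * near_ind e (x - y)))| <= 2 * C.
Proof.
move=> e0 mk kC; have bk : bmeas k by split => //; exists C.
apply: (le_trans (tame_le_norm_Rint (tame_avg x e0 bk))).
have tn := near_ind_tame x (ltW e0).
apply: (@le_trans _ _ (\int[mu]_y (e^-1 * C * near_ind e (x - y)))).
  apply: tame_le_Rint; [exact/tame_norm/tame_avg|exact: tameZ|] => y.
  rewrite !normrM [X in X * _]ger0_norm ?invr_ge0 ?(ltW e0)// -mulrA.
  rewrite ler_wpM2l ?invr_ge0 ?(ltW e0)// [X in _ * X]ger0_norm ?near_ind_ge0//.
  by rewrite ler_wpM2r ?near_ind_ge0.
rewrite tame_RintZ// Rint_near_ind ?(ltW e0)// -mulr_natr.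
by rewrite le_eqVlt; apply/orP; left; apply/eqP; field; rewrite gt_eqF.
Qed.

Definition slice_osc g (N e : R) (p : R * R) : R := \1_(square N) p *
  \int[mu]_y (e^-1 * (`|g (p.1, y) - g p| * near_ind e (p.2 - y))).

Lemma slice_osc_bound g N e (C : R) : measurable_fun setT g -> 0 < e -> (forall p, `|g p| <= C) ->
  forall p, `|slice_osc g N e p| <= 4 * C * \1_(square N) p.
Proof.
move=> mg e0 gC p; have i0 : 0 <= \1_(square N) p :> R by rewrite indicE.
rewrite /slice_osc normrM mulrC (ger0_norm i0) ler_wpM2r//.
rewrite (_ : 4 * C = 2 * (C + C)); last by ring.
apply: avg_le => // [|y].
  apply: measurableT_comp => //; apply: measurable_funB => //.
  exact: measurable_fun_pair2.
by rewrite normr_id (le_trans (ler_normB _ _))// lerD.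
Qed.

Lemma measurable_slice_osc g N e : bmeas g -> 0 < e -> measurable_fun setT (slice_osc g N e).
Proof.
move=> bg e0; have [C C0 gC] := bmeas_gt0 bg; have [mg _] := bg.
pose F (z : (R * R) * R) := \1_(square N) z.1 *
  (e^-1 * (`|g (z.1.1, z.2) - g z.1| * near_ind e (z.1.2 - z.2))).
have tF : tame_prod leb2 mu F.
  split.
    apply: measurable_funM.
      by apply: measurableT_comp => //; apply: measurable_indic; exact: measurable_square.
    apply: measurable_funM => //; apply: measurable_funM.
      apply: measurableT_comp => //; apply: measurable_funB.
        apply: measurableT_comp => //; apply: measurable_fun_pair => //.
        exact: measurableT_comp.
      exact: measurableT_comp.
    apply: measurableT_comp; first exact: measurable_near_ind.
    by apply: measurable_funB => //; exact: measurableT_comp.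
  exists (square N), `[- (N + e), N + e], (e^-1 * (C + C)).
  split; [exact: measurable_square|exact: leb2_square_lty|by []|exact: lebesgue_itv_lty|].
  move=> [[t x] y]; rewrite /F /= square_indicE /= !indicE !mem_setE !in_itv/= -!ler_norml near_indE.
  have [xt|_] := leP `|t| N; last by rewrite !mul0r mulr0 normr0.
  have [xN|_] := leP `|x| N; last by rewrite mulr0 !mul0r mulr0 normr0.
  rewrite !mul1r.
  have [xy|_] := ltP `|x - y| e; last first.
    by rewrite !mulr0 normr0 mulr_ge0 ?ler0n// mulr_ge0 ?invr_ge0 ?(ltW e0)// addr_ge0 ?ltW.
  have -> : `|y| <= N + e.
    by rewrite -(subrK x y) (le_trans (ler_normD _ _))// addrC lerD// distrC ltW.
  rewrite !mulr1 normrM ger0_norm ?invr_ge0 ?(ltW e0)// ler_wpM2l ?invr_ge0 ?(ltW e0)//.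
  by rewrite normr_id (le_trans (ler_normB _ _))// lerD.
have := tame_measurable (@tame_prod_int_fst _ _ _ _ _ (@plane_measure R) mu F tF).
congr (measurable_fun _ _); apply/funext => p.
rewrite /F /slice_osc /= tame_RintZ//; apply: tame_avg => //.
by apply/bmeas_norm/bmeasB; [split; [exact: measurable_fun_pair2|exists C => y; exact: gC]|exact: bmeas_cst].
Qed.

Lemma slice_osc_cvg0 g N (e : nat -> R) : bmeas g ->
  (forall n, 0 < e n) -> e n @[n --> \oo] --> 0 ->
  \int[leb2]_p slice_osc g N (e n) p @[n --> \oo] --> 0.
Proof.
move=> bg e0 ecv; have [C C0 gC] := bmeas_gt0 bg; have [mg _] := bg.
have tS n : tame_prod mu mu (slice_osc g N (e n)).
  apply: (tame_prod_supp_square (N := N) (C := 4 * C)); first exact: measurable_slice_osc.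
  exact: slice_osc_bound.
under eq_fun do rewrite leb2_Rint12//.
have iE n t : \int[mu]_x slice_osc g N (e n) (t, x) =
    \1_(`[- N, N] : set R) t * osc1 (fun x => g (t, x)) N (e n).
  rewrite /osc1 -tame_RintZ.
    by apply: eq_Rintegral => x _; rewrite /slice_osc square_indicE /= mulrA.
  have bgt : bmeas (fun x => g (t, x)).
    by split; [exact: measurable_fun_pair2|exists C].
  have := tame_prod_int_fst (tame_prod_osc N bgt (e0 n)).
  congr (tame _ _); apply/funext => x /=; rewrite tame_RintZ//; apply: tame_avg => //.
  by apply/bmeas_norm/bmeasB => //; exact: bmeas_cst.
have tN : tame mu (\1_(`[- N, N] : set R)) by apply: tame_indic => //; exact: lebesgue_itv_lty.
apply: (@tame_dct0 _ _ R (@lebesgue_measure R) _ (fun t : R => 4 * C * fine (mu `[- N, N]) * \1_(`[- N, N] : set R) t)).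
- by move=> n; apply: tame_measurable; exact: tame_prod_int_fst (tS n).
- exact: tameZ.
- move=> n t; have tx := tame_prod_fst t (tS n).
  apply: (le_trans (tame_le_norm_Rint tx)).
  rewrite -Rint_indic// mulrAC -tame_RintZ//.
  apply: tame_le_Rint; [exact: tame_norm|exact: tameZ|move=> x].
  apply: le_trans (slice_osc_bound _ mg (e0 n) gC _) _.
  by rewrite square_indicE mulrA.
- apply: aeW => t; under eq_fun do rewrite iE.
  rewrite -(mulr0 (\1_(`[- N, N] : set R) t)); apply: cvgM; first exact: cvg_cst.
  apply: osc1_cvg0 => //; split; first exact: measurable_fun_pair2.
  by exists C.
Qed.

Definition osc2 g (N e : R) : R := \int[leb2]_p \int[leb2]_q
  (\1_(square N) p * (e^-2 * (`|g q - g p| * (near_ind e (p.1 - q.1) * near_ind e (p.2 - q.2))))).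

Definition transp g : R * R -> R := fun p => g (p.2, p.1).

Lemma bmeas_transp g : bmeas g -> bmeas (transp g).
Proof.
move=> [mg [C gC]]; split; last by exists C => p; exact: gC.
by apply: measurableT_comp => //; apply: measurable_fun_pair.
Qed.

Lemma near_prod_supp N e (p q : R * R) (c C : R) : 0 <= c -> 0 < e -> `|c| <= C ->
  `|\1_(square N) p * (c * (near_ind e (p.1 - q.1) * near_ind e (p.2 - q.2)))| <=
  C * (\1_(square N) p * \1_(square (N + e)) q).
Proof.
move=> c0 e0 cC; case: p q => [t x] [s y] /=.
rewrite !square_indicE /= !indicE !mem_setE !in_itv/= -!ler_norml !near_indE.
have [xt|_] := leP `|t| N; last by rewrite !mul0r mulr0 normr0.
have [xN|_] := leP `|x| N; last by rewrite mulr0 !mul0r mulr0 normr0.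
rewrite !mul1r.
have nn (a b : bool) : 0 <= C * (a%:R * b%:R).
  by rewrite mulr_ge0 ?mulr_ge0// (le_trans _ cC).
have [ts|_] := ltP `|t - s| e; last by rewrite mul0r mulr0 normr0.
have [xy|_] := ltP `|x - y| e; last by rewrite !mulr0 normr0.
have -> : `|s| <= N + e.
  by rewrite -(subrK t s) (le_trans (ler_normD _ _))// addrC lerD// distrC ltW.
have -> : `|y| <= N + e.
  by rewrite -(subrK x y) (le_trans (ler_normD _ _))// addrC lerD// distrC ltW.
by rewrite !mulr1.
Qed.

Lemma measurable_near_prod e :
  measurable_fun setT (fun z : (R * R) * (R * R) => near_ind e (z.1.1 - z.2.1) * near_ind e (z.1.2 - z.2.2)).
Proof.
apply: measurable_funM; apply: measurableT_comp; try exact: measurable_near_ind.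
- by apply: measurable_funB; apply: measurableT_comp.
- by apply: measurable_funB; apply: measurableT_comp.
Qed.

Lemma tame_prod_near (a : (R * R) * (R * R) -> R) N e C : 0 < e -> measurable_fun setT a ->
  (forall z, 0 <= a z <= C) ->
  tame_prod leb2 leb2 (fun z => \1_(square N) z.1 *
    (a z * (near_ind e (z.1.1 - z.2.1) * near_ind e (z.1.2 - z.2.2)))).
Proof.
move=> e0 ma aC; split.
  apply: measurable_funM.
    by apply: measurableT_comp => //; apply: measurable_indic; exact: measurable_square.
  by apply: measurable_funM => //; exact: measurable_near_prod.
exists (square N), (square (N + e)), C; split; try exact: measurable_square; try exact: leb2_square_lty.
move=> [p q] /=; have /andP[a0 aC'] := aC (p, q).
by apply: near_prod_supp => //; rewrite ger0_norm.
Qed.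

Lemma tame_prod_transp (f : R * R -> R) : tame_prod mu mu f -> tame_prod mu mu (transp f).
Proof.
move=> [mf [D1 [D2 [C [mD1 D1oo mD2 D2oo fC]]]]]; split.
  by apply: measurableT_comp => //; apply: measurable_fun_pair.
by exists D2, D1, C; split => // p; rewrite (le_trans (fC _))//= [X in C * X]mulrC.
Qed.

Lemma transp_Rint (f : R * R -> R) : tame_prod mu mu f ->
  \int[leb2]_p transp f p = \int[leb2]_p f p.
Proof.
by move=> tf; rewrite leb2_Rint21 ?leb2_Rint12//; exact: tame_prod_transp.
Qed.

Lemma tame_prod_near_snd (k : R -> R) e (p : R * R) : 0 < e -> bmeas k ->
  tame_prod mu mu (fun q : R * R => e^-2 * (k q.2 * (near_ind e (p.1 - q.1) * near_ind e (p.2 - q.2)))).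
Proof.
move=> e0 bk; have [C C0 kC] := bmeas_gt0 bk; have [mk _] := bk.
pose a (z : (R * R) * (R * R)) := e^-2 * (k z.2.2 * (near_ind e (z.1.1 - z.2.1) * near_ind e (z.1.2 - z.2.2))).
have ma : measurable_fun setT a.
  apply: measurable_funM => //; apply: measurable_funM; last exact: measurable_near_prod.
  by apply: measurableT_comp => //; apply: measurableT_comp.
apply: (tame_prod_supp_square (N := `|p.1| + `|p.2| + e) (C := e^-2 * C)).
  exact: (measurable_fun_pair2 p ma).
move=> q; rewrite normrM [X in X * _ <= _]ger0_norm ?invr_ge0 ?exprn_ge0 ?(ltW e0)//.
rewrite -mulrA ler_wpM2l ?invr_ge0 ?exprn_ge0 ?(ltW e0)//.
rewrite normrM !near_indE; case: ltP => [h1|_]; last by rewrite mul0r normr0 mulr0 mulr_ge0// ?ltW// indicE.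
case: ltP => [h2|_]; last by rewrite mulr0 normr0 mulr0 mulr_ge0// ?ltW// indicE.
rewrite !mulr1 normr1 mulr1 indicE mem_set ?mulr1//; apply/squareP; split.
  by have := ler_normD (q.1 - p.1) p.1; rewrite subrK distrC; have := normr_ge0 p.2; lra.
by have := ler_normD (q.2 - p.2) p.2; rewrite subrK distrC; have := normr_ge0 p.1; lra.
Qed.

Lemma tame_near_snd (k : R -> R) e (p : R * R) : 0 < e -> bmeas k ->
  tame leb2 (fun q : R * R => e^-2 * (k q.2 * (near_ind e (p.1 - q.1) * near_ind e (p.2 - q.2)))).
Proof. by move=> e0 bk; exact/tame_prod_tame/tame_prod_near_snd. Qed.

Lemma Rint_near_snd (k : R -> R) e (p : R * R) : 0 < e -> bmeas k ->
  \int[leb2]_q (e^-2 * (k q.2 * (near_ind e (p.1 - q.1) * near_ind e (p.2 - q.2)))) =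
  2 * \int[mu]_y (e^-1 * (k y * near_ind e (p.2 - y))).
Proof.
move=> e0 bk; rewrite leb2_Rint21; last exact: tame_prod_near_snd.
rewrite -tame_RintZ; last exact: tame_avg.
apply: eq_Rintegral => y _ /=.
rewrite (_ : (fun x => _) = (fun x : R => e^-2 * (k y * near_ind e (p.2 - y)) * near_ind e (p.1 - x))).
  rewrite tame_RintZ; last by apply: near_ind_tame; exact: ltW.
  by rewrite Rint_near_ind ?(ltW e0)// -mulr_natr; field; rewrite gt_eqF.
by apply/funext => x; ring.
Qed.

(* Moves first along x and then along t, so that the one-dimensional differentiation theorem applies. *)
Lemma osc2_le g N e C : bmeas g -> 0 < e -> e <= 1 -> (forall p, `|g p| <= C) ->
  osc2 g N e <= 2 * \int[leb2]_p slice_osc g N e p +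
    2 * \int[leb2]_p slice_osc (transp g) (N + 1) e p.
Proof.
move=> bg e0 e1 gC; have [mg _] := bg.
have bgt := bmeas_transp bg; have [mgt _] := bgt.
have em0 : 0 <= e^-2 by rewrite invr_ge0 exprn_ge0// ltW.
pose G (z : (R * R) * (R * R)) := g (z.1.1, z.2.2).
have mG : measurable_fun setT G.
  apply: measurableT_comp => //; apply: measurable_fun_pair.
    by apply: measurableT_comp => //.
  by apply: measurableT_comp => //.
have m1 : measurable_fun setT (fun z : (R * R) * (R * R) => g z.1) by exact: measurableT_comp.
have m2 : measurable_fun setT (fun z : (R * R) * (R * R) => g z.2) by exact: measurableT_comp.
pose K (z : (R * R) * (R * R)) := near_ind e (z.1.1 - z.2.1) * near_ind e (z.1.2 - z.2.2).
have bnd (b c : R) : `|b| <= C -> `|c| <= C -> 0 <= e^-2 * `|b - c| <= e^-2 * (C + C).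
  move=> bC cC; rewrite mulr_ge0//= ler_wpM2l// (le_trans (ler_normB _ _))//.
  exact: lerD.
have T0 := tame_prod_near N e0 (a := fun z => e^-2 * `|g z.2 - g z.1|) (C := e^-2 * (C + C)).
have T1 := tame_prod_near N e0 (a := fun z => e^-2 * `|G z - g z.1|) (C := e^-2 * (C + C)).
have T2 := tame_prod_near N e0 (a := fun z => e^-2 * `|g z.2 - G z|) (C := e^-2 * (C + C)).
have {}T0 := T0 (measurable_funM (measurable_cst _) (measurableT_comp (@normr_measurable R setT) (measurable_funB m2 m1))) (fun z => bnd _ _ (gC _) (gC _)).
have {}T1 := T1 (measurable_funM (measurable_cst _) (measurableT_comp (@normr_measurable R setT) (measurable_funB mG m1))) (fun z => bnd _ _ (gC _) (gC _)).
have {}T2 := T2 (measurable_funM (measurable_cst _) (measurableT_comp (@normr_measurable R setT) (measurable_funB m2 mG))) (fun z => bnd _ _ (gC _) (gC _)).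
pose f0 z := \1_(square N) z.1 * (e^-2 * `|g z.2 - g z.1| * K z).
pose f1 z := \1_(square N) z.1 * (e^-2 * `|G z - g z.1| * K z).
pose f2 z := \1_(square N) z.1 * (e^-2 * `|g z.2 - G z| * K z).
have L : osc2 g N e <= \int[leb2]_p \int[leb2]_q f1 (p, q) + \int[leb2]_p \int[leb2]_q f2 (p, q).
  rewrite -tame_RintD; [|exact: leb2_tame_prod_int_fst T1|exact: leb2_tame_prod_int_fst T2].
  rewrite /osc2 (_ : (fun p => _) = (fun p => \int[leb2]_q f0 (p, q))); last first.
    by apply/funext => p; apply: eq_Rintegral => q _; rewrite /f0 /K /=; ring.
  apply: tame_le_Rint.
  - exact: leb2_tame_prod_int_fst T0.
  - by apply: tameD; [exact: leb2_tame_prod_int_fst T1|exact: leb2_tame_prod_int_fst T2].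
  move=> p; rewrite -tame_RintD; [|exact: leb2_tame_prod_fst T1|exact: leb2_tame_prod_fst T2].
  apply: tame_le_Rint; first exact: leb2_tame_prod_fst T0.
    by apply: tameD; [exact: leb2_tame_prod_fst T1|exact: leb2_tame_prod_fst T2].
  move=> q; rewrite /f0 /f1 /f2 -mulrDr ler_wpM2l ?indicE// -mulrDl.
  rewrite ler_wpM2r ?mulr_ge0 ?near_ind_ge0// -mulrDr ler_wpM2l//.
  by rewrite [leRHS]addrC; exact: ler_distD.
apply: (le_trans L); apply: lerD.
- rewrite -tame_RintZ; last first.
    apply: (supp_square_tame (N := N)).
      split; first exact: measurable_slice_osc.
      exists (4 * C) => p; rewrite (le_trans (slice_osc_bound N mg e0 gC p))//.
      rewrite ler_piMr ?mulr_ge0 ?(le_trans _ (gC (0, 0)))// indicE lern1 leq_b1 //.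
    by move=> p np; rewrite /slice_osc indicE memNset// mul0r.
  rewrite le_eqVlt; apply/orP; left; apply/eqP; apply: eq_Rintegral => p _.
  have bk : bmeas (fun y => `|g (p.1, y) - g p|).
    by apply/bmeas_norm/bmeasB; [split; [exact: measurable_fun_pair2|exists C => y; exact: gC]|exact: bmeas_cst].
  rewrite /slice_osc mulrCA -Rint_near_snd// -tame_RintZ; last first.
    exact: (tame_near_snd p e0 bk).
  by apply: eq_Rintegral => q _; rewrite /f1 /K /G /=; ring.
- rewrite leb2_tame_prod_swap//.
  have ts : tame leb2 (slice_osc (transp g) (N + 1) e).
    apply: (supp_square_tame (N := N + 1)).
      split; first exact: measurable_slice_osc.
      exists (4 * C) => p; rewrite (le_trans (slice_osc_bound (N + 1) mgt e0 (fun p => gC _) p))//.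
      by rewrite ler_piMr ?mulr_ge0 ?(le_trans _ (gC (0, 0)))// indicE lern1 leq_b1.
    by move=> p np; rewrite /slice_osc indicE memNset// mul0r.
  have tps : tame_prod mu mu (slice_osc (transp g) (N + 1) e).
    exact: tame_prod_supp_square (tame_measurable ts) (slice_osc_bound (N + 1) mgt e0 (fun p => gC _)).
  rewrite -(transp_Rint tps) -tame_RintZ; last exact/tame_prod_tame/tame_prod_transp.
  apply: tame_le_Rint.
  + exact: leb2_tame_prod_int_snd T2.
  + by apply: tameZ; exact/tame_prod_tame/tame_prod_transp.
  move=> q.
  have bk : bmeas (fun t => `|transp g (q.2, t) - transp g (q.2, q.1)|).
    apply/bmeas_norm/bmeasB; last exact: bmeas_cst.
    by split; [exact: measurable_fun_pair2|exists C => y; exact: gC].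
  have tn := tame_near_snd (q.2, q.1) e0 bk.
  have tpn := tame_prod_near_snd (q.2, q.1) e0 bk.
  rewrite {1}/transp /slice_osc mulrCA -(Rint_near_snd (q.2, q.1))//.
  rewrite -(transp_Rint tpn) -tame_RintZ; last exact/tame_prod_tame/tame_prod_transp.
  apply: tame_le_Rint; first exact: leb2_tame_prod_snd T2.
    by apply: tameZ; exact/tame_prod_tame/tame_prod_transp.
  move=> p; rewrite /f2 /K /G /transp /= distrC (near_indC e (p.1)) (near_indC e p.2).
  rewrite -surjective_pairing.
  set k := `|_ - _|; set n1 := near_ind e (q.1 - p.1); set n2 := near_ind e (q.2 - p.2).
  have [k0 n10 n20] : [/\ 0 <= k, 0 <= n1 & 0 <= n2] by split; [exact: normr_ge0|exact: near_ind_ge0|exact: near_ind_ge0].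
  (* As e <= 1, a point within e of [square N] lies in [square (N + 1)]. In this term the
     integration over p is the inner one, and the cutoff has to be passed from p to q. *)
  have Q : \1_(square N) p * (n1 * n2) <= \1_(square (N + 1)) (q.2, q.1) * (n1 * n2).
    rewrite /n1 /n2 !near_indE; case: ltP => [h1|_]; last by rewrite !mul0r !mulr0.
    case: ltP => [h2|_]; last by rewrite !mulr0.
    rewrite !mulr1 !indicE; have [/set_mem/squareP[a1 a2]|_] := boolP (p \in square N) => //.
    rewrite mem_set//; apply/squareP; split => /=.
      by rewrite -(subrK p.2 q.2) (le_trans (ler_normD _ _))// addrC lerD// (le_trans (ltW h2)).
    by rewrite -(subrK p.1 q.1) (le_trans (ler_normD _ _))// addrC lerD// (le_trans (ltW h1)).
  rewrite [leLHS](_ : _ = e^-2 * k * (\1_(square N) p * (n1 * n2))); last by ring.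
  rewrite [leRHS](_ : _ = e^-2 * k * (\1_(square (N + 1)) (q.2, q.1) * (n1 * n2))); last by ring.
  by rewrite ler_wpM2l// mulr_ge0.
Qed.

Lemma osc2_ge0 g N e : 0 <= osc2 g N e.
Proof.
apply: Rintegral_ge0 => p _; apply: Rintegral_ge0 => q _.
by rewrite mulr_ge0 ?indicE// mulr_ge0 ?invr_ge0 ?sqr_ge0// !mulr_ge0 ?near_ind_ge0.
Qed.

Lemma cvg0_le (e : nat -> R) (d : R) : (forall n, 0 < e n) -> e n @[n --> \oo] --> 0 ->
  0 < d -> \forall n \near \oo, e n <= d.
Proof.
move=> e0 /cvgrPdist_le ecv d0; near=> n.
have : `|0 - e n| <= d by near: n; exact: ecv.
by rewrite sub0r normrN ger0_norm ?(ltW (e0 n)).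
Unshelve. all: by end_near.
Qed.

Lemma osc2_cvg0 g N (e : nat -> R) : bmeas g ->
  (forall n, 0 < e n) -> e n @[n --> \oo] --> 0 ->
  osc2 g N (e n) @[n --> \oo] --> 0.
Proof.
move=> bg e0 ecv; have [C C0 gC] := bmeas_gt0 bg.
have h1 := slice_osc_cvg0 N bg e0 ecv.
have h2 := slice_osc_cvg0 (N + 1) (bmeas_transp bg) e0 ecv.
have h3 : 2 * \int[leb2]_p slice_osc g N (e n) p +
    2 * \int[leb2]_p slice_osc (transp g) (N + 1) (e n) p @[n --> \oo] --> 0.
  rewrite -[X in _ --> X](addr0 0) -{1}(mulr0 2) -[X in _ --> _ + X](mulr0 2).
  by apply: cvgD; (apply: cvgM; first exact: cvg_cst); [exact: h1|exact: h2].
apply: squeeze_cvgr (cvg_cst 0) h3.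
near=> n; rewrite osc2_ge0/=; apply: (osc2_le N bg (e0 n) _ gC).
by near: n; exact: cvg0_le.
Unshelve. all: by end_near.
Qed.

End Mollify2.

(** * Convolution with smooth kernels *)

Section Convolution.
Context {R : realType}.
Implicit Types (f g L : R * R -> R).

Lemma taylor2_le (f df ddf : R -> R) (B : R) : (forall x : R, is_derive x 1 f (df x)) ->
  (forall x : R, is_derive x 1 df (ddf x)) -> (forall x, `|ddf x| <= B) ->
  forall x h, `|f (x + h) - f x - h * df x| <= B * h ^+ 2.
Proof.
move=> D1 D2 dB x h.
have [c [c1 c2 Ec]] := is_derive_mvtW x (x + h) D1.
have [d [_ _ Ed]] := is_derive_mvtW x c D2.
rewrite Ec (_ : x + h - x = h); last by ring.
have -> : df c * h - h * df x = h * (df c - df x) by ring.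
rewrite Ed !normrM mulrCA expr2 ler_pM ?mulr_ge0//.
have xc : `|c - x| <= `|h|.
  have [h0|h0] := leP 0 h.
    rewrite min_l ?lerDl// in c1; rewrite max_r ?lerDl// in c2.
    by rewrite !ger0_norm// ?subr_ge0//; lra.
  rewrite min_r ?gerDl ?(ltW h0)// in c1; rewrite max_l ?gerDl ?(ltW h0)// in c2.
  by rewrite distrC ger0_norm ?subr_ge0// ler0_norm ?(ltW h0)//; lra.
have := ler_pM (normr_ge0 _) (normr_ge0 _) xc (lexx `|h|).
by rewrite [X in _ <= X -> _]mulrC -expr2 real_normK ?num_real// mulrC -expr2.
Qed.

Lemma mvt_le (f df : R -> R) (B : R) : (forall x : R, is_derive x 1 f (df x)) ->
  (forall x, `|df x| <= B) -> forall x y, `|f x - f y| <= B * `|x - y|.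
Proof.
move=> D dB x y; have [c [_ _ E]] := is_derive_mvtW y x D.
by rewrite E normrM ler_wpM2r.
Qed.

Lemma smooth2_is_derive_t f (x t : R) : smooth2 f ->
  is_derive t 1 (fun t => f (t, x)) (partial_t f (t, x)).
Proof.
move=> sf; apply: DeriveDef.
  have H : derivable f (t, x) (1, 0) by exact: (smooth2_derivable_t sf).
  exact: ((derive_tE f (t, x)).1.1 H).
by rewrite (derive_tE f (t, x)).2 derive1E.
Qed.

Lemma smooth2_is_derive_x f (t x : R) : smooth2 f ->
  is_derive x 1 (fun x => f (t, x)) (partial_x f (t, x)).
Proof.
move=> sf; apply: DeriveDef.
  have H : derivable f (t, x) (0, 1) by exact: (smooth2_derivable_x sf).
  exact: ((derive_xE f (t, x)).1.1 H).
by rewrite (derive_xE f (t, x)).2 derive1E.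
Qed.

Lemma smooth2_bounded f N : smooth2 f -> supp_square N f ->
  exists2 C, 0 < C & forall p, `|f p| <= C.
Proof. by move=> sf; apply: continuous_supp_bounded; exact: smooth2_continuous. Qed.

Lemma smooth2_tame f N : smooth2 f -> supp_square N f -> tame leb2 f.
Proof. by move=> sf; apply: continuous_supp_tame; exact: smooth2_continuous. Qed.

Lemma smooth2_bmeas f N : smooth2 f -> supp_square N f -> bmeas f.
Proof. by move=> sf; apply: continuous_supp_bmeas; exact: smooth2_continuous. Qed.

Lemma smooth2_lipschitz f N : smooth2 f -> supp_square N f ->
  exists2 B, 0 < B & forall p q, `|f p - f q| <= B * (`|p.1 - q.1| + `|p.2 - q.2|).
Proof.
move=> sf Nf; have [H1 H2] := supp_square_partial Nf.
have [B1 B10 fB1] := smooth2_bounded (smooth2_partial_t sf) H1.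
have [B2 B20 fB2] := smooth2_bounded (smooth2_partial_x sf) H2.
exists (B1 + B2); first exact: addr_gt0.
move=> [t x] [s y] /=.
have h1 := mvt_le (fun t => smooth2_is_derive_t x t sf) (fun t => fB1 _) t s.
have h2 := mvt_le (fun x => smooth2_is_derive_x s x sf) (fun x => fB2 _) x y.
rewrite (le_trans (ler_distD (f (s, x)) _ _))// mulrDl lerD//.
  by rewrite (le_trans h1)// ler_wpM2l ?(ltW B10)// lerDl.
by rewrite (le_trans h2)// ler_wpM2l ?(ltW B20)// lerDr.
Qed.

Lemma supp_square_refl N M L (z : R * R) : supp_square N L -> `|z.1| <= M -> `|z.2| <= M ->
  supp_square (N + M) (fun q => L (z - q)).
Proof.
move=> NL z1 z2; apply/supp_squareP => q /((supp_squareP _ _).1 NL) [/= h1 h2]; split.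
  by rewrite -(subrK z.1 q.1) (le_trans (ler_normD _ _))// lerD// distrC.
by rewrite -(subrK z.2 q.2) (le_trans (ler_normD _ _))// lerD// distrC.
Qed.

Definition convol g L (z : R * R) : R := \int[leb2]_q (g q * L (z - q)).

Lemma refl_tame L N (z : R * R) : smooth2 L -> supp_square N L ->
  tame leb2 (fun q => L (z - q)).
Proof.
move=> sL NL; apply: (@smooth2_tame _ (N + (`|z.1| + `|z.2|))); first exact: smooth2_refl.
by apply: supp_square_refl => //; rewrite ?lerDl ?lerDr.
Qed.

Lemma convol_tame g L N z : bmeas g -> smooth2 L -> supp_square N L ->
  tame leb2 (fun q => g q * L (z - q)).
Proof. by move=> bg sL NL; apply: tameMr => //; exact: refl_tame NL. Qed.

Lemma Rint_square_le g f (C B M : R) : bmeas g -> (forall p, `|g p| <= C) -> 0 <= C ->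
  tame leb2 f -> (forall q, `|f q| <= B * \1_(square M) q) ->
  `|\int[leb2]_q (g q * f q)| <= C * B * fine (leb2 (square M)).
Proof.
move=> bg gC C0 tf fB.
have tgf : tame leb2 (fun q => g q * f q) by apply: tameMr.
apply: (le_trans (tame_le_norm_Rint tgf)).
have tS : tame leb2 (\1_(square M) : R * R -> R).
  by apply: tame_indic; [exact: measurable_square|exact: leb2_square_lty].
rewrite -Rint_indic; last exact: measurable_square.
rewrite -tame_RintZ//; apply: tame_le_Rint; [exact: tame_norm|exact: tameZ|].
by move=> q; rewrite normrM -mulrA ler_pM.
Qed.

(** L is Lipschitz, and the restriction to unit distance keeps the supports of both translates in
    one fixed square, whose measure enters A. *)
Lemma convol_diff_le g L N (z : R * R) : bmeas g -> smooth2 L -> supp_square N L ->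
  exists A, forall z' : R * R, `|z'.1 - z.1| <= 1 -> `|z'.2 - z.2| <= 1 ->
    `|convol g L z' - convol g L z| <= A * (`|z'.1 - z.1| + `|z'.2 - z.2|).
Proof.
move=> bg sL NL; have [C C0 gC] := bmeas_gt0 bg.
have [B B0 LB] := smooth2_lipschitz sL NL.
pose M := `|z.1| + `|z.2| + 1.
exists (C * B * fine (leb2 (square (N + M)))) => z' h1 h2.
rewrite /convol -tame_RintB; [|exact: convol_tame NL|exact: convol_tame NL].
under eq_Rintegral do rewrite -mulrBr.
have tt : tame leb2 (fun q => L (z' - q) - L (z - q)).
  by apply: tameB; exact: refl_tame NL.
have S1 : supp_square (N + M) (fun q => L (z' - q)).
  apply: supp_square_refl => //; rewrite /M.
    by have := ler_normD (z'.1 - z.1) z.1; rewrite subrK; have := normr_ge0 z.2; lra.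
  by have := ler_normD (z'.2 - z.2) z.2; rewrite subrK; have := normr_ge0 z.1; lra.
have S2 : supp_square (N + M) (fun q => L (z - q)).
  apply: supp_square_refl => //; rewrite /M.
    by have := normr_ge0 z.2; lra.
  by have := normr_ge0 z.1; lra.
rewrite [leRHS](_ : _ = C * (B * (`|z'.1 - z.1| + `|z'.2 - z.2|)) * fine (leb2 (square (N + M)))); last by ring.
apply: Rint_square_le => //; first exact: ltW.
apply: supp_square_indic; first by move=> p np; rewrite S1// S2// subrr.
move=> q; rewrite (le_trans (LB _ _))//= ler_wpM2l ?(ltW B0)//.
rewrite (_ : z'.1 - q.1 - (z.1 - q.1) = z'.1 - z.1); last by ring.
by rewrite (_ : z'.2 - q.2 - (z.2 - q.2) = z'.2 - z.2); last by ring.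
Qed.

Lemma convol_continuous g L N : bmeas g -> smooth2 L -> supp_square N L ->
  continuous (convol g L).
Proof.
move=> bg sL NL z; have [A HA] := convol_diff_le z bg sL NL.
have A1 : 0 < `|A| + 1 by rewrite ltr_wpDl.
apply/cvgrPdist_le => e e0.
have d0 : 0 < Num.min 1 (e / (2 * (`|A| + 1))).
  by rewrite lt_min ltr01 divr_gt0// mulr_gt0.
have c1 : (fun p : R * R => p.1) @ nbhs z --> z.1 by exact: cvg_fst.
have c2 : (fun p : R * R => p.2) @ nbhs z --> z.2 by exact: cvg_snd.
near=> z'.
have h1 : `|z'.1 - z.1| <= Num.min 1 (e / (2 * (`|A| + 1))).
  by rewrite distrC; near: z'; move/cvgrPdist_le : c1; exact.
have h2 : `|z'.2 - z.2| <= Num.min 1 (e / (2 * (`|A| + 1))).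
  by rewrite distrC; near: z'; move/cvgrPdist_le : c2; exact.
move: h1 h2; rewrite !le_min => /andP[h1 h1'] /andP[h2 h2'].
rewrite distrC (le_trans (HA z' h1 h2))//.
apply: (@le_trans _ _ ((`|A| + 1) * (e / (2 * (`|A| + 1)) + e / (2 * (`|A| + 1))))).
  rewrite (@le_trans _ _ ((`|A| + 1) * (`|z'.1 - z.1| + `|z'.2 - z.2|)))//.
    by rewrite ler_wpM2r ?addr_ge0// (le_trans (ler_norm _))// lerDl.
  by rewrite ler_wpM2l ?(ltW A1)// lerD.
by rewrite le_eqVlt; apply/orP; left; apply/eqP; field; rewrite gt_eqF.
Unshelve. all: by end_near.
Qed.

(** Differentiation under the integral sign: the quadratic remainder is uniform in q on a fixed
    square, so it remains quadratic after integration against the bounded function g. *)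
Lemma Rint_is_derive (g : R * R -> R) (l : R -> R * R -> R) (m : R * R -> R) (B M : R) :
  bmeas g -> (forall h, tame leb2 (l h)) -> tame leb2 m ->
  (forall h q, `|h| <= 1 -> `|l h q - l 0 q - h * m q| <= B * h ^+ 2 * \1_(square M) q) ->
  exists A, forall h, `|h| <= 1 ->
    `|\int[leb2]_q (g q * l h q) - \int[leb2]_q (g q * l 0 q) - h * \int[leb2]_q (g q * m q)| <= A * h ^+ 2.
Proof.
move=> bg tl tm H; have [C C0 gC] := bmeas_gt0 bg.
exists (C * B * fine (leb2 (square M))) => h h1.
have t1 k : tame leb2 (fun q => g q * l k q) by apply: tameMr.
have t2 : tame leb2 (fun q => g q * m q) by apply: tameMr.
rewrite -tame_RintB// -tame_RintZ// -tame_RintB//; last 2 first.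
- by apply: tameB.
- by apply: tameZ.
rewrite (_ : (fun x => _) = (fun q => g q * (l h q - l 0 q - h * m q))); last first.
  by apply/funext => q; ring.
rewrite (_ : C * B * _ * _ = C * (B * h ^+ 2) * fine (leb2 (square M))); last by ring.
apply: Rint_square_le => //; first exact: ltW.
  by apply: tameB; [apply: tameB|exact: tameZ].
by move=> q; exact: H.
Qed.

Lemma convol_is_derive_t g L N (t x : R) : bmeas g -> smooth2 L -> supp_square N L ->
  is_derive t 1 (fun t => convol g L (t, x)) (convol g (partial_t L) (t, x)).
Proof.
move=> bg sL NL.
have sLt := smooth2_partial_t sL; have [NLt _] := supp_square_partial NL.
have sLtt := smooth2_partial_t sLt; have [NLtt _] := supp_square_partial NLt.
have [B B0 LB] := smooth2_bounded sLtt NLtt.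
pose M := N + (`|t| + `|x| + 1).
have := @Rint_is_derive g (fun h q => L ((t + h, x) - q)) (fun q => partial_t L ((t, x) - q)) B M bg.
move=> /(_ (fun h => refl_tame _ sL NL) (refl_tame _ sLt NLt)) [].
  move=> h q h1; rewrite addr0.
  have S1 : supp_square M (fun q => L ((t + h, x) - q)).
    apply: supp_square_refl => //=; last by have := normr_ge0 t; lra.
    by have := ler_normD t h; have := normr_ge0 x; lra.
  have S2 : supp_square M (fun q => L ((t, x) - q)).
    apply: supp_square_refl => //=; last by have := normr_ge0 t; lra.
    by have := normr_ge0 x; lra.
  have S3 : supp_square M (fun q => partial_t L ((t, x) - q)).
    apply: supp_square_refl => //=; last by have := normr_ge0 t; lra.
    by have := normr_ge0 x; lra.
  apply: (@supp_square_indic _ M (fun q => L ((t + h, x) - q) - L ((t, x) - q) - h * partial_t L ((t, x) - q))).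
    by move=> p np; rewrite S1// S2// S3// mulr0 !subr0.
  move=> p; have := taylor2_le (fun s => smooth2_is_derive_t (x - p.2) s sL)
    (fun s => smooth2_is_derive_t (x - p.2) s sLt) (fun s => LB _) (t - p.1) h.
  by rewrite (_ : t - p.1 + h = t + h - p.1)//; ring.
move=> A HA; apply: (is_derive_quad (C := A)) => h h1.
by have := HA h h1; rewrite addr0.
Qed.

Lemma convol_is_derive_x g L N (t x : R) : bmeas g -> smooth2 L -> supp_square N L ->
  is_derive x 1 (fun x => convol g L (t, x)) (convol g (partial_x L) (t, x)).
Proof.
move=> bg sL NL.
have sLt := smooth2_partial_x sL; have [_ NLt] := supp_square_partial NL.
have sLtt := smooth2_partial_x sLt; have [_ NLtt] := supp_square_partial NLt.
have [B B0 LB] := smooth2_bounded sLtt NLtt.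
pose M := N + (`|t| + `|x| + 1).
have := @Rint_is_derive g (fun h q => L ((t, x + h) - q)) (fun q => partial_x L ((t, x) - q)) B M bg.
move=> /(_ (fun h => refl_tame _ sL NL) (refl_tame _ sLt NLt)) [].
  move=> h q h1; rewrite addr0.
  have S1 : supp_square M (fun q => L ((t, x + h) - q)).
    apply: supp_square_refl => //=; first by have := normr_ge0 x; lra.
    by have := ler_normD x h; have := normr_ge0 t; lra.
  have S2 : supp_square M (fun q => L ((t, x) - q)).
    apply: supp_square_refl => //=; last by have := normr_ge0 t; lra.
    by have := normr_ge0 x; lra.
  have S3 : supp_square M (fun q => partial_x L ((t, x) - q)).
    apply: supp_square_refl => //=; last by have := normr_ge0 t; lra.
    by have := normr_ge0 x; lra.
  apply: (@supp_square_indic _ M (fun q => L ((t, x + h) - q) - L ((t, x) - q) - h * partial_x L ((t, x) - q))).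
    by move=> p np; rewrite S1// S2// S3// mulr0 !subr0.
  move=> p; have := taylor2_le (fun s => smooth2_is_derive_x (t - p.1) s sL)
    (fun s => smooth2_is_derive_x (t - p.1) s sLt) (fun s => LB _) (x - p.2) h.
  by rewrite (_ : x - p.2 + h = x + h - p.2)//; ring.
move=> A HA; apply: (is_derive_quad (C := A)) => h h1.
by have := HA h h1; rewrite addr0.
Qed.

(** Derivatives fall on the kernel only, and those of L satisfy the same hypotheses as L; the
    induction on the order therefore runs over all kernels. *)
Lemma convol_smooth2 g L N : bmeas g -> smooth2 L -> supp_square N L ->
  [/\ smooth2 (convol g L), partial_t (convol g L) = convol g (partial_t L) &
      partial_x (convol g L) = convol g (partial_x L)].
Proof.
move=> bg; have Et M : smooth2 M -> supp_square N M ->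
    (forall p, derivable (convol g M) p (1, 0)) /\ partial_t (convol g M) = convol g (partial_t M).
  move=> sM NM; have D t x := convol_is_derive_t t x bg sM NM.
  split=> [[t x]|]; first by apply/(derive_tE _ _).1; have [] := D t x.
  by apply/funext => -[t x]; rewrite (derive_tE _ _).2 derive1E; have [_ ->] := D t x.
have Ex M : smooth2 M -> supp_square N M ->
    (forall p, derivable (convol g M) p (0, 1)) /\ partial_x (convol g M) = convol g (partial_x M).
  move=> sM NM; have D t x := convol_is_derive_x t x bg sM NM.
  split=> [[t x]|]; first by apply/(derive_xE _ _).1; have [] := D t x.
  by apply/funext => -[t x]; rewrite (derive_xE _ _).2 derive1E; have [_ ->] := D t x.
move=> sL NL; split; [|exact: (Et _ sL NL).2|exact: (Ex _ sL NL).2].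
move=> k; elim: k L sL NL => [|k IH] L sL NL.
  by split => //; exact: convol_continuous NL.
split; first exact: convol_continuous NL.
have [dt ->] := Et _ sL NL; have [dx ->] := Ex _ sL NL.
have [NLt NLx] := supp_square_partial NL.
split; [exact: dt|exact: dx| |].
- by apply: IH => //; exact: smooth2_partial_t.
- by apply: IH => //; exact: smooth2_partial_x.
Qed.

End Convolution.

(** * Smooth mollifiers supported in the past *)

Section Kernel.
Context {R : realType}.
Notation mu := (@lebesgue_measure R).
Variable th : R -> R.
Hypothesis sth : smooth1 th.
Hypothesis th0 : forall x, x <= 0 -> th x = 0.
Hypothesis th1 : forall x, 1 <= x -> th x = 1.
Hypothesis dth_ge0 : forall x, 0 <= derive1 th x.

Lemma smooth1_scale (a : R -> R) (c : R) : smooth1 a -> smooth1 (fun x => a (c * x)).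
Proof.
move=> /(smooth1_affine c 0); congr smooth1; apply/funext => x; by rewrite addr0.
Qed.

Lemma is_derive_step (x : R) : is_derive x 1 th (derive1 th x).
Proof. by apply: DeriveDef; [exact: smooth1_derivable|rewrite derive1E]. Qed.

Lemma dth_supp x : derive1 th x != 0 -> 0 <= x <= 1.
Proof.
apply: contraNT; rewrite negb_and -!ltNge => /orP[x0|x1].
  rewrite derive1E (@near_eq_derive _ _ _ th (cst 0)) ?derive_cst//.
  by near=> y; rewrite th0 ?ltW//; near: y; exact: lt_nbhsl.
rewrite derive1E (@near_eq_derive _ _ _ th (cst 1)) ?derive_cst//.
by near=> y; rewrite th1 ?ltW//; near: y; exact: lt_nbhsr.
Unshelve. all: by end_near. Qed.

Lemma step_ndecr x y : x <= y -> th x <= th y.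
Proof.
rewrite le_eqVlt => /predU1P[->//|xy].
have [c _ E] := is_derive_mvt is_derive_step xy.
by rewrite -subr_ge0 E mulr_ge0// subr_ge0 ltW.
Qed.

Lemma step_ge0 x : 0 <= th x.
Proof.
have [x0|x0] := leP x 0; first by rewrite th0.
by rewrite -(th0 (lexx 0)) step_ndecr// ltW.
Qed.

Lemma step_le1 x : th x <= 1.
Proof.
have [x1|x1] := leP 1 x; first by rewrite th1.
by rewrite -(th1 (lexx 1)) step_ndecr// ltW.
Qed.

Lemma dth_bounded : exists2 C, 0 < C & forall x, derive1 th x <= C.
Proof.
have /compact_bounded[M [Mr HM]] : compact (derive1 th @` `[0, 1]).
  apply: continuous_compact; last exact: segment_compact.
  exact: continuous_subspaceT (smooth1_continuous (smooth1_derive sth)).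
exists (`|M| + 1); first by rewrite ltr_wpDl.
move=> x; have [->|/dth_supp x01] := eqVneq (derive1 th x) 0; first by rewrite addr_ge0.
rewrite (le_trans (ler_norm _))//.
apply: (HM (`|M| + 1)); last by exists x => //=; rewrite in_itv.
by rewrite (le_lt_trans (ler_norm _))// ltrDl.
Qed.

(** An approximate unit supported in [0, e], on one side of 0. A mollified function thus depends at
    time t on times in [t - e, t] only, which keeps track of the distance of test functions to t =
    0. *)
Definition kern1 (e s : R) : R := e^-1 * derive1 th (e^-1 * s).

Lemma is_derive_step_scale (e s : R) : is_derive s 1 (fun s => th (e^-1 * s)) (kern1 e s).
Proof.
have E : (fun s => th (e^-1 * s)) = (fun s => th (e^-1 * s + 0)).
  by apply/funext => x; rewrite addr0.
have [D1 D2] := derive1_affine (smooth1_derivable sth (x := e^-1 * s + 0)).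
by rewrite E; apply: (DeriveDef D1); rewrite -derive1E [LHS]D2 addr0.
Qed.

Lemma smooth1_kern1 e : smooth1 (kern1 e).
Proof.
apply: (smooth1M (a := cst e^-1)); first exact: smooth1_cst.
by apply: smooth1_scale; exact: smooth1_derive.
Qed.

Lemma kern1_ge0 e s : 0 < e -> 0 <= kern1 e s.
Proof. by move=> e0; rewrite mulr_ge0// invr_ge0 ltW. Qed.

Lemma kern1_supp e s : 0 < e -> kern1 e s != 0 -> 0 <= s <= e.
Proof.
move=> e0; rewrite mulf_eq0 negb_or => /andP[_ /dth_supp].
by rewrite pmulr_rge0 ?invr_gt0// mulrC ler_pdivrMr// mul1r.
Qed.

Lemma Rint_kern1 e t : 0 < e -> \int[mu]_s kern1 e (t - s) = 1.
Proof.
move=> e0; have te : t - e < t by rewrite ltrBlDr ltrDl.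
have -> : \int[mu]_s kern1 e (t - s) = \int[mu]_(s in `[t - e, t]) kern1 e (t - s).
  rewrite [RHS]Rintegral_mkcond; apply: eq_Rintegral => s _; rewrite patchE.
  case: ifPn => // /negP ns; apply/eqP; apply/negPn/negP => /(kern1_supp e0) H.
  by apply: ns; apply/mem_set; rewrite /= in_itv/=; lra.
have D (s : R) : is_derive s 1 (fun s => - th (e^-1 * (t - s))) (kern1 e (t - s)).
  have E : (fun s => - th (e^-1 * (t - s))) = (fun s => - th (- e^-1 * s + e^-1 * t)).
    by apply/funext => x; congr (- th _); ring.
  have [D1 D2] := derive1_affine (smooth1_derivable sth (x := - e^-1 * s + e^-1 * t)).
  have D3 : is_derive s 1 (fun s => th (- e^-1 * s + e^-1 * t)) (- kern1 e (t - s)).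
    apply: (DeriveDef D1); rewrite -derive1E [LHS]D2 /kern1 mulNr.
    by congr (- (_ * derive1 th _)); ring.
  by rewrite E; apply: (is_derive_eq (is_deriveN D3)); rewrite opprK.
have cth : continuous (fun s => - th (e^-1 * (t - s))).
  by move=> s; apply: differentiable_continuous; apply/derivable1_diffP; have [] := D s.
have ck : continuous (fun s => kern1 e (t - s)).
  have -> : (fun s : R => kern1 e (t - s)) = (fun s : R => kern1 e (-1 * s + t)).
    by apply/funext => s; rewrite mulN1r addrC.
  exact: smooth1_continuous (smooth1_affine (-1) t (smooth1_kern1 e)).
rewrite /Rintegral (@continuous_FTC2 R _ (fun s => - th (e^-1 * (t - s))) (t - e) t te).
- rewrite /= subrr mulr0 th0// th1; first by ring.
  by rewrite (_ : t - (t - e) = e) ?mulVf ?gt_eqF//; ring.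
- exact: (continuous_subspaceT ck).
- split.
  + by move=> s _; have [] := D s.
  + exact/cvg_at_right_filter/cth.
  + exact/cvg_at_left_filter/cth.
- by move=> s _; rewrite derive1E; have [_ ->] := D s.
Qed.

Definition kern2 (e : R) (p : R * R) : R := kern1 e p.1 * kern1 e p.2.

Lemma smooth2_kern2 e : smooth2 (kern2 e).
Proof. by apply: smooth2_tensor; exact: smooth1_kern1. Qed.

Lemma kern2_ge0 e p : 0 < e -> 0 <= kern2 e p.
Proof. by move=> e0; rewrite mulr_ge0 ?kern1_ge0. Qed.

Lemma kern2_supp e p : 0 < e -> kern2 e p != 0 -> 0 <= p.1 <= e /\ 0 <= p.2 <= e.
Proof.
move=> e0; rewrite mulf_eq0 negb_or => /andP[h1 h2].
by split; exact: kern1_supp.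
Qed.

Lemma kern2_supp_square e : 0 < e -> supp_square e (kern2 e).
Proof.
move=> e0; apply/supp_squareP => p /(kern2_supp e0)[/andP[a b] /andP[c d]].
by rewrite !ger0_norm.
Qed.

Lemma kern2_le_near : exists2 C, 0 < C & forall e, 0 < e -> forall p q : R * R,
  kern2 e (p - q) <= C * ((2 * e) ^- 2 * (near_ind (2 * e) (p.1 - q.1) * near_ind (2 * e) (p.2 - q.2))).
Proof.
(* [kern2] is at most C ^ 2 / e ^ 2, and the factor 4 makes up for the normalisation at radius 2 *
   e. That radius is chosen so that the closed support of the kernel lies in an open ball. *)
have [C C0 HC] := dth_bounded; exists (4 * C ^+ 2); first by rewrite mulr_gt0// exprn_gt0.
move=> e e0 p q.
have [->|] := eqVneq (kern2 e (p - q)) 0.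
  rewrite !mulr_ge0 ?near_ind_ge0 ?exprn_ge0 ?(ltW C0)// invr_ge0 exprn_ge0// mulr_ge0// ltW//.
move=> /(kern2_supp e0)[/= h1 h2]; rewrite !near_indE.
have -> : `|p.1 - q.1| < 2 * e by rewrite ger0_norm; lra.
have -> : `|p.2 - q.2| < 2 * e by rewrite ger0_norm; lra.
rewrite !mulr1 /kern2 /kern1 mulrACA.
rewrite [leRHS](_ : _ = (e^-1 * e^-1) * (C * C)); last by field; rewrite gt_eqF.
by rewrite ler_wpM2l ?mulr_ge0 ?invr_ge0 ?(ltW e0)// ler_pM.
Qed.

Lemma continuous_kern1 e : continuous (kern1 e).
Proof. exact: smooth1_continuous (smooth1_kern1 e). Qed.

Lemma kern1_bounded e : 0 < e -> exists2 C, 0 < C & forall s, `|kern1 e s| <= C.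
Proof.
move=> e0; have [C C0 HC] := dth_bounded; exists (e^-1 * C); first by rewrite mulr_gt0// invr_gt0.
by move=> s; rewrite ger0_norm ?kern1_ge0// ler_wpM2l// invr_ge0 ltW.
Qed.

Lemma tame_kern1 e t : 0 < e -> tame mu (fun s => kern1 e (t - s)).
Proof.
move=> e0; have [C C0 HC] := kern1_bounded e0; split.
  apply: (measurableT_comp (f := kern1 e)); first exact: continuous_measurable_fun (@continuous_kern1 e).
  exact: measurable_funB.
exists `[t - e, t], C; split => //; first exact: lebesgue_itv_lty.
move=> s; rewrite indicE; have [->|] := eqVneq (kern1 e (t - s)) 0.
  by rewrite normr0 mulr_ge0// ltW.
by move=> /(kern1_supp e0) H; rewrite mem_set ?mulr1//= in_itv/=; lra.
Qed.

Lemma Rint_kern2 e (p : R * R) : 0 < e -> \int[leb2]_q kern2 e (p - q) = 1.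
Proof.
move=> e0; rewrite leb2_Rint12; last first.
  have Nr := supp_square_refl (kern2_supp_square e0) (M := `|p.1| + `|p.2|) (z := p) (ltac:(by rewrite lerDl)) (ltac:(by rewrite lerDr)).
  have [C C0 HC] := smooth2_bounded (smooth2_kern2 e) (kern2_supp_square e0).
  apply: (tame_prod_supp_square (C := C)).
    by apply: continuous2_measurable; apply: smooth2_continuous; apply: smooth2_refl; exact: smooth2_kern2.
  by apply: (supp_square_indic Nr).
rewrite -[RHS](Rint_kern1 p.1 e0); apply: eq_Rintegral => s _.
rewrite (_ : (fun y => _) = (fun y => kern1 e (p.1 - s) * kern1 e (p.2 - y)))//.
by rewrite tame_RintZ ?Rint_kern1 ?mulr1//; exact: tame_kern1.
Qed.

Lemma tame_kern2 e (p : R * R) : 0 < e -> tame leb2 (fun q => kern2 e (p - q)).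
Proof. by move=> e0; exact: refl_tame (smooth2_kern2 e) (kern2_supp_square e0). Qed.

Lemma tame_prod_kern (a : (R * R) * (R * R) -> R) N e : 0 < e -> bmeas a ->
  tame_prod leb2 leb2 (fun z => \1_(square N) z.1 * (a z * kern2 e (z.1 - z.2))).
Proof.
move=> e0 ba; have [A A0 aA] := bmeas_gt0 ba; have [ma _] := ba.
have [C C0 HC] := kern2_le_near.
have e20 : 0 < 2 * e by rewrite mulr_gt0.
split.
  apply: measurable_funM.
    by apply: measurableT_comp => //; apply: measurable_indic; exact: measurable_square.
  apply: measurable_funM => //; rewrite /kern2; apply: measurable_funM.
    apply: (measurableT_comp (f := kern1 e)); first exact: continuous_measurable_fun (@continuous_kern1 e).
    by apply: measurable_funB; apply: measurableT_comp.
  apply: (measurableT_comp (f := kern1 e)); first exact: continuous_measurable_fun (@continuous_kern1 e).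
  by apply: measurable_funB; apply: measurableT_comp.
exists (square N), (square (N + 2 * e)), (A * C * (2 * e) ^- 2); split; try exact: measurable_square; try exact: leb2_square_lty.
move=> [p q] /=.
have K0 : 0 <= A * C * (2 * e) ^- 2 by rewrite !mulr_ge0 ?(ltW A0) ?(ltW C0)// invr_ge0 exprn_ge0// ltW.
have := near_prod_supp N p q K0 e20 (_ : `|A * C * (2 * e) ^- 2| <= A * C * (2 * e) ^- 2).
rewrite {1}ger0_norm// => /(_ (lexx _)); apply: le_trans.
rewrite normrM [leRHS]normrM ler_wpM2l// [leRHS]ger0_norm; last first.
  by rewrite mulr_ge0// mulr_ge0// near_ind_ge0.
rewrite normrM [X in _ * X]ger0_norm ?kern2_ge0//.
apply: (le_trans (ler_pM (normr_ge0 _) (kern2_ge0 _ e0) (aA (p, q)) (HC e e0 p q))).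
by rewrite !mulrA.
Qed.

Definition kern_osc (g : R * R -> R) (N e : R) : R :=
  \int[leb2]_p \int[leb2]_q (\1_(square N) p * (`|g q - g p| * kern2 e (p - q))).

Lemma bmeas_diff (g : R * R -> R) : bmeas g -> bmeas (fun z : (R * R) * (R * R) => `|g z.2 - g z.1|).
Proof.
move=> [mg [C gC]]; apply/bmeas_norm/bmeasB.
  by split; [exact: measurableT_comp|exists C].
by split; [exact: measurableT_comp|exists C].
Qed.

Lemma kern_osc_ge0 g N e : 0 < e -> 0 <= kern_osc g N e.
Proof.
move=> e0; apply: Rintegral_ge0 => p _; apply: Rintegral_ge0 => q _.
by rewrite mulr_ge0 ?indicE// mulr_ge0// kern2_ge0.
Qed.

Lemma kern_osc_le : exists2 C, 0 < C & forall g N e, bmeas g -> 0 < e ->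
  kern_osc g N e <= C * osc2 g N (2 * e).
Proof.
have [C C0 HC] := kern2_le_near; exists C => // g N e bg e0.
have e20 : 0 < 2 * e by rewrite mulr_gt0.
have [A A0 gA] := bmeas_gt0 bg.
have T1 := tame_prod_kern N e0 (bmeas_diff bg).
have T2 : tame_prod leb2 leb2 (fun z => \1_(square N) z.1 * ((2 * e)^-2 * `|g z.2 - g z.1| * (near_ind (2 * e) (z.1.1 - z.2.1) * near_ind (2 * e) (z.1.2 - z.2.2)))).
  apply: (@tame_prod_near R _ N (2 * e) ((2 * e)^-2 * (A + A)) e20).
    by apply: measurable_funM => //; have [] := bmeas_diff bg.
  have i0 : 0 <= (2 * e)^-2 by rewrite invr_ge0 exprn_ge0// ltW.
  move=> z; rewrite mulr_ge0//= ler_wpM2l// (le_trans (ler_normB _ _))//.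
  exact: lerD.
have E p q : \1_(square N) p * ((2 * e)^-2 * (`|g q - g p| * (near_ind (2 * e) (p.1 - q.1) * near_ind (2 * e) (p.2 - q.2)))) =
  \1_(square N) p * ((2 * e)^-2 * `|g q - g p| * (near_ind (2 * e) (p.1 - q.1) * near_ind (2 * e) (p.2 - q.2))).
  by ring.
rewrite /osc2; under eq_Rintegral do under eq_Rintegral do rewrite E.
rewrite -tame_RintZ; last exact: leb2_tame_prod_int_fst T2.
apply: tame_le_Rint; first exact: leb2_tame_prod_int_fst T1.
  by apply: tameZ; exact: leb2_tame_prod_int_fst T2.
move=> p; rewrite -tame_RintZ; last exact: leb2_tame_prod_fst T2.
apply: tame_le_Rint; first exact: leb2_tame_prod_fst T1.
  by apply: tameZ; exact: leb2_tame_prod_fst T2.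
have i0 : 0 <= \1_(square N) p :> R by rewrite indicE.
move=> q; rewrite [leRHS]mulrCA ler_wpM2l//.
have := ler_wpM2l (normr_ge0 (g q - g p)) (HC e e0 p q).
by move/le_trans; apply; rewrite le_eqVlt; apply/orP; left; apply/eqP; ring.
Qed.

Lemma kern_osc_cvg0 (g : R * R -> R) N (e : nat -> R) : bmeas g -> (forall n, 0 < e n) ->
  e n @[n --> \oo] --> 0 -> kern_osc g N (e n) @[n --> \oo] --> 0.
Proof.
move=> bg e0 ecv; have [C C0 HC] := kern_osc_le.
have h : C * osc2 g N (2 * e n) @[n --> \oo] --> 0.
  rewrite -[X in _ --> X](mulr0 C); apply: cvgM; first exact: cvg_cst.
  apply: osc2_cvg0 => //; first by move=> n; rewrite mulr_gt0.
  by rewrite -[X in _ --> X](mulr0 2); apply: cvgM; first exact: cvg_cst.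
apply: squeeze_cvgr (cvg_cst 0) h.
by apply: nearW => n; rewrite kern_osc_ge0//= HC.
Qed.

(** The kernel has integral 1, so that [g p] can be taken under the integral defining the
    mollification. *)
Lemma moll_dist_le (g : R * R -> R) N e : bmeas g -> 0 < e ->
  \int[leb2]_p (\1_(square N) p * `|convol g (kern2 e) p - g p|) <= kern_osc g N e.
Proof.
move=> bg e0; have [C C0 gC] := bmeas_gt0 bg; have [mg _] := bg.
have T1 := tame_prod_kern N e0 (bmeas_diff bg).
have sK := smooth2_kern2 e; have NK := kern2_supp_square e0.
have ctn : measurable_fun setT (fun p => `|convol g (kern2 e) p - g p|).
  apply: measurableT_comp => //; apply: measurable_funB => //.
  by apply: continuous2_measurable; exact: convol_continuous NK.
have dle p : `|convol g (kern2 e) p - g p| <= \int[leb2]_q (`|g q - g p| * kern2 e (p - q)).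
  have tb : bmeas (fun q => g q - g p) by apply: bmeasB => //; exact: bmeas_cst.
  have tg : tame leb2 (fun q => g q * kern2 e (p - q)) by apply: tameMr => //; exact: tame_kern2.
  have tc : tame leb2 (fun q => g p * kern2 e (p - q)) by apply: tameZ; exact: tame_kern2.
  have tt : tame leb2 (fun q => (g q - g p) * kern2 e (p - q)) by apply: tameMr => //; exact: tame_kern2.
  rewrite /convol -[X in _ - X]mulr1 -(Rint_kern2 p e0) -tame_RintZ; last exact: tame_kern2.
  rewrite -tame_RintB// (_ : (fun x => _) = (fun q => (g q - g p) * kern2 e (p - q))); last first.
    by apply/funext => q; ring.
  apply: (le_trans (tame_le_norm_Rint tt)).
  rewrite le_eqVlt; apply/orP; left; apply/eqP; apply: eq_Rintegral => q _.
  by rewrite normrM [X in _ * X]ger0_norm// kern2_ge0.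
have tb p : tame leb2 (fun q => `|g q - g p| * kern2 e (p - q)).
  apply: tameMr; last exact: tame_kern2.
  by apply/bmeas_norm/bmeasB => //; exact: bmeas_cst.
rewrite /kern_osc; apply: tame_le_Rint; last 1 first.
- move=> p; have i0 : 0 <= \1_(square N) p :> R by rewrite indicE.
  by rewrite tame_RintZ// ler_wpM2l.
- apply: tameM.
    by apply: tame_indic; [exact: measurable_square|exact: leb2_square_lty].
  split; first exact: ctn.
  exists (2 * C) => p; rewrite normr_id (le_trans (dle p))//.
  rewrite -[leRHS]mulr1 -[X in _ <= _ * X](Rint_kern2 p e0) -tame_RintZ; last exact: tame_kern2.
  apply: tame_le_Rint => //; first by apply: tameZ; exact: tame_kern2.
  move=> q; rewrite ler_wpM2r ?kern2_ge0// (le_trans (ler_normB _ _))//.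
  by rewrite mulr_natl mulr2n lerD.
- exact: leb2_tame_prod_int_fst T1.
Qed.

Lemma moll_cvg0 (g : R * R -> R) N (e : nat -> R) : bmeas g -> (forall n, 0 < e n) ->
  e n @[n --> \oo] --> 0 ->
  \int[leb2]_p (\1_(square N) p * `|convol g (kern2 (e n)) p - g p|) @[n --> \oo] --> 0.
Proof.
move=> bg e0 ecv.
apply: squeeze_cvgr (cvg_cst 0) (@kern_osc_cvg0 g N e bg e0 ecv).
apply: nearW => n; rewrite moll_dist_le// andbT.
by apply: Rintegral_ge0 => p _; rewrite mulr_ge0// indicE.
Qed.

End Kernel.

(** * Doubling of variables *)

Section Shift.
Context {R : realType}.
Implicit Types (f L : R * R -> R).

Lemma smooth2_shift f (q : R * R) : smooth2 f ->
  [/\ smooth2 (fun p => f (p - q)),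
      forall p, partial_t (fun p => f (p - q)) p = partial_t f (p - q) &
      forall p, partial_x (fun p => f (p - q)) p = partial_x f (p - q)].
Proof.
(* A translation is the composition of two reflections, whose derivatives are already known. *)
move=> sf; pose h (p : R * R) := f (0 - p).
have sh : smooth2 h by exact: smooth2_refl.
have E : (fun p => f (p - q)) = (fun p => h (q - p)).
  by apply/funext => p; rewrite /h sub0r opprB.
rewrite E; split; first exact: smooth2_refl.
- move=> p; rewrite (partial_t_refl q p (smooth2_derivable_t sh)).2.
  by rewrite (partial_t_refl 0 (q - p) (smooth2_derivable_t sf)).2 opprK sub0r opprB.
- move=> p; rewrite (partial_x_refl q p (smooth2_derivable_x sh)).2.
  by rewrite (partial_x_refl 0 (q - p) (smooth2_derivable_x sf)).2 opprK sub0r opprB.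
Qed.

Lemma supp_square_shift (f : R * R -> R) (N : R) (w : R * R) : supp_square N f ->
  supp_square (N + (`|w.1| + `|w.2|)) (fun p => f (p - w)).
Proof.
move=> Nf p np; apply: Nf; apply: contra_not np => /squareP[/= h1 h2]; apply/squareP; split.
  by rewrite -(subrK w.1 p.1) (le_trans (ler_normD _ _))// lerD// lerDl.
by rewrite -(subrK w.2 p.2) (le_trans (ler_normD _ _))// lerD// lerDr.
Qed.

Lemma tame_prod_convol (A : (R * R) * (R * R) -> R) (s m : R * R -> R) N e : bmeas A ->
  bmeas s -> supp_square N s -> smooth2 m -> supp_square e m ->
  tame_prod leb2 leb2 (fun z => A z * (s z.1 * m (z.1 - z.2))).
Proof.
move=> bA ss Ns sm Nm; have [CA CA0 HA] := bmeas_gt0 bA; have [mA _] := bA.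
have [Cs Cs0 Hs] := bmeas_gt0 ss; have [ms _] := ss; have [Cm Cm0 Hm] := smooth2_bounded sm Nm.
split.
  apply: measurable_funM => //; apply: measurable_funM.
    exact: (measurableT_comp ms measurable_fst).
  apply: (measurableT_comp (f := m)).
    by apply: continuous2_measurable; exact: smooth2_continuous.
  apply: measurable_fun_pair.
    by apply: measurable_funB; apply: measurableT_comp.
  by apply: measurable_funB; apply: measurableT_comp.
exists (square N), (square (N + e)), (CA * (Cs * Cm)).
split; try exact: measurable_square; try exact: leb2_square_lty.
move=> [p q] /=; rewrite !normrM.
have nn : 0 <= CA * (Cs * Cm) by rewrite !mulr_ge0// ltW.
have ii : 0 <= \1_(square N) p * \1_(square (N + e)) q :> R by rewrite !indicE mulr_ge0.
have [->|sp] := eqVneq (s p) 0.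
  by rewrite normr0 mul0r mulr0 mulr_ge0.
have [->|mq] := eqVneq (m (p - q)) 0.
  by rewrite normr0 !mulr0 mulr_ge0.
have [p1 p2] := (supp_squareP _ _).1 Ns p sp.
have [/= q1 q2] := (supp_squareP _ _).1 Nm (p - q) mq.
rewrite !indicE mem_set; last exact/squareP.
rewrite mem_set; last first.
  apply/squareP; split.
    by rewrite -(subrK p.1 q.1) (le_trans (ler_normD _ _))// addrC lerD// distrC.
  by rewrite -(subrK p.2 q.2) (le_trans (ler_normD _ _))// addrC lerD// distrC.
by rewrite !mulr1 ler_pM ?mulr_ge0// ler_pM.
Qed.

Lemma tame_prod_test (A : (R * R) * (R * R) -> R) (s m : R * R -> R) N e : bmeas A ->
  smooth2 s -> supp_square N s -> smooth2 m -> supp_square e m ->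
  tame_prod leb2 leb2 (fun z => A z * (s z.1 * m (z.1 - z.2))).
Proof.
move=> bA ss Ns sm Nm; apply: (tame_prod_convol bA _ Ns sm Nm).
have [C C0 HC] := smooth2_bounded ss Ns; split; last by exists C.
by apply: continuous2_measurable; exact: smooth2_continuous.
Qed.

(** With a > 0 and a bounded support, this expresses compact support in the open half-plane with an
    explicit distance to t = 0. *)
Definition late (a : R) f := forall p : R * R, p.1 <= a -> f p = 0.

(* Kruzhkov's flux sgn (a - b) (phi a - phi b). *)
Definition kflux (phi : R -> R) (a b : R) : R := phi (Num.max a b) - phi (Num.min a b).

Lemma kfluxC phi a b : kflux phi a b = kflux phi b a.
Proof. by rewrite /kflux maxC minC. Qed.

Lemma ler_dist_max (a b c : R) : `|Num.max a b - Num.max a c| <= `|b - c|.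
Proof.
have [ab|ab] := leP a b; have [ac|ac] := leP a c.
- by [].
- by rewrite !ger0_norm; lra.
- by rewrite !ler0_norm; lra.
- by rewrite subrr normr0.
Qed.

Lemma ler_dist_min (a b c : R) : `|Num.min a b - Num.min a c| <= `|b - c|.
Proof.
have [ab|ab] := leP a b; have [ac|ac] := leP a c.
- by rewrite subrr normr0.
- by rewrite !ger0_norm; lra.
- by rewrite !ler0_norm; lra.
- by [].
Qed.

Definition lip_on (phi : R -> R) (C Lam : R) := forall a b, `|a| <= C -> `|b| <= C ->
  `|phi a - phi b| <= Lam * `|a - b|.

Lemma norm_max (a b C : R) : `|a| <= C -> `|b| <= C -> `|Num.max a b| <= C.
Proof. by move=> aC bC; have [] := leP a b. Qed.
Lemma norm_min (a b C : R) : `|a| <= C -> `|b| <= C -> `|Num.min a b| <= C.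
Proof. by move=> aC bC; have [] := leP a b. Qed.

Lemma kflux_lip phi C Lam (a b c : R) : lip_on phi C Lam -> 0 <= Lam ->
  `|a| <= C -> `|b| <= C -> `|c| <= C ->
  `|kflux phi a b - kflux phi a c| <= 2 * Lam * `|b - c|.
Proof.
move=> H L0 aC bC cC; rewrite /kflux.
have -> : phi (Num.max a b) - phi (Num.min a b) - (phi (Num.max a c) - phi (Num.min a c)) =
  (phi (Num.max a b) - phi (Num.max a c)) - (phi (Num.min a b) - phi (Num.min a c)) by ring.
rewrite (le_trans (ler_normB _ _))// mulr2n mulrDl mul1r mulrDl lerD//.
  rewrite (le_trans (H _ _ (norm_max aC bC) (norm_max aC cC)))//.
  by rewrite ler_wpM2l// ler_dist_max.
rewrite (le_trans (H _ _ (norm_min aC bC) (norm_min aC cC)))//.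
by rewrite ler_wpM2l// ler_dist_min.
Qed.

Lemma kflux_le phi C Lam (a b : R) : lip_on phi C Lam -> `|a| <= C -> `|b| <= C ->
  `|kflux phi a b| <= Lam * `|a - b|.
Proof.
move=> H aC bC; rewrite /kflux (le_trans (H _ _ (norm_max aC bC) (norm_min aC bC)))//.
have -> // : `|Num.max a b - Num.min a b| = `|a - b|.
by have [ab|ab] := leP a b; rewrite // distrC.
Qed.

Lemma kflux_normE phi (a b : R) : `|a - b| * (phi a - phi b) = kflux phi a b * (a - b).
Proof.
rewrite /kflux; have [ab|ab] := leP a b.
  by rewrite ler0_norm ?subr_le0//; ring.
by rewrite ger0_norm ?subr_ge0 ?(ltW ab)//; ring.
Qed.

Lemma kflux_bounded phi C Lam (a b : R) : lip_on phi C Lam -> 0 <= Lam -> `|a| <= C -> `|b| <= C ->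
  `|kflux phi a b| <= Lam * (C + C).
Proof.
move=> H L0 aC bC; rewrite (le_trans (kflux_le H aC bC))// ler_wpM2l//.
by rewrite (le_trans (ler_normB _ _))// lerD.
Qed.

Lemma bmeas_kflux d (T : measurableType d) phi C Lam (u v : T -> R) : continuous phi ->
  lip_on phi C Lam -> 0 <= Lam ->
  measurable_fun setT u -> measurable_fun setT v ->
  (forall p, `|u p| <= C) -> (forall p, `|v p| <= C) -> bmeas (fun p => kflux phi (u p) (v p)).
Proof.
move=> cphi H L0 mu mv uC vC; split.
  have mphi : measurable_fun setT phi by exact: continuous_measurable_fun.
  apply: measurable_funB; apply: measurableT_comp => //.
    exact: measurable_maxr.
  exact: measurable_minr.
by exists (Lam * (C + C)) => p; exact: kflux_bounded.
Qed.

Definition kruzkov (phi : R -> R) (w : R * R -> R) := forall (k : R) (psi : R * R -> R) (a N : R),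
  smooth2 psi -> 0 < a -> late a psi -> supp_square N psi -> (forall p, 0 <= psi p) ->
  0 <= \int[leb2]_p (`|w p - k| * partial_t psi p + kflux phi (w p) k * partial_x psi p).

End Shift.

Lemma tame_prodD d1 d2 (T1 : measurableType d1) (T2 : measurableType d2) (R : realType)
  (m1 : {measure set T1 -> \bar R}) (m2 : {measure set T2 -> \bar R}) (f g : T1 * T2 -> R) :
  tame_prod m1 m2 f -> tame_prod m1 m2 g -> tame_prod m1 m2 (fun z => f z + g z).
Proof.
have lem d (T : measurableType d) (m : {measure set T -> \bar R}) (A B : set T) :
    measurable A -> measurable B -> (m A < +oo)%E -> (m B < +oo)%E -> (m (A `|` B) < +oo)%E.
  by move=> mA mB Aoo Boo; apply: le_lt_trans (measureU2 _ mA mB) _; exact: lte_add_pinfty.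
move=> [mf [A1 [A2 [C [mA1 A1oo mA2 A2oo fC]]]]] [mg [B1 [B2 [D [mB1 B1oo mB2 B2oo gD]]]]].
split; first exact: measurable_funD.
exists (A1 `|` B1), (A2 `|` B2), (`|C| + `|D|); split; [exact: measurableU|exact: lem|exact: measurableU|exact: lem|].
have mono (E : R) (A A' B B' : set _) (z : T1 * T2) : A `<=` A' -> B `<=` B' ->
    E * (\1_A z.1 * \1_B z.2) <= `|E| * (\1_A' z.1 * \1_B' z.2).
  move=> AA BB; rewrite !indicE.
  have [/set_mem hA|hA] := boolP (z.1 \in A); last by rewrite mul0r mulr0 !mulr_ge0.
  have [/set_mem hB|hB] := boolP (z.2 \in B); last by rewrite !mulr0 !mulr_ge0.
  rewrite (mem_set (AA _ hA)) (mem_set (BB _ hB)) !mulr1; exact: ler_norm.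
move=> z; rewrite (le_trans (ler_normD _ _))// mulrDl lerD//.
  by rewrite (le_trans (fC z))// mono//; exact: subsetUl.
by rewrite (le_trans (gD z))// mono//; exact: subsetUr.
Qed.

(** The mollifier reaches back in time by at most e <= a / 2, so what lives after time a stays after
    time a / 2. *)
Lemma late_shift_contra (R : realType) (a e x y : R) :
  x - y <= e -> 2 * e <= a -> a < x -> y <= a / 2 -> False.
Proof. by lra. Qed.

Section Doubling.
Context {R : realType}.
Variable th : R -> R.
Hypothesis sth : smooth1 th.
Hypothesis th0 : forall x, x <= 0 -> th x = 0.
Hypothesis th1 : forall x, 1 <= x -> th x = 1.
Hypothesis dth_ge0 : forall x, 0 <= derive1 th x.
Variables (phi : R -> R) (C Lam : R).
Hypothesis cphi : continuous phi.
Hypothesis phi_lip : lip_on phi C Lam.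
Hypothesis Lam0 : 0 <= Lam.
Variables w1 w2 : R * R -> R.
Hypothesis mw1 : measurable_fun setT w1.
Hypothesis mw2 : measurable_fun setT w2.
Hypothesis w1C : forall p, `|w1 p| <= C.
Hypothesis w2C : forall p, `|w2 p| <= C.

Let C0 : 0 <= C. Proof. exact: le_trans (w1C (0, 0)). Qed.

Let K e := kern2 th e.

Let D (z : (R * R) * (R * R)) := `|w1 z.1 - w2 z.2|.
Let F (z : (R * R) * (R * R)) := kflux phi (w1 z.1) (w2 z.2).

Let bD : bmeas D.
Proof.
apply/bmeas_norm/bmeasB; (split; last by exists C => z) => //.
  exact: (measurableT_comp mw1 measurable_fst).
exact: (measurableT_comp mw2 measurable_snd).
Qed.

Let bF : bmeas F.
Proof.
apply: (bmeas_kflux (C := C) (Lam := Lam)) => //.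
  exact: (measurableT_comp mw1 measurable_fst).
exact: (measurableT_comp mw2 measurable_snd).
Qed.

Let bd : bmeas (fun p => `|w1 p - w2 p|).
Proof. by apply/bmeas_norm/bmeasB; split => //; exists C. Qed.

Let bf : bmeas (fun p => kflux phi (w1 p) (w2 p)).
Proof. exact: (bmeas_kflux (C := C) (Lam := Lam)). Qed.

(* The test functions psi(p) K(p - q) and K(p - .) psi(p): the derivatives of K cancel. *)
Lemma doubling_ge0 (psi : R * R -> R) (a N e : R) : kruzkov phi w1 -> kruzkov phi w2 ->
  smooth2 psi -> 0 < a -> late a psi -> supp_square N psi -> (forall p, 0 <= psi p) ->
  0 < e -> 2 * e <= a ->
  0 <= \int[leb2]_p \int[leb2]_q
    (D (p, q) * (partial_t psi p * K e (p - q)) + F (p, q) * (partial_x psi p * K e (p - q))).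
Proof.
move=> k1 k2 spsi a0 la Npsi psi0 e0 ea.
have sK : smooth2 (K e) by exact: smooth2_kern2.
have NK : supp_square e (K e) by exact: kern2_supp_square.
have K0 p : 0 <= K e p by exact: kern2_ge0.
have [NKt NKx] := supp_square_partial NK; have [Npt Npx] := supp_square_partial Npsi.
have sKt := smooth2_partial_t sK; have sKx := smooth2_partial_x sK.
have spt := smooth2_partial_t spsi; have spx := smooth2_partial_x spsi.
have T1 := tame_prod_test bD spt Npt sK NK.
have T2 := tame_prod_test bF spx Npx sK NK.
have T3 := tame_prod_test bD spsi Npsi sKt NKt.
have T4 := tame_prod_test bF spsi Npsi sKx NKx.
pose G1 (z : (R * R) * (R * R)) := (D z * (partial_t psi z.1 * K e (z.1 - z.2)) + F z * (partial_x psi z.1 * K e (z.1 - z.2))).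
pose G2 (z : (R * R) * (R * R)) := (D z * (psi z.1 * partial_t (K e) (z.1 - z.2)) + F z * (psi z.1 * partial_x (K e) (z.1 - z.2))).
have TG1 : tame_prod leb2 leb2 G1 := tame_prodD T1 T2.
have TG2 : tame_prod leb2 leb2 G2 := tame_prodD T3 T4.
have TG := tame_prodD TG1 TG2.
(* For fixed q, the value [w2 q] is the constant in the inequality for w1. G1 carries the
   derivatives of psi, G2 those of the kernel. *)
have H1 : 0 <= \int[leb2]_q \int[leb2]_p (G1 (p, q) + G2 (p, q)).
  apply: Rintegral_ge0 => q _.
  have [sS St Sx] := smooth2_shift q sK.
  have := k1 (w2 q) (psi \* (fun p => K e (p - q))) a N (smooth2M spsi sS) a0.
  have l' : late a (psi \* (fun p => K e (p - q))) by move=> p pa /=; rewrite la// mul0r.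
  have N' : supp_square N (psi \* (fun p => K e (p - q))) by move=> p pa /=; rewrite Npsi// mul0r.
  move=> /(_ l' N' (fun p => mulr_ge0 (psi0 p) (K0 _))).
  congr (_ <= _); apply: eq_Rintegral => p _.
  rewrite (partial_tM _ spsi sS) (partial_xM _ spsi sS) St Sx /G1 /G2 /D /F /=; ring.
have H2 : 0 <= - \int[leb2]_p \int[leb2]_q G2 (p, q).
  rewrite -mulN1r -tame_RintZ; last exact: leb2_tame_prod_int_fst TG2.
  apply: Rintegral_ge0 => p _.
  (* Here [w1 p] is the constant in the inequality for w2. Where psi vanishes there is nothing to
     show; elsewhere a < p.1, which places the kernel, as a function of q, after time a / 2. *)
  have [p0|p0] := eqVneq (psi p) 0.
    rewrite (_ : (fun q => G2 (p, q)) = (fun=> 0)); last first.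
      apply/funext => q; transitivity (psi p * (D (p, q) * partial_t (K e) (p - q) + F (p, q) * partial_x (K e) (p - q))).
        by rewrite /G2 [(p, q).1]/= [(p, q).2]/=; ring.
      by rewrite p0 mul0r.
    by rewrite Rintegral_cst// mul0r mulr0.
  have pa : a < p.1 by rewrite ltNge; apply/negP => /la; exact/eqP.
  have sR := smooth2_refl p sK.
  have sc : smooth2 (cst (psi p) : R * R -> R) by move=> k; exact: Ck2_cst.
  have := k2 (w1 p) (cst (psi p) \* (fun q => K e (p - q))) (a / 2) (e + (`|p.1| + `|p.2|)) (smooth2M sc sR).
  rewrite divr_gt0// => /(_ isT).
  have l' : late (a / 2) (cst (psi p) \* (fun q => K e (p - q))).
    move=> q qa /=; have [->|] := eqVneq (K e (p - q)) 0; first by rewrite mulr0.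
    move=> /(kern2_supp th0 th1 e0)[/= /andP[_ h] _]; exfalso.
    exact: late_shift_contra h ea pa qa.
  have N' : supp_square (e + (`|p.1| + `|p.2|)) (cst (psi p) \* (fun q => K e (p - q))).
    move=> q nq /=; rewrite (supp_square_refl NK (M := `|p.1| + `|p.2|)) ?mulr0// ?lerDl ?lerDr//.
  move=> /(_ l' N' (fun q => mulr_ge0 (psi0 p) (K0 _))).
  congr (_ <= _); rewrite -tame_RintZ; last exact: leb2_tame_prod_fst TG2.
  apply: eq_Rintegral => q _.
  rewrite (partial_tM _ sc sR) (partial_xM _ sc sR).
  rewrite (partial_t_refl _ _ (smooth2_derivable_t sK)).2 (partial_x_refl _ _ (smooth2_derivable_x sK)).2.
  have -> : partial_t (cst (psi p) : R * R -> R) q = 0 by exact: derive_cst.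
  have -> : partial_x (cst (psi p) : R * R -> R) q = 0 by exact: derive_cst.
  rewrite /G2 /D /F /= kfluxC distrC; ring.
have I1 : tame leb2 (fun p => \int[leb2]_q G1 (p, q)) by exact: leb2_tame_prod_int_fst TG1.
have I2 : tame leb2 (fun p => \int[leb2]_q G2 (p, q)) by exact: leb2_tame_prod_int_fst TG2.
have E : \int[leb2]_p \int[leb2]_q (G1 (p, q) + G2 (p, q)) =
    \int[leb2]_p \int[leb2]_q G1 (p, q) + \int[leb2]_p \int[leb2]_q G2 (p, q).
  rewrite -(tame_RintD I1 I2); apply: eq_Rintegral => p _.
  by rewrite tame_RintD//; [exact: leb2_tame_prod_fst TG1|exact: leb2_tame_prod_fst TG2].
have S : \int[leb2]_p \int[leb2]_q (G1 (p, q) + G2 (p, q)) =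
    \int[leb2]_q \int[leb2]_p (G1 (p, q) + G2 (p, q)) := leb2_tame_prod_swap TG.
have : 0 <= \int[leb2]_p \int[leb2]_q G1 (p, q).
  by have := addr_ge0 H1 H2; rewrite -S E addrK.
by [].
Qed.

(** In [doubling_ge0] the derivatives fall on psi alone and w1 is already taken at p. Replacing
    [w2 q] by [w2 p] costs a multiple of the mean oscillation of w2 at scale e, because |a - b| and
    [kflux phi a b] are Lipschitz in b; this oscillation tends to 0. *)
Lemma kruzkov_pair (psi : R * R -> R) (a N : R) : kruzkov phi w1 -> kruzkov phi w2 ->
  smooth2 psi -> 0 < a -> late a psi -> supp_square N psi -> (forall p, 0 <= psi p) ->
  0 <= \int[leb2]_p (`|w1 p - w2 p| * partial_t psi p + kflux phi (w1 p) (w2 p) * partial_x psi p).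
Proof.
move=> k1 k2 spsi a0 la Npsi psi0.
have [Npt Npx] := supp_square_partial Npsi.
have spt := smooth2_partial_t spsi; have spx := smooth2_partial_x spsi.
have [A A0 HA] := smooth2_bounded spt Npt; have [B B0 HB] := smooth2_bounded spx Npx.
set X0 := \int[leb2]_p _.
have bw2 : bmeas w2 by split => //; exists C.
have key e : 0 < e -> 2 * e <= a -> - X0 <= (A + 2 * Lam * B) * kern_osc th w2 N e.
  move=> e0 ea; have H := doubling_ge0 k1 k2 spsi a0 la Npsi psi0 e0 ea.
  have sK : smooth2 (K e) by exact: smooth2_kern2.
  have NK : supp_square e (K e) by exact: kern2_supp_square.
  have K0 p : 0 <= K e p by exact: kern2_ge0.
  have bdz : bmeas (fun z : (R * R) * (R * R) => `|w1 z.1 - w2 z.1|).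
    by apply/bmeas_norm/bmeasB; (split; last by exists C => z) => //; exact: (measurableT_comp _ measurable_fst).
  have bfz : bmeas (fun z : (R * R) * (R * R) => kflux phi (w1 z.1) (w2 z.1)).
    by apply: (bmeas_kflux (C := C) (Lam := Lam)) => //; exact: (measurableT_comp _ measurable_fst).
  have T1 := tame_prodD (tame_prod_test bD spt Npt sK NK) (tame_prod_test bF spx Npx sK NK).
  have T2 := tame_prodD (tame_prod_test bdz spt Npt sK NK) (tame_prod_test bfz spx Npx sK NK).
  have T3 := tame_prod_kern sth th0 th1 dth_ge0 N e0 (bmeas_diff bw2).
  have I1 : tame leb2 (fun p => \int[leb2]_q (D (p, q) * (partial_t psi p * K e (p - q)) + F (p, q) * (partial_x psi p * K e (p - q)))) by exact: leb2_tame_prod_int_fst T1.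
  have I2 : tame leb2 (fun p => \int[leb2]_q (`|w1 p - w2 p| * (partial_t psi p * K e (p - q)) + kflux phi (w1 p) (w2 p) * (partial_x psi p * K e (p - q)))) by exact: leb2_tame_prod_int_fst T2.
  have I3 : tame leb2 (fun p => \int[leb2]_q (\1_(square N) p * (`|w2 q - w2 p| * K e (p - q)))) by exact: leb2_tame_prod_int_fst T3.
  have E0 : X0 = \int[leb2]_p \int[leb2]_q (`|w1 p - w2 p| * (partial_t psi p * K e (p - q)) + kflux phi (w1 p) (w2 p) * (partial_x psi p * K e (p - q))).
    apply: eq_Rintegral => p _.
    rewrite (_ : (fun q => _) = (fun q => (`|w1 p - w2 p| * partial_t psi p + kflux phi (w1 p) (w2 p) * partial_x psi p) * K e (p - q))).
      rewrite tame_RintZ; last exact: tame_kern2.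
      by rewrite Rint_kern2// mulr1.
    by apply/funext => q; ring.
  apply: (@le_trans _ _ (\int[leb2]_p \int[leb2]_q (D (p, q) * (partial_t psi p * K e (p - q)) + F (p, q) * (partial_x psi p * K e (p - q))) - X0)).
    by rewrite -[leLHS]add0r lerD2r.
  rewrite E0 -(tame_RintB I1 I2) /kern_osc -(tame_RintZ _ I3).
  apply: tame_le_Rint; [exact: (tameB I1 I2)|exact: (tameZ _ I3)|move=> p].
  have J1 := leb2_tame_prod_fst p T1; have J2 := leb2_tame_prod_fst p T2.
  have J3 := leb2_tame_prod_fst p T3.
  rewrite -(tame_RintB J1 J2) -(tame_RintZ _ J3).
  apply: tame_le_Rint; [exact: (tameB J1 J2)|exact: (tameZ _ J3)|move=> q].
  rewrite [leLHS](_ : _ = ((D (p, q) - `|w1 p - w2 p|) * partial_t psi p + (F (p, q) - kflux phi (w1 p) (w2 p)) * partial_x psi p) * K e (p - q)); last by rewrite /=; ring.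
  rewrite [leRHS](_ : _ = ((A + 2 * Lam * B) * (\1_(square N) p * `|w2 q - w2 p|)) * K e (p - q)); last by rewrite /= -/(K e (p - q)); ring.
  rewrite ler_wpM2r//.
  have [pN|pN] := pselect (square N p); last first.
    by rewrite Npt// Npx// !mulr0 addr0 indicE memNset// mul0r mulr0.
  rewrite indicE mem_set// mul1r [leRHS]mulrDl; apply: lerD.
    rewrite (le_trans (ler_norm _))// normrM mulrC ler_pM//.
    rewrite /D /= (le_trans (ler_dist_dist _ _))//.
    by rewrite (_ : w1 p - w2 q - (w1 p - w2 p) = - (w2 q - w2 p)) ?normrN//; ring.
  rewrite (le_trans (ler_norm _))// normrM mulrAC ler_pM//.
  by rewrite /F /=; exact: (kflux_lip phi_lip).
pose e n : R := a / 2 * n.+1%:R^-1.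
have e0 n : 0 < e n by rewrite mulr_gt0 ?divr_gt0.
have ecv : e n @[n --> \oo] --> 0.
  rewrite -[X in _ --> X](mulr0 (a / 2)); apply: cvgM; first exact: cvg_cst.
  exact: cvg_harmonic.
have cv := @kern_osc_cvg0 R th sth th0 th1 dth_ge0 w2 N e bw2 e0 ecv.
have cv2 : (A + 2 * Lam * B) * kern_osc th w2 N (e n) @[n --> \oo] --> 0.
  by rewrite -[X in _ --> X](mulr0 (A + 2 * Lam * B)); apply: cvgM => //; exact: cvg_cst.
rewrite -oppr_le0.
apply: (cvgr_to_ge cv2); apply: nearW => n; apply: key => //.
by rewrite /e mulrA [2 * _]mulrC divfK// ler_piMr ?(ltW a0)// invf_le1 ?ltr0n// ler1n.
Qed.

End Doubling.

(** * The potential of the difference of two solutions *)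

Section PlaneCalculus.
Context {R : realType}.
Notation mu := (@lebesgue_measure R).
Implicit Types (a : R -> R) (f L : R * R -> R).

Lemma linear_partials a (al be : R) (p : R * R) : smooth1 a ->
  [/\ derivable (fun p => a (al * p.1 + be * p.2)) p (1, 0),
      derivable (fun p => a (al * p.1 + be * p.2)) p (0, 1),
      partial_t (fun p => a (al * p.1 + be * p.2)) p = al * derive1 a (al * p.1 + be * p.2) &
      partial_x (fun p => a (al * p.1 + be * p.2)) p = be * derive1 a (al * p.1 + be * p.2)].
Proof.
move=> sa; have [Ht Et] := derive_tE (fun p => a (al * p.1 + be * p.2)) p.
have [Hx Ex] := derive_xE (fun p => a (al * p.1 + be * p.2)) p.
have [D1 D2] := derive1_affine (smooth1_derivable sa (x := al * p.1 + be * p.2)).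
have [D3 D4] := derive1_affine (c := be) (x := p.2) (d := al * p.1) (smooth1_derivable sa (x := be * p.2 + al * p.1)).
have E : (fun x => a (al * (p.1, x).1 + be * (p.1, x).2)) = (fun x => a (be * x + al * p.1)).
  by apply/funext => x /=; rewrite addrC.
rewrite /= in Ht; split; first exact: Ht.2 D1.
- by apply/Hx; rewrite E.
- by rewrite Et [LHS]D2.
- by rewrite Ex E [LHS]D4 addrC.
Qed.

Lemma smooth2_linear a (al be : R) : smooth1 a -> smooth2 (fun p => a (al * p.1 + be * p.2)).
Proof.
move=> sa k; elim: k a sa => [|k IH] a sa.
  split=> // p; apply: continuous_comp; last exact: (smooth1_continuous sa).
  by apply: cvgD; apply: cvgM; [exact: cvg_cst|exact: cvg_fst|exact: cvg_cst|exact: cvg_snd].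
split; first exact: Ck2_continuous (IH a sa).
have sd := smooth1_derive sa; split.
- move=> p; case: (linear_partials al be p sa) => h _ _ _; apply h.
- move=> p; case: (linear_partials al be p sa) => _ h _ _; apply h.
- rewrite (_ : partial_t _ = cst al \* (fun p => derive1 a (al * p.1 + be * p.2))).
    by apply: Ck2M; [exact: Ck2_cst|exact: IH].
  by apply/funext => p; have [_ _ -> _] := linear_partials al be p sa.
- rewrite (_ : partial_x _ = cst be \* (fun p => derive1 a (al * p.1 + be * p.2))).
    by apply: Ck2M; [exact: Ck2_cst|exact: IH].
  by apply/funext => p; have [_ _ _ ->] := linear_partials al be p sa.
Qed.

Lemma is_derive_continuous (f df : R -> R) : (forall x : R, is_derive x 1 f (df x)) -> continuous f.
Proof.
by move=> D s; apply: differentiable_continuous; apply/derivable1_diffP; have [] := D s.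
Qed.

Lemma Rint_derive0 (f df : R -> R) N : (forall x : R, is_derive x 1 f (df x)) ->
  continuous df -> 0 < N -> (forall x, N <= `|x| -> f x = 0) -> (forall x, N < `|x| -> df x = 0) ->
  \int[mu]_x df x = 0.
Proof.
move=> D cdf N0 f0 df0.
have -> : \int[mu]_s df s = \int[mu]_(s in `[- N, N]) df s.
  rewrite [RHS]Rintegral_mkcond; apply: eq_Rintegral => s _; rewrite patchE.
  case: ifPn => // /negP ns; apply: df0; rewrite ltNge; apply/negP => H; apply: ns.
  by apply/mem_set; rewrite /= in_itv/= -ler_norml.
have cf := is_derive_continuous D.
rewrite /Rintegral (@continuous_FTC2 R _ f (- N) N (gtrN N0)).
- by rewrite /= !f0 ?subrr// ?normrN ler_norm.
- exact: (continuous_subspaceT cdf).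
- split.
  + by move=> s _; have [] := D s.
  + exact/cvg_at_right_filter/cf.
  + exact/cvg_at_left_filter/cf.
- by move=> s _; rewrite derive1E; have [_ ->] := D s.
Qed.

Lemma Rint_partial0 f N : smooth2 f -> supp_square N f ->
  \int[leb2]_p partial_t f p = 0 /\ \int[leb2]_p partial_x f p = 0.
Proof.
move=> sf Nf; have [Nt Nx] := supp_square_partial Nf.
have [st sx] := (smooth2_partial_t sf, smooth2_partial_x sf).
have lem g : smooth2 g -> supp_square N g -> tame_prod mu mu g.
  move=> sg Ng; have [C C0 HC] := smooth2_bounded sg Ng.
  apply: (tame_prod_supp_square (N := N) (C := C)); last exact: supp_square_indic.
  by apply: continuous2_measurable; exact: smooth2_continuous.
have z0 : \int[mu]_x (0 : R) = 0 by rewrite Rintegral_cst// mul0r.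
have M0 : 0 < `|N| + 1 by rewrite ltr_wpDl.
have NM : N < `|N| + 1 by rewrite (le_lt_trans (ler_norm N))// ltrDl.
split.
- rewrite (leb2_Rint21 (lem _ st Nt)) -[RHS]z0; apply: eq_Rintegral => x _.
  apply: (@Rint_derive0 (fun t => f (t, x)) _ (`|N| + 1)) => //.
  + by move=> t; apply smooth2_is_derive_t.
  + apply: (@is_derive_continuous _ (fun t => partial_t (partial_t f) (t, x))) => t.
    by apply smooth2_is_derive_t.
  + by move=> t Nt'; apply: Nf => -[/= + _]; rewrite in_itv/= -ler_norml; lra.
  + by move=> t Nt'; apply: Nt => -[/= + _]; rewrite in_itv/= -ler_norml; lra.
- rewrite (leb2_Rint12 (lem _ sx Nx)) -[RHS]z0; apply: eq_Rintegral => t _.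
  apply: (@Rint_derive0 (fun x => f (t, x)) _ (`|N| + 1)) => //.
  + by move=> x; apply smooth2_is_derive_x.
  + apply: (@is_derive_continuous _ (fun x => partial_x (partial_x f) (t, x))) => x.
    by apply smooth2_is_derive_x.
  + by move=> x Nt'; apply: Nf => -[/= _]; rewrite in_itv/= -ler_norml; lra.
  + by move=> x Nt'; apply: Nx => -[/= _]; rewrite in_itv/= -ler_norml; lra.
Qed.

Lemma continuous_bounded_square f N : continuous f ->
  exists2 C, 0 < C & forall p, square N p -> `|f p| <= C.
Proof.
move=> cf; have /compact_bounded[M [Mr HM]] : compact (f @` square N).
  by apply: continuous_compact; [exact: continuous_subspaceT|exact: compact_square].
exists (`|M| + 1); first by rewrite ltr_wpDl.
move=> p Np; apply: (HM (`|M| + 1)); last by exists p.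
by rewrite (le_lt_trans (ler_norm M))// ltrDl.
Qed.

Lemma continuous_square_tame f N : continuous f -> tame leb2 (fun p => \1_(square N) p * f p).
Proof.
move=> cf; have [C C0 HC] := continuous_bounded_square N cf; split.
  apply: measurable_funM; last exact: continuous2_measurable.
  by apply: measurable_indic; exact: measurable_square.
exists (square N), C; split; [exact: measurable_square|exact: leb2_square_lty|move=> p].
rewrite indicE; have [/set_mem pN|pN] := boolP (p \in _).
  by rewrite mul1r mulr1 HC.
by rewrite mul0r normr0 mulr0.
Qed.

End PlaneCalculus.

(** * Cutoffs in time and to backward cones *)

Section Cutoffs.
Context {R : realType}.
Variable th : R -> R.
Hypothesis sth : smooth1 th.
Hypothesis th0 : forall x, x <= 0 -> th x = 0.
Hypothesis th1 : forall x, 1 <= x -> th x = 1.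
Hypothesis dth_ge0 : forall x, 0 <= derive1 th x.

(** A nonincreasing time cutoff of slope at most -1 up to time T - 1. Testing with it turns a
    statement about time derivatives into one about integrals over [0, T - 1], rather than about
    values at a single time. *)
Definition ramp (T t : R) : R := (T - t) * th (T - t).
(** Switches on between the times e and 2 * e. It makes a test function [late], at the price of a
    derivative of size 1 / e on a layer of width e. *)
Definition delay (e t : R) : R := th (e^-1 * t - 1).

Lemma is_derive_ramp (T t : R) :
  is_derive t 1 (ramp T) (- th (T - t) - (T - t) * derive1 th (T - t)).
Proof.
have [D1 D2] := derive1_affine (c := -1) (x := t) (d := T) (smooth1_derivable sth (x := -1 * t + T)).
have D3 : is_derive t 1 (fun s => th (-1 * s + T)) (-1 * derive1 th (-1 * t + T)).
  by apply: (DeriveDef D1); rewrite -derive1E.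
have E : ramp T = (fun s => T - s) \* (fun s => th (-1 * s + T)).
  by apply/funext => s; rewrite /ramp /= mulN1r addrC.
rewrite E; have D4 : is_derive t 1 (fun s => T - s) (-1).
  apply: (is_derive_eq (is_deriveB (is_derive_cst T t 1) (is_derive_id t 1))).
  by rewrite sub0r.
apply: (is_derive_eq (is_deriveM D4 D3)).
by rewrite (_ : -1 * t + T = T - t) /GRing.scale /=; ring.
Qed.

Lemma smooth1_ramp T : smooth1 (ramp T).
Proof.
have -> : ramp T = (fun s => -1 * s + T) \* (fun s => th (-1 * s + T)).
  by apply/funext => s; rewrite /ramp /= mulN1r addrC.
by apply: smooth1M; [exact: (smooth1_affine _ _ (@smooth1_id R))|exact: smooth1_affine].
Qed.

Lemma ramp_late T t : T <= t -> ramp T t = 0.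
Proof. by move=> Tt; rewrite /ramp th0 ?mulr0// subr_le0. Qed.

Lemma ramp_ge0 T t : 0 <= ramp T t.
Proof.
have [Tt|tT] := leP T t; first by rewrite ramp_late.
by rewrite mulr_ge0 ?subr_ge0 ?(ltW tT)//; exact: (step_ge0 sth th0 dth_ge0).
Qed.

Lemma ramp_le T t : 0 <= T -> 0 <= t -> ramp T t <= T.
Proof.
move=> T0 t0; have [Tt|tT] := leP T t; first by rewrite ramp_late.
have h1 := step_le1 sth th1 dth_ge0 (T - t).
have h0 := step_ge0 sth th0 dth_ge0 (T - t).
by rewrite /ramp (le_trans (ler_piMr _ h1))// ?subr_ge0 ?(ltW tT)// gerDl oppr_le0.
Qed.

Lemma dramp_le0 T t : derive1 (ramp T) t <= 0.
Proof.
rewrite derive1E; have [_ ->] := is_derive_ramp T t.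
have h0 := step_ge0 sth th0 dth_ge0 (T - t); have [Tt|tT] := leP T t.
  have [->|/(dth_supp th0 th1)] := eqVneq (derive1 th (T - t)) 0.
    by rewrite mulr0 subr0 oppr_le0.
  move=> /andP[Tt' _]; have -> : T - t = 0 by apply/eqP; rewrite eq_le subr_le0 Tt.
  by rewrite mul0r subr0 oppr_le0 th0.
by rewrite -opprD oppr_le0 addr_ge0// mulr_ge0// subr_ge0 ltW.
Qed.

Lemma dramp_leN1 T t : t + 1 <= T -> derive1 (ramp T) t <= -1.
Proof.
move=> tT; rewrite derive1E; have [_ ->] := is_derive_ramp T t.
rewrite th1; last by rewrite lerBrDl.
rewrite gerBl mulr_ge0//; lra.
Qed.

Lemma is_derive_delay (e t : R) : is_derive t 1 (delay e) (e^-1 * derive1 th (e^-1 * t - 1)).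
Proof.
have [D1 D2] := derive1_affine (c := e^-1) (x := t) (d := -1) (smooth1_derivable sth (x := e^-1 * t - 1)).
by apply: (DeriveDef D1); rewrite -derive1E.
Qed.

Lemma smooth1_delay e : smooth1 (delay e). Proof. exact: smooth1_affine. Qed.

Lemma delay0 e t : 0 < e -> t <= e -> delay e t = 0.
Proof. by move=> e0 te; rewrite /delay th0// subr_le0 mulrC ler_pdivrMr// mul1r. Qed.

Lemma delay1 e t : 0 < e -> 2 * e <= t -> delay e t = 1.
Proof. by move=> e0 te; rewrite /delay th1// lerBrDr mulrC ler_pdivlMr. Qed.

Lemma delay01 e t : 0 <= delay e t <= 1.
Proof. by rewrite /delay (step_ge0 sth th0 dth_ge0) (step_le1 sth th1 dth_ge0). Qed.

Lemma ddelay_ge0 e t : 0 < e -> 0 <= derive1 (delay e) t.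
Proof.
move=> e0; rewrite derive1E; have [_ ->] := is_derive_delay e t.
by rewrite mulr_ge0// invr_ge0 ltW.
Qed.

Lemma ddelay_supp e t : 0 < e -> derive1 (delay e) t != 0 -> e <= t <= 2 * e.
Proof.
move=> e0; rewrite derive1E; have [_ ->] := is_derive_delay e t.
rewrite mulf_eq0 negb_or => /andP[_ /(dth_supp th0 th1)].
by rewrite subr_ge0 lerBlDr mulrC ler_pdivlMr// ler_pdivrMr// mul1r.
Qed.

Lemma ddelay_le : exists2 B, 0 < B & forall e t, 0 < e -> derive1 (delay e) t <= B / e.
Proof.
have [B B0 HB] := dth_bounded sth th0 th1; exists B => // e t e0.
rewrite derive1E; have [_ ->] := is_derive_delay e t.
by rewrite mulrC ler_wpM2r// invr_ge0 ltW.
Qed.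

(* Cutoff to the backward cone |x| + Lam t <= S: if |F| <= Lam |d|, then the flux through its
   boundary has a sign, |d| c_t + F c_x <= 0. *)
Definition cone (S Lam : R) (p : R * R) : R :=
  th (S - Lam * p.1 - p.2) * th (S - Lam * p.1 + p.2).

Lemma smooth2_cone S Lam : smooth2 (cone S Lam).
Proof.
have sa : smooth1 (fun x => th (1 * x + S)) by exact: smooth1_affine.
have -> : cone S Lam = (fun p => th (1 * (- Lam * p.1 + (-1) * p.2) + S)) \*
    (fun p => th (1 * (- Lam * p.1 + 1 * p.2) + S)).
  by apply/funext => p; rewrite /cone /=; congr (th _ * th _); ring.
exact: (smooth2M (smooth2_linear _ _ sa) (smooth2_linear _ _ sa)).
Qed.

(** A and B are the contributions of the right and of the left edge of the cone. In this form the
    sign announced for [cone] follows from |B - A| <= A + B. *)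
Lemma cone_partials S Lam (p : R * R) : exists A B : R, [/\ 0 <= A, 0 <= B,
  partial_t (cone S Lam) p = - Lam * (A + B) & partial_x (cone S Lam) p = B - A].
Proof.
have sa : smooth1 (fun x => th (1 * x + S)) by exact: smooth1_affine.
have da x : derive1 (fun x => th (1 * x + S)) x = derive1 th (x + S).
  have [_ D] := derive1_affine (c := 1) (d := S) (x := x) (smooth1_derivable sth (x := 1 * x + S)).
  by rewrite [LHS]D !mul1r.
have E : cone S Lam = (fun p => th (1 * (- Lam * p.1 + (-1) * p.2) + S)) \*
    (fun p => th (1 * (- Lam * p.1 + 1 * p.2) + S)).
  by apply/funext => q; rewrite /cone /=; congr (th _ * th _); ring.
have [_ _ t1 x1] := linear_partials (- Lam) (-1) p sa.
have [_ _ t2 x2] := linear_partials (- Lam) 1 p sa.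
have s1 := smooth2_linear (- Lam) (-1) sa; have s2 := smooth2_linear (- Lam) 1 sa.
rewrite E (partial_tM _ s1 s2) (partial_xM _ s1 s2) t1 t2 x1 x2 !da.
exists (derive1 th (- Lam * p.1 + (-1) * p.2 + S) * th (1 * (- Lam * p.1 + 1 * p.2) + S)).
exists (derive1 th (- Lam * p.1 + 1 * p.2 + S) * th (1 * (- Lam * p.1 + (-1) * p.2) + S)).
split; try ring.
- by apply: mulr_ge0 => //; exact: (step_ge0 sth th0 dth_ge0).
- by apply: mulr_ge0 => //; exact: (step_ge0 sth th0 dth_ge0).
Qed.

Lemma cone01 S Lam p : 0 <= cone S Lam p <= 1.
Proof.
have h0 x := step_ge0 sth th0 dth_ge0 x; have h1 x := step_le1 sth th1 dth_ge0 x.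
by rewrite /cone mulr_ge0//= mulr_ile1.
Qed.

Lemma cone1 S Lam p : 1 <= S - Lam * p.1 - `|p.2| -> cone S Lam p = 1.
Proof.
move=> H; have [h1 h2] : p.2 <= `|p.2| /\ - p.2 <= `|p.2| by rewrite ler_norm -normrN ler_norm.
by rewrite /cone !th1 ?mul1r//; lra.
Qed.

Lemma cone0 S Lam p : S - Lam * p.1 <= `|p.2| -> cone S Lam p = 0.
Proof.
rewrite /cone; have [p0|p0] := leP 0 p.2.
  by rewrite ger0_norm// => H; rewrite th0 ?mul0r//; lra.
by rewrite ltr0_norm// => H; rewrite [X in _ * X]th0 ?mulr0//; lra.
Qed.

End Cutoffs.
Section Potential.
Context {R : realType}.
Variable th : R -> R.
Hypothesis sth : smooth1 th.
Hypothesis th0 : forall x, x <= 0 -> th x = 0.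
Hypothesis th1 : forall x, 1 <= x -> th x = 1.
Hypothesis dth_ge0 : forall x, 0 <= derive1 th x.
Variables (d e F : R * R -> R) (Lam : R).
Hypothesis bd : bmeas d.
Hypothesis be : bmeas e.
Hypothesis bF : bmeas F.
Hypothesis Lam0 : 0 <= Lam.
Hypothesis eLam : forall p, `|e p| <= Lam * `|d p|.
Hypothesis FLam : forall p, `|F p| <= Lam * `|d p|.
Hypothesis deF : forall p, `|d p| * e p = F p * d p.
Hypothesis d0 : forall p : R * R, p.1 < 0 -> d p = 0.
Hypothesis weak : forall psi N, smooth2 psi -> supp_square N psi ->
  \int[leb2]_p (d p * partial_t psi p + e p * partial_x psi p) = 0.
Hypothesis kru : forall (psi : R * R -> R) (a N : R), smooth2 psi -> 0 < a -> late a psi ->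
  supp_square N psi -> (forall p, 0 <= psi p) ->
  0 <= \int[leb2]_p (`|d p| * partial_t psi p + F p * partial_x psi p).

Let K eps := kern2 th eps.

Let e0 p : p.1 < 0 -> e p = 0.
Proof. by move=> p0; apply/normr0_eq0/le_anti; rewrite normr_ge0 (le_trans (eLam p))// d0// normr0 mulr0. Qed.

(** A primitive in time of the mollifier [kern2 th eps], truncated after time N to have bounded
    support: the factor [th (N + 1 - t)] equals 1 for t <= N. *)
Definition pot_kern (N eps : R) (p : R * R) : R :=
  (th (eps^-1 * p.1) * th (N + 1 - p.1)) * kern1 th eps p.2.

(* By the weak equation for d and e, up to time N this has time derivative - e_eps and space
   derivative d_eps, where eps denotes mollification. *)
Definition pot (N eps : R) (z : R * R) : R := - convol e (pot_kern N eps) z.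

Let smooth1_pk N eps : smooth1 (fun s => th (eps^-1 * s) * th (N + 1 - s)).
Proof.
have -> : (fun s => th (eps^-1 * s) * th (N + 1 - s)) = (fun s => th (eps^-1 * s)) \* (fun s => th (-1 * s + (N + 1))).
  by apply/funext => s /=; congr (_ * th _); ring.
by apply: smooth1M; [exact: smooth1_scale|exact: smooth1_affine].
Qed.

Lemma smooth2_pot_kern N eps : smooth2 (pot_kern N eps).
Proof. by apply: (smooth2_tensor (@smooth1_pk N eps)); exact: smooth1_kern1. Qed.

Lemma pot_kern_supp N eps (p : R * R) : 0 < eps -> pot_kern N eps p != 0 ->
  0 < p.1 < N + 1 /\ 0 <= p.2 <= eps.
Proof.
move=> eps0; rewrite /pot_kern mulf_eq0 negb_or => /andP[+ h3].
rewrite mulf_eq0 negb_or => /andP[h1 h2]; split; last exact: (kern1_supp th0 th1 eps0 h3).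
apply/andP; split.
  have : 0 < eps^-1 * p.1 by rewrite ltNge; apply: contraNN h1 => h; rewrite th0.
  by rewrite pmulr_rgt0 ?invr_gt0.
rewrite ltNge; apply: contraNN h2 => h; rewrite th0// subr_le0//.
Qed.

Lemma pot_kern_square N eps : 0 < eps -> eps <= N + 1 -> supp_square (N + 1) (pot_kern N eps).
Proof.
move=> eps0 epsN; apply/supp_squareP => p /(pot_kern_supp eps0)[/andP[a b] /andP[c f]].
rewrite !ger0_norm//; [split|]; [exact: ltW|exact: le_trans f _|exact: ltW].
Qed.

Lemma partial_t_pot_kern N eps (p : R * R) : p.1 < N ->
  partial_t (pot_kern N eps) p = K eps p.
Proof.
move=> pN; rewrite (partial_t_tensor (kern1 th eps) p (@smooth1_pk N eps)) /K /kern2; congr (_ * _).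
rewrite derive1E (@near_eq_derive _ _ _ _ (fun s => th (eps^-1 * s))).
- by have [_ ->] := is_derive_step_scale sth eps p.1.
- near=> s; rewrite [X in _ * X]th1 ?mulr1//.
  have : s < N by near: s; exact: lt_nbhsl.
  lra.
Unshelve. all: by end_near. Qed.

Lemma pot_smooth2 N eps : 0 < eps -> eps <= N + 1 ->
  [/\ smooth2 (pot N eps),
      forall z, partial_t (pot N eps) z = - convol e (partial_t (pot_kern N eps)) z &
      forall z, partial_x (pot N eps) z = - convol e (partial_x (pot_kern N eps)) z].
Proof.
move=> eps0 epsN; have sL := smooth2_pot_kern N eps; have NL := pot_kern_square eps0 epsN.
have [s t x] := convol_smooth2 be sL NL.
have E : pot N eps = cst (-1) \* convol e (pot_kern N eps).
  by apply/funext => z; rewrite /pot /= mulN1r.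
have sc : smooth2 (cst (-1) : R * R -> R) by move=> k; exact: Ck2_cst.
have ct z : partial_t (cst (-1) : R * R -> R) z = 0 by exact: derive_cst.
have cx z : partial_x (cst (-1) : R * R -> R) z = 0 by exact: derive_cst.
rewrite E; split; first exact: smooth2M.
- by move=> z; rewrite (partial_tM z sc s) ct t /= mulN1r mulr0 addr0.
- by move=> z; rewrite (partial_xM z sc s) cx x /= mulN1r mulr0 addr0.
Qed.

Let pot_time (q z : R * R) N : 0 <= q.1 -> z.1 < N -> (z - q).1 < N.
Proof. by rewrite /=; lra. Qed.

Lemma partial_t_pot N eps z : 0 < eps -> eps <= N + 1 -> z.1 < N ->
  partial_t (pot N eps) z = - convol e (K eps) z.
Proof.
move=> eps0 epsN zN; have [_ -> _] := pot_smooth2 eps0 epsN; congr (- _).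
(* At negative times e vanishes; for the other q one has [(z - q).1 < N], where the truncation in
   [pot_kern] is inactive. *)
apply: eq_Rintegral => q _; have [q0|q0] := ltP q.1 0; first by rewrite e0// !mul0r.
by rewrite partial_t_pot_kern// (pot_time q0 zN).
Qed.

(** The weak equation is tested with q |-> [pot_kern N eps (z - q)], which need not vanish at q.1 =
    0. This is where the zero initial datum of d enters the argument. *)
Lemma partial_x_pot N eps z : 0 < eps -> eps <= N + 1 -> z.1 < N ->
  partial_x (pot N eps) z = convol d (K eps) z.
Proof.
move=> eps0 epsN zN; have [_ _ ->] := pot_smooth2 eps0 epsN.
have sL := smooth2_pot_kern N eps; have NL := pot_kern_square eps0 epsN.
have [NLt NLx] := supp_square_partial NL.
have sLt := smooth2_partial_t sL; have sLx := smooth2_partial_x sL.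
have NR := supp_square_refl NL (M := `|z.1| + `|z.2|) (z := z) (ltac:(by rewrite lerDl)) (ltac:(by rewrite lerDr)).
have T1 := convol_tame z bd sLt NLt; have T2 := convol_tame z be sLx NLx.
have E : \int[leb2]_q (d q * partial_t (fun q => pot_kern N eps (z - q)) q +
    e q * partial_x (fun q => pot_kern N eps (z - q)) q) =
    (-1) * convol d (partial_t (pot_kern N eps)) z - convol e (partial_x (pot_kern N eps)) z.
  rewrite /convol -(tame_RintZ _ T1) -(tame_RintB (tameZ (-1) T1) T2).
  apply: eq_Rintegral => q _.
  by rewrite (partial_t_refl _ _ (smooth2_derivable_t sL)).2 (partial_x_refl _ _ (smooth2_derivable_x sL)).2; ring.
have -> : convol d (K eps) z = convol d (partial_t (pot_kern N eps)) z.
  apply: eq_Rintegral => q _; have [q0|q0] := ltP q.1 0; first by rewrite d0// !mul0r.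
  by rewrite partial_t_pot_kern// (pot_time q0 zN).
have := weak (smooth2_refl z sL) NR; rewrite E mulN1r => /eqP.
by rewrite subr_eq0 => /eqP <-; rewrite opprK.
Qed.

Lemma pot0 N eps z : 0 < eps -> z.1 <= 0 -> pot N eps z = 0.
Proof.
move=> eps0 z0; rewrite /pot /convol (_ : (fun q => _) = (fun=> 0)).
  by rewrite Rintegral_cst// mul0r oppr0.
apply/funext => q; have [q0|q0] := ltP q.1 0; first by rewrite e0// mul0r.
have [->|/(pot_kern_supp eps0)[/= /andP[h _] _]] := eqVneq (pot_kern N eps (z - q)) 0; first by rewrite mulr0.
exfalso; move: h q0 z0; lra.
Qed.

Lemma convol_kern2_le g C eps z : bmeas g -> (forall p, `|g p| <= C) -> 0 < eps ->
  `|convol g (K eps) z| <= C.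
Proof.
move=> bg gC eps0; have TK := tame_kern2 sth th0 th1 z eps0.
have T := convol_tame z bg (smooth2_kern2 sth eps) (kern2_supp_square th0 th1 eps0).
rewrite (le_trans (tame_le_norm_Rint T))// -[leRHS]mulr1 -(Rint_kern2 sth th0 th1 dth_ge0 z eps0).
rewrite -(tame_RintZ _ TK); apply: tame_le_Rint; [exact: tame_norm|exact: tameZ|move=> q].
rewrite normrM [X in _ * X]ger0_norm ?ler_wpM2r//; exact: (kern2_ge0 dth_ge0).
Qed.

(** Mean value theorem in time from [pot0], as the time derivative is the opposite of a
    mollification of e and keeps its bound. The estimate is uniform in eps. *)
Lemma pot_le C N eps z : (forall p, `|e p| <= C) -> 0 < eps -> eps <= N + 1 -> 0 <= z.1 -> z.1 < N ->
  `|pot N eps z| <= C * z.1.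
Proof.
move=> eC eps0 epsN z0 zN; have [sD _ _] := pot_smooth2 eps0 epsN.
move: z0; rewrite le_eqVlt => /predU1P[z0|z0].
  by rewrite pot0 ?normr0 -?z0 ?mulr0.
have D (t : R) : is_derive t 1 (fun t => pot N eps (t, z.2)) (partial_t (pot N eps) (t, z.2)).
  by apply smooth2_is_derive_t.
have [c /andP[c0 cz] E] := is_derive_mvt D z0.
have -> : pot N eps z = partial_t (pot N eps) (c, z.2) * z.1.
  by move: E; rewrite /= (pot0 N (z := (0, z.2)))// !subr0 -surjective_pairing.
rewrite normrM [X in _ * X]ger0_norm ?(ltW z0)// ler_wpM2r ?(ltW z0)//.
rewrite partial_t_pot//=; last exact: lt_trans zN.
by rewrite normrN; exact: convol_kern2_le.
Qed.
(** Collects the errors of the estimates below: eps for the layer near t = 0, then the local L^1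
    errors of mollification of e and of d. *)
Let err Q eps : R := eps + \int[leb2]_p (\1_(square Q) p * `|convol e (K eps) p - e p|) +
  \int[leb2]_p (\1_(square Q) p * `|convol d (K eps) p - d p|).

Let tame_err g Q eps : bmeas g -> 0 < eps ->
  tame leb2 (fun p => \1_(square Q) p * `|convol g (K eps) p - g p|).
Proof.
move=> bg eps0; have [C C0 gC] := bmeas_gt0 bg; have [mg _] := bg.
apply: tameM; first by apply: tame_indic; [exact: measurable_square|exact: leb2_square_lty].
split; last first.
  exists (C + C) => p; rewrite normr_id (le_trans (ler_normB _ _))// lerD//.
  exact: convol_kern2_le.
apply: measurableT_comp => //; apply: measurable_funB => //.
apply: continuous2_measurable.
exact: (convol_continuous bg (smooth2_kern2 sth eps) (kern2_supp_square th0 th1 eps0)).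
Qed.

Let err_ge g Q eps : bmeas g -> 0 < eps ->
  0 <= \int[leb2]_p (\1_(square Q) p * `|convol g (K eps) p - g p|).
Proof. by move=> bg eps0; apply: Rintegral_ge0 => p _; rewrite mulr_ge0// indicE. Qed.

Let indic_ge0 (N : R) (p : R * R) : 0 <= \1_(square N) p :> R. Proof. by rewrite indicE. Qed.

(* Tests the doubled inequality with D^2 times a cutoff, D := pot: as |d| e = F d, the terms
   |d| D_t + F D_x = - |d| e_eps + F d_eps vanish up to the mollification error. *)
Lemma pot_weighted M N Q : 0 <= M -> M + 2 <= N -> M + 2 + Lam * M <= Q ->
  exists2 A, 0 <= A & forall eps, 0 < eps -> eps <= 1 ->
    \int[leb2]_p (\1_(square M) p * pot N eps p ^+ 2 * `|d p|) <= A * err Q eps.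
Proof.
move=> M0 MN MQ.
have [Ce Ce0 eC] := bmeas_gt0 be; have [Cd Cd0 dC] := bmeas_gt0 bd.
have [B B0 HB] := ddelay_le sth th0 th1.
have LM0 : 0 <= Lam * M by rewrite mulr_ge0.
(* With this S the cone cutoff equals 1 on the part of [square M] at nonnegative times. B1 collects
   the contributions of the layer up to time 2 * eps, where D ^ 2 <= 4 * Ce ^ 2 * eps ^ 2, and B2
   those of the mollification errors. *)
pose S := M + 1 + Lam * M.
pose B1 := 4 * Ce ^+ 2 * Cd * (B * (M + 1) + 1).
pose B2 := 2 * Ce * (M + 1) ^+ 2 * Cd * (1 + Lam).
have M10 : 0 <= M + 1 by rewrite addr_ge0.
have M1N : M + 1 <= N by lra.
have MM1 : M < M + 1 by rewrite ltrDl.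
have MQ' : M <= Q by lra.
have S1 x y : x <= Lam * M -> y <= M -> 1 <= S - x - y by rewrite /S; lra.
have B10 : 0 <= B1 by rewrite !mulr_ge0 ?exprn_ge0 ?addr_ge0 ?mulr_ge0// ?ltW.
have B20 : 0 <= B2 by rewrite !mulr_ge0 ?exprn_ge0 ?addr_ge0// ?ltW.
exists (B1 * fine (leb2 (square Q : set (R * R))) + B2); first by rewrite addr_ge0// mulr_ge0// fine_ge0.
move=> eps eps0 eps1; have epsN : eps <= N + 1 by lra.
have [sD _ _] := pot_smooth2 eps0 epsN.
pose D := pot N eps; pose al t := delay th eps t * ramp th (M + 1) t; pose c := cone th S Lam.
have sal : smooth1 al by exact: (smooth1M (smooth1_delay sth eps) (smooth1_ramp sth (M + 1))).
have sal2 : smooth2 (fun p : R * R => al p.1) by move=> k; exact: Ck2_fst.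
have sc : smooth2 c by exact: smooth2_cone.
pose psi := (D \* D) \* ((fun p : R * R => al p.1) \* c).
have sDD := smooth2M sD sD; have sac := smooth2M sal2 sc.
have spsi : smooth2 psi := smooth2M sDD sac.
have del01 := delay01 sth th0 th1 dth_ge0 eps.
have ramp0 := ramp_ge0 sth th0 dth_ge0 (M + 1).
have c01 p : 0 <= c p <= 1 by exact: cone01.
have al0 t : 0 <= al t by rewrite mulr_ge0//; have /andP[] := del01 t.
have lpsi : late eps psi.
  by move=> p pe; rewrite /psi /= /al delay0// !(mul0r, mulr0).
have in_Q p : 0 <= p.1 -> ramp th (M + 1) p.1 * c p != 0 -> square Q p.
  move=> p0; rewrite mulf_eq0 negb_or => /andP[h1 h2]; apply/squareP.
  have h1' : p.1 < M + 1 by rewrite ltNge; apply: contraNN h1 => h; rewrite ramp_late.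
  have h2' : `|p.2| < S - Lam * p.1.
    by rewrite ltNge; apply: contraNN h2 => h; apply/eqP; exact: cone0.
  have Lp : 0 <= Lam * p.1 by rewrite mulr_ge0.
  rewrite ger0_norm//; move: h2' MQ; rewrite /S; lra.
have npsi : supp_square Q psi.
  move=> p pQ; rewrite /psi /= /al; have [p0|p0] := ltP p.1 0.
    by rewrite /D pot0 ?ltW// !mul0r.
  have [h|/in_Q h] := eqVneq (ramp th (M + 1) p.1 * c p) 0; last by exfalso; apply/pQ/h.
  by rewrite -[delay _ _ _ * _ * _]mulrA h !mulr0.
have psi0 p : 0 <= psi p.
  by rewrite /psi /= mulr_ge0// -?expr2 ?sqr_ge0// mulr_ge0//; have /andP[] := c01 p.
have [npt npx] := supp_square_partial npsi.
have Tpsi : tame leb2 (fun p => `|d p| * partial_t psi p + F p * partial_x psi p).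
  apply: tameD; apply: tameMr => //; last 2 first.
  - exact: (smooth2_tame (smooth2_partial_t spsi) npt).
  - exact: (smooth2_tame (smooth2_partial_x spsi) npx).
  exact: bmeas_norm.
have TJ : tame leb2 (fun p => \1_(square M) p * pot N eps p ^+ 2 * `|d p|).
  apply: tameM; last exact: bmeas_norm.
  have -> : (fun p => \1_(square M) p * pot N eps p ^+ 2) = (fun p => \1_(square M) p * (D \* D) p).
    by apply/funext => p; rewrite expr2.
  exact: (continuous_square_tame M (smooth2_continuous sDD)).
have TQ : tame leb2 (\1_(square Q) : R * R -> R).
  by apply: tame_indic; [exact: measurable_square|exact: leb2_square_lty].
have Te := tame_err Q be eps0; have Td := tame_err Q bd eps0.
have T1 := tameB (tameZ (B1 * eps) TQ) TJ.
have T2 := tameZ B2 (tameD Te Td).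
have key p : `|d p| * partial_t psi p + F p * partial_x psi p <=
    (B1 * eps * \1_(square Q) p - \1_(square M) p * D p ^+ 2 * `|d p|) +
    B2 * (\1_(square Q) p * `|convol e (K eps) p - e p| + \1_(square Q) p * `|convol d (K eps) p - d p|).
  have D4 : 0 <= p.1 -> p.1 <= 2 * eps -> p.1 < M + 1 -> D p ^+ 2 <= 4 * Ce ^+ 2 * eps ^+ 2.
    move=> p0 p2 pM; have H : `|D p| <= Ce * p.1 by apply: pot_le => //; exact: lt_le_trans M1N.
    have H2 : `|D p| <= Ce * (2 * eps) by rewrite (le_trans H)// ler_wpM2l// ltW.
    rewrite -real_normK ?num_real// expr2 (le_trans (ler_pM _ _ H2 H2))//.
    by rewrite [leLHS](_ : _ = 4 * Ce ^+ 2 * eps ^+ 2)//; ring.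
  have iD : 0 <= D p ^+ 2 by exact: sqr_ge0.
  have [A [A' [A0 A'0 ct cx]]] := cone_partials sth th0 dth_ge0 S Lam p.
  have /andP[cp0 cp1] := c01 p; have /andP[de0 de1] := del01 p.1.
  have dal : partial_t (fun p : R * R => al p.1) p =
      derive1 (delay th eps) p.1 * ramp th (M + 1) p.1 + delay th eps p.1 * derive1 (ramp th (M + 1)) p.1.
    have [_ ->] := derive_tE (fun p : R * R => al p.1) p.
    have D1 := is_derive_delay sth eps p.1; have D2 := is_derive_ramp sth (M + 1) p.1.
    have [_ D3] := is_deriveM D1 D2.
    rewrite derive1E [LHS]D3 !derive1E; have [_ ->] := D1; have [_ ->] := D2.
    by rewrite /GRing.scale /= !derive1E; ring.
  have dalx : partial_x (fun p : R * R => al p.1) p = 0.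
    have [_ Ex] := derive_xE (fun p : R * R => al p.1) p; rewrite Ex.
    by rewrite (_ : (fun x => _) = cst (al p.1)) ?derive1_cst.
  (* In this order: the derivatives of D, which leave a mollification error; those of the cone, of
     favourable sign; that of the delay, where D ^ 2 of order eps ^ 2 meets a slope of order 1 /
     eps; and that of the ramp, which produces the integral to be bounded. [H1] to [H4] treat them
     one by one. *)
  have -> : `|d p| * partial_t psi p + F p * partial_x psi p =
      2 * D p * (al p.1 * c p) * (`|d p| * partial_t D p + F p * partial_x D p) +
      D p ^+ 2 * al p.1 * (- Lam * (A + A') * `|d p| + F p * (A' - A)) +
      D p ^+ 2 * `|d p| * c p * (derive1 (delay th eps) p.1 * ramp th (M + 1) p.1) +
      D p ^+ 2 * `|d p| * c p * (delay th eps p.1 * derive1 (ramp th (M + 1)) p.1).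
    rewrite (partial_tM p sDD sac) (partial_xM p sDD sac) (partial_tM p sD sD) (partial_xM p sD sD).
    rewrite (partial_tM p sal2 sc) (partial_xM p sal2 sc) dal dalx ct cx /=; ring.
  have H1 : 2 * D p * (al p.1 * c p) * (`|d p| * partial_t D p + F p * partial_x D p) <=
      B2 * (\1_(square Q) p * `|convol e (K eps) p - e p| + \1_(square Q) p * `|convol d (K eps) p - d p|).
    have nn : 0 <= B2 * (\1_(square Q) p * `|convol e (K eps) p - e p| + \1_(square Q) p * `|convol d (K eps) p - d p|).
      by rewrite mulr_ge0// addr_ge0// mulr_ge0.
    have [z|nz] := eqVneq (al p.1 * c p) 0; first by rewrite z mulr0 mul0r.
    have [p0|p0] := ltP p.1 0; first by rewrite /al delay0 ?mul0r ?mulr0 ?mul0r// (le_trans (ltW p0)) ?ltW.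
    have rc : ramp th (M + 1) p.1 * c p != 0.
      by move: nz; rewrite /al -mulrA mulf_eq0 negb_or => /andP[].
    have pM : p.1 < M + 1.
      by rewrite ltNge; apply: contraNN rc => h; rewrite ramp_late ?mul0r.
    have pN : p.1 < N := lt_le_trans pM M1N.
    rewrite indicE (mem_set (in_Q _ p0 rc)) !mul1r partial_t_pot// partial_x_pot//.
    have -> : `|d p| * - convol e (K eps) p + F p * convol d (K eps) p =
      F p * (convol d (K eps) p - d p) - `|d p| * (convol e (K eps) p - e p).
      by rewrite !mulrBr deF; ring.
    have DC : `|D p| <= Ce * (M + 1).
      by rewrite (le_trans (pot_le eC eps0 epsN p0 pN))// ler_wpM2l// ltW.
    have aC : `|al p.1 * c p| <= M + 1.
      have a1 : al p.1 <= M + 1.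
        rewrite /al -[leRHS]mul1r; apply: ler_pM => //.
        exact: (ramp_le sth th0 th1 dth_ge0).
      by have := ler_pM (al0 p.1) cp0 a1 cp1; rewrite mulr1 ger0_norm//; exact: mulr_ge0 (al0 _) cp0.
    have FC : `|F p| <= Lam * Cd by rewrite (le_trans (FLam p))// ler_wpM2l.
    have X1 : `|F p * (convol d (K eps) p - d p) - `|d p| * (convol e (K eps) p - e p)| <=
       Cd * (1 + Lam) * (`|convol e (K eps) p - e p| + `|convol d (K eps) p - d p|).
      rewrite (le_trans (ler_normB _ _))// !normrM normr_id.
      have Y1 : `|F p| * `|convol d (K eps) p - d p| <= Lam * Cd * `|convol d (K eps) p - d p| by rewrite ler_wpM2r.
      have Y2 : `|d p| * `|convol e (K eps) p - e p| <= Cd * `|convol e (K eps) p - e p| by rewrite ler_wpM2r.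
      apply: (le_trans (lerD Y1 Y2)); rewrite -subr_ge0.
      rewrite [leRHS](_ : _ = Cd * `|convol d (K eps) p - d p| + Lam * Cd * `|convol e (K eps) p - e p|); last by ring.
      by rewrite addr_ge0// !mulr_ge0// ltW.
    rewrite (le_trans (ler_norm _))// [leLHS]normrM 2!normrM [`|2|]ger0_norm//.
    have X2 := ler_pM (normr_ge0 _) (normr_ge0 _) DC aC.
    have X3 : 2 * `|D p| * `|al p.1 * c p| <= 2 * (Ce * (M + 1) * (M + 1)).
      by rewrite -mulrA ler_wpM2l.
    have Z1 : 0 <= 2 * `|D p| * `|al p.1 * c p| by rewrite !mulr_ge0.
    apply: (le_trans (ler_pM Z1 (normr_ge0 _) X3 X1)).
    rewrite /B2 [leLHS](_ : _ = 2 * Ce * (M + 1) ^+ 2 * Cd * (1 + Lam) * (`|convol e (K eps) p - e p| + `|convol d (K eps) p - d p|))//.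
    ring.
  have H2 : D p ^+ 2 * al p.1 * (- Lam * (A + A') * `|d p| + F p * (A' - A)) <= 0.
    apply: mulr_ge0_le0; first by rewrite mulr_ge0.
    have Y : F p * (A' - A) <= Lam * `|d p| * (A + A').
      rewrite (le_trans (ler_norm _))// normrM ler_pM// (le_trans (ler_normB _ _))// !ger0_norm// addrC//.
    by rewrite mulNr mulNr addrC subr_le0 (le_trans Y)// mulrAC.
  have H3 : D p ^+ 2 * `|d p| * c p * (derive1 (delay th eps) p.1 * ramp th (M + 1) p.1) <=
      4 * Ce ^+ 2 * Cd * (B * (M + 1)) * eps * \1_(square Q) p.
    have nn : 0 <= 4 * Ce ^+ 2 * Cd * (B * (M + 1)) * eps * \1_(square Q) p.
      by rewrite !mulr_ge0// ?exprn_ge0 ?ltW// indicE.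
    have [z|nz] := eqVneq (derive1 (delay th eps) p.1) 0; first by rewrite z mul0r mulr0.
    have /andP[pe p2] := ddelay_supp sth th0 th1 eps0 nz.
    have p0 : 0 <= p.1 by rewrite (le_trans _ pe)// ltW.
    have [z|rc] := eqVneq (ramp th (M + 1) p.1 * c p) 0.
      by rewrite mulrACA [c p * _]mulrC z mulr0.
    have pM : p.1 < M + 1.
      by rewrite ltNge; apply: contraNN rc => h; rewrite ramp_late ?mul0r.
    rewrite indicE (mem_set (in_Q _ p0 rc)) mulr1.
    have Y1 := D4 p0 p2 pM; have Y2 := HB eps p.1 eps0.
    have Y3 : ramp th (M + 1) p.1 <= M + 1 by exact: (ramp_le sth th0 th1 dth_ge0).
    have Y4 : D p ^+ 2 * `|d p| * c p <= 4 * Ce ^+ 2 * eps ^+ 2 * Cd * 1.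
      have Z1 := ler_pM iD (normr_ge0 _) Y1 (dC p).
      exact: (ler_pM (mulr_ge0 iD (normr_ge0 _)) cp0 Z1 cp1).
    have Y5 : derive1 (delay th eps) p.1 * ramp th (M + 1) p.1 <= B / eps * (M + 1).
      by rewrite ler_pM//; exact: (ddelay_ge0 sth).
    have Z1 : 0 <= D p ^+ 2 * `|d p| * c p by exact: mulr_ge0 (mulr_ge0 iD (normr_ge0 _)) cp0.
    have Z2 : 0 <= derive1 (delay th eps) p.1 * ramp th (M + 1) p.1.
      by rewrite mulr_ge0//; exact: (ddelay_ge0 sth).
    apply: (le_trans (ler_pM Z1 Z2 Y4 Y5)).
    rewrite [leLHS](_ : _ = 4 * Ce ^+ 2 * Cd * (B * (M + 1)) * eps)//.
    by field; rewrite gt_eqF.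
  have H4 : D p ^+ 2 * `|d p| * c p * (delay th eps p.1 * derive1 (ramp th (M + 1)) p.1) <=
      4 * Ce ^+ 2 * Cd * eps * \1_(square Q) p - \1_(square M) p * D p ^+ 2 * `|d p|.
    have nn : 0 <= 4 * Ce ^+ 2 * Cd * eps * \1_(square Q) p.
      by rewrite !mulr_ge0// ?exprn_ge0 ?ltW// indicE.
    have nn' : 0 <= 4 * Ce ^+ 2 * Cd * eps by rewrite !mulr_ge0// ?exprn_ge0 ?ltW.
    have r0 := dramp_le0 sth th0 th1 dth_ge0 (M + 1) p.1.
    have [p0|p0] := leP p.1 0.
      by rewrite /D pot0// expr0n /= !(mul0r, mulr0) subr0.
    have [pM|pM] := pselect (square M p); last first.
      rewrite [X in _ - X * _ * _]indicE memNset// !mul0r subr0 (le_trans _ nn)//.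
      exact: mulr_ge0_le0 (mulr_ge0 (mulr_ge0 iD (normr_ge0 _)) cp0) (mulr_ge0_le0 de0 r0).
    have [pM1 pM2] := (squareP _ _).1 pM; rewrite (gtr0_norm p0) in pM1.
    have LpM : Lam * p.1 <= Lam * M by rewrite ler_wpM2l.
    have c1 : c p = 1 by apply: (cone1 th1); exact: S1.
    have pQ : square Q p.
      by apply/squareP; rewrite (gtr0_norm p0); split; exact: le_trans MQ'.
    rewrite !indicE (mem_set pM) (mem_set pQ) c1 !mulr1 mul1r.
    have r1 : derive1 (ramp th (M + 1)) p.1 <= -1 by apply: (dramp_leN1 sth th1 dth_ge0); rewrite lerD2r.
    have Y : D p ^+ 2 * `|d p| * (delay th eps p.1 * derive1 (ramp th (M + 1)) p.1) <=
        - (D p ^+ 2 * `|d p| * delay th eps p.1).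
      rewrite -mulrN; apply: ler_wpM2l; first exact: mulr_ge0 iD (normr_ge0 _).
      by have := ler_wpM2l de0 r1; rewrite mulrN1.
    (* After time 2 * eps the delay is 1 and the ramp yields the full term - D ^ 2 |d|. Before that
       time the missing part is of order eps and is absorbed by the first term on the right. *)
    apply: (le_trans Y); have [pe|pe] := leP (2 * eps) p.1.
      by rewrite delay1// mulr1 lerDr.
    have Z : D p ^+ 2 * `|d p| <= 4 * Ce ^+ 2 * Cd * eps.
      have Z1 := D4 (ltW p0) (ltW pe) (le_lt_trans pM1 MM1).
      have Z2 : 4 * Ce ^+ 2 * eps ^+ 2 <= 4 * Ce ^+ 2 * eps.
        apply: ler_wpM2l; first by rewrite !mulr_ge0// ltW.
        by rewrite expr2 ger_pMr.
      rewrite [leRHS]mulrAC; exact: (ler_pM iD (normr_ge0 _) (le_trans Z1 Z2) (dC p)).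
    apply: (@le_trans _ _ 0); last by rewrite subr_ge0.
    by rewrite oppr_le0; exact: mulr_ge0 (mulr_ge0 iD (normr_ge0 _)) de0.
  have := lerD (lerD (lerD H1 H2) H3) H4; rewrite /B1; lra.
have T12 := tameD T1 T2.
have H := kru spsi eps0 lpsi npsi psi0.
have := le_trans H (tame_le_Rint Tpsi T12 key).
rewrite (tame_RintD T1 T2) (tame_RintB (tameZ (B1 * eps) TQ) TJ) (tame_RintZ _ TQ).
rewrite (tame_RintZ _ (tameD Te Td)) (tame_RintD Te Td) Rint_indic; last exact: measurable_square.
move=> H'; have ge := err_ge Q be eps0; have gd := err_ge Q bd eps0.
set V := fine _ in H' *; have V0 : 0 <= V by exact: fine_ge0.
rewrite /err; set X := \int[leb2]_p _ in H' *; set Ie := \int[leb2]_p _ in H' ge *.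
set Id := \int[leb2]_p _ in H' gd *.
have G1 : 0 <= B1 * V * (Ie + Id) := mulr_ge0 (mulr_ge0 B10 V0) (addr_ge0 ge gd).
have G2 : 0 <= B2 * eps := mulr_ge0 B20 (ltW eps0).
have := addr_ge0 (addr_ge0 H' G1) G2; rewrite -[in X in _ -> X]subr_ge0.
by congr (_ <= _); ring.
Qed.
(* (D^4)_t = - 4 D^3 e_eps and |e| <= Lam |d|, so D^4 is controlled by D^2 |d|. *)
Lemma pot_pow4 M N Q : 0 <= M -> M + 3 <= N -> M + 3 + Lam * (M + 1) <= Q ->
  exists2 A, 0 <= A & forall eps, 0 < eps -> eps <= 1 ->
    \int[leb2]_p (\1_(square M) p * pot N eps p ^+ 4) <= A * err Q eps.
Proof.
move=> M0 MN MQ.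
have M10 : 0 <= M + 1 by rewrite addr_ge0.
have LM0 : 0 <= Lam * (M + 1) by rewrite mulr_ge0.
have [A A0 HA] := pot_weighted (M := M + 1) (N := N) (Q := Q) M10 (ltac:(lra)) (ltac:(lra)).
have [Ce Ce0 eC] := bmeas_gt0 be.
have M1N : M + 1 <= N by lra.
have MM1 : M < M + 1 by rewrite ltrDl.
have M1Q : M + 1 <= Q by lra.
have S1 (x y : R) : x = 0 -> y <= M -> 1 <= M + 1 - x - y by lra.
have S2 (x y : R) : x = 0 -> M + 1 < y -> M + 1 - x <= y by lra.
have N0 : 0 <= N by lra.
have epsN' eps : eps <= 1 -> eps <= N + 1 by lra.
pose B := 4 * (M + 1) * (Ce * (M + 1)).
have CM0 : 0 <= Ce * (M + 1) := mulr_ge0 (ltW Ce0) M10.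
have B0 : 0 <= B by rewrite !mulr_ge0// ltW.
pose B1 := B * Lam; pose B2 := B * (Ce * (M + 1)) ^+ 2.
have B10 : 0 <= B1 := mulr_ge0 B0 Lam0.
have B20 : 0 <= B2 := mulr_ge0 B0 (sqr_ge0 _).
exists (B1 * A + B2); first exact: addr_ge0 (mulr_ge0 B10 A0) B20.
move=> eps eps0 eps1; have epsN := epsN' _ eps1.
have [sD _ _] := pot_smooth2 eps0 epsN; pose D := pot N eps.
(* With speed 0 the cone is a cutoff in x alone, which suffices since the equation D_t = - e_eps
   involves no flux. *)
pose al := ramp th (M + 1); pose c := cone th (M + 1) 0.
have sal : smooth1 al by exact: smooth1_ramp.
have sal2 : smooth2 (fun p : R * R => al p.1) by move=> k; exact: Ck2_fst.
have sc : smooth2 c by exact: smooth2_cone.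
have sDD := smooth2M sD sD; have sD4 := smooth2M sDD sDD; have sac := smooth2M sal2 sc.
pose psi := ((D \* D) \* (D \* D)) \* ((fun p : R * R => al p.1) \* c).
have spsi : smooth2 psi := smooth2M sD4 sac.
have npsi : supp_square (M + 1) psi.
  move=> p pQ; rewrite /psi /=; have [p0|p0] := leP p.1 0.
    by rewrite /D pot0// !mul0r.
  have [h|h] := leP (M + 1) p.1; first by rewrite /al ramp_late// !(mul0r, mulr0).
  have [h2|h2] := leP `|p.2| (M + 1); last first.
    by rewrite /c (cone0 th0) ?mulr0//; apply: S2 => //; rewrite mul0r.
  by exfalso; apply/pQ/squareP; rewrite gtr0_norm// ltW.
have [npt npx] := supp_square_partial npsi.
(* psi has bounded support, since D vanishes for t <= 0. The integral of its time derivative is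
   therefore 0; in it the slope of the ramp produces the integral of D ^ 4, which is balanced by the
   term with D_t. *)
have [It _] := Rint_partial0 spsi npsi.
have Tpt := smooth2_tame (smooth2_partial_t spsi) npt.
have TJ : tame leb2 (fun p => \1_(square (M + 1)) p * pot N eps p ^+ 2 * `|d p|).
  apply: tameM; last exact: bmeas_norm.
  have -> : (fun p => \1_(square (M + 1)) p * pot N eps p ^+ 2) = (fun p => \1_(square (M + 1)) p * (D \* D) p).
    by apply/funext => p; rewrite expr2.
  exact: (continuous_square_tame (M + 1) (smooth2_continuous sDD)).
have T4 : tame leb2 (fun p => \1_(square M) p * pot N eps p ^+ 4).
  have -> : (fun p => \1_(square M) p * pot N eps p ^+ 4) = (fun p => \1_(square M) p * ((D \* D) \* (D \* D)) p).
    by apply/funext => p; rewrite (exprM _ 2 2) !expr2.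
  exact: (continuous_square_tame M (smooth2_continuous sD4)).
have Te := tame_err Q be eps0.
have TR := tameD (tameZ B1 TJ) (tameZ B2 Te).
have key p : \1_(square M) p * D p ^+ 4 <= (-1) * partial_t psi p +
   (B1 * (\1_(square (M + 1)) p * D p ^+ 2 * `|d p|) + B2 * (\1_(square Q) p * `|convol e (K eps) p - e p|)).
  have iD : 0 <= D p ^+ 2 by exact: sqr_ge0.
  have iD4 : 0 <= D p ^+ 4 by rewrite (exprM _ 2 2) sqr_ge0.
  have [A1 [A2 [A10 A20 ct cx]]] := cone_partials sth th0 dth_ge0 (M + 1) 0 p.
  have /andP[cp0 cp1] : 0 <= c p <= 1 by exact: cone01.
  have a0 : 0 <= al p.1 by exact: (ramp_ge0 sth th0 dth_ge0).
  have dal : partial_t (fun p : R * R => al p.1) p = derive1 al p.1.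
    by have [_ ->] := derive_tE (fun p : R * R => al p.1) p.
  have da0 := dramp_le0 sth th0 th1 dth_ge0 (M + 1) p.1.
  have Ept : (-1) * partial_t psi p = D p ^+ 4 * (c p * - derive1 al p.1) - (al p.1 * c p) * (4 * D p * D p ^+ 2 * partial_t D p).
    rewrite (partial_tM p sD4 sac) (partial_tM p sDD sDD) (partial_tM p sD sD).
    by rewrite (partial_tM p sal2 sc) dal ct /=; ring.
  have H1 : \1_(square M) p * D p ^+ 4 <= D p ^+ 4 * (c p * - derive1 al p.1).
    have nn : 0 <= D p ^+ 4 * (c p * - derive1 al p.1).
      by apply: (mulr_ge0 iD4 (mulr_ge0 cp0 _)); rewrite oppr_ge0.
    have [pM|pM] := pselect (square M p); last by rewrite indicE memNset// mul0r.
    have [pM1 pM2] := (squareP _ _).1 pM.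
    have c1 : c p = 1 by apply: (cone1 th1); apply: S1 => //; rewrite mul0r.
    rewrite indicE mem_set// mul1r c1 mul1r -[leLHS]mulr1; apply: ler_wpM2l => //.
    rewrite lerNr; apply: (dramp_leN1 sth th1 dth_ge0); rewrite lerD2r.
    exact: le_trans (ler_norm _) pM1.
  have H2 : (al p.1 * c p) * (4 * D p * D p ^+ 2 * partial_t D p) <=
     B1 * (\1_(square (M + 1)) p * D p ^+ 2 * `|d p|) + B2 * (\1_(square Q) p * `|convol e (K eps) p - e p|).
    have nn : 0 <= B1 * (\1_(square (M + 1)) p * D p ^+ 2 * `|d p|) + B2 * (\1_(square Q) p * `|convol e (K eps) p - e p|).
      apply: addr_ge0; first exact: mulr_ge0 B10 (mulr_ge0 (mulr_ge0 (indic_ge0 _ _) iD) (normr_ge0 _)).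
      exact: mulr_ge0 B20 (mulr_ge0 (indic_ge0 _ _) (normr_ge0 _)).
    have [p0|p0] := leP p.1 0.
      have D0 : D p = 0 by exact: pot0.
      by rewrite [leLHS](_ : _ = 0)//; rewrite D0; ring.
    have [h|h] := leP (M + 1) p.1; first by rewrite /al ramp_late// !mul0r.
    have [h2|h2] := leP `|p.2| (M + 1); last first.
      by rewrite /c (cone0 th0) ?mulr0 ?mul0r//; apply: S2 => //; rewrite mul0r.
    have pM : square (M + 1) p by apply/squareP; rewrite gtr0_norm// ltW.
    have pQ : square Q p.
      by apply/squareP; rewrite (gtr0_norm p0); split; apply: le_trans M1Q => //; exact: ltW.
    have pN : p.1 < N := lt_le_trans h M1N.
    rewrite !indicE (mem_set pM) (mem_set pQ) !mul1r partial_t_pot//.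
    have DC : `|D p| <= Ce * (M + 1).
      by rewrite (le_trans (pot_le eC eps0 epsN (ltW p0) pN))// ler_wpM2l// ltW.
    have D2C : D p ^+ 2 <= (Ce * (M + 1)) ^+ 2.
      by rewrite -real_normK ?num_real// !expr2; exact: ler_pM.
    have aC : al p.1 * c p <= M + 1.
      have a1 : al p.1 <= M + 1 by apply: (ramp_le sth th0 th1 dth_ge0) => //; exact: ltW.
      by have := ler_pM a0 cp0 a1 cp1; rewrite mulr1.
    set ce := convol e (K eps) p.
    have X1 : `|4 * D p * (D p ^+ 2 * - ce)| <= 4 * (Ce * (M + 1)) * (Lam * (D p ^+ 2 * `|d p|) + (Ce * (M + 1)) ^+ 2 * `|ce - e p|).
      rewrite [leLHS]normrM; apply: ler_pM => //.
        by rewrite normrM [`|4|]ger0_norm// ler_wpM2l.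
      rewrite normrM normrN (ger0_norm iD).
      have Y : `|ce| <= Lam * `|d p| + `|ce - e p|.
        rewrite -{1}(subrK (e p) ce) addrC (le_trans (ler_normD _ _))// lerD2r//.
      have Y2 := ler_wpM2l iD Y; apply: (le_trans Y2); rewrite mulrDr; apply: lerD.
        by rewrite mulrCA.
      exact: ler_wpM2r.
    have X2 : 0 <= al p.1 * c p := mulr_ge0 a0 cp0.
    rewrite (le_trans (ler_norm _))// normrM (ger0_norm X2) -[4 * D p * _ * _]mulrA.
    apply: (le_trans (ler_pM X2 (normr_ge0 _) aC X1)).
    rewrite /B1 /B2 /B [leLHS](_ : _ = 4 * (M + 1) * (Ce * (M + 1)) * Lam * (D p ^+ 2 * `|d p|) +
      4 * (M + 1) * (Ce * (M + 1)) * (Ce * (M + 1)) ^+ 2 * `|ce - e p|)//.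
    ring.
  rewrite Ept -addrA; apply: (le_trans H1); rewrite lerDl addrC subr_ge0//.
have := tame_le_Rint T4 (tameD (tameZ (-1) Tpt) TR) key.
rewrite (tame_RintD (tameZ (-1) Tpt) TR) (tame_RintZ _ Tpt) It mulr0 add0r.
rewrite (tame_RintD (tameZ B1 TJ) (tameZ B2 Te)) (tame_RintZ _ TJ) (tame_RintZ _ Te) => H.
apply: (le_trans H); rewrite mulrDl -[B1 * A * _]mulrA; apply: lerD.
  by apply: ler_wpM2l => //; exact: HA.
apply: ler_wpM2l => //; rewrite /err -addrA addrCA lerDl.
exact: addr_ge0 (ltW eps0) (err_ge Q bd eps0).
Qed.

Let err_cvg Q : err Q n.+1%:R^-1 @[n --> \oo] --> 0.
Proof.
pose en (n : nat) : R := n.+1%:R^-1.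
have en0 n : 0 < en n by rewrite invr_gt0.
have ecv : en n @[n --> \oo] --> 0 by exact: cvg_harmonic.
rewrite -[X in _ --> X](addr0 0) -[X in _ --> X + _](addr0 0).
apply: cvgD; last exact: (@moll_cvg0 R th sth th0 th1 dth_ge0 d Q en bd en0 ecv).
apply: cvgD; first exact: ecv.
exact: (@moll_cvg0 R th sth th0 th1 dth_ge0 e Q en be en0 ecv).
Qed.

(** Up to a mollification error d is the x-derivative of D, which is moved onto chi. The inequality
    |D| <= del + del ^ (-3) D ^ 4 then bounds the integral of |D| by that of D ^ 4; first eps and
    then del tends to 0. *)
Lemma pot_test M chi : 0 <= M -> smooth2 chi -> supp_square M chi ->
  \int[leb2]_p (d p * chi p) = 0.
Proof.
move=> M0 schi nchi; have [nct ncx] := supp_square_partial nchi.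
pose N := M + 3; pose Q := M + 3 + Lam * (M + 1).
have MN : M < N by rewrite ltrDl.
have MQ : M <= Q by rewrite /Q -addrA lerDl addr_ge0// mulr_ge0// addr_ge0.
have N0 : 0 <= N by rewrite addr_ge0.
have [A A0 HA] := pot_pow4 (N := N) (Q := Q) M0 (lexx _) (lexx _).
have [B B0 HB] := smooth2_bounded schi nchi.
have [B' B'0 HB'] := smooth2_bounded (smooth2_partial_x schi) ncx.
have V0 : 0 <= fine (leb2 (square M : set (R * R))) by exact: fine_ge0.
set V := fine _ in V0; set X := \int[leb2]_p _.
have key del eps : 0 < del -> 0 < eps -> eps <= 1 ->
    `|X| <= (B + B' * (del ^- 3 * A)) * err Q eps + B' * (del * V).
  move=> del0 eps0 eps1; have epsN : eps <= N + 1 by rewrite (le_trans eps1)// lerDr.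
  have [sD _ _] := pot_smooth2 eps0 epsN; pose D := pot N eps.
  have sDc := smooth2M sD schi.
  have nDc : supp_square M (D \* chi) by move=> p pM /=; rewrite nchi// mulr0.
  have [_ Ix] := Rint_partial0 sDc nDc.
  have Ex p : partial_x (D \* chi) p = D p * partial_x chi p + convol d (K eps) p * chi p.
    rewrite (partial_xM p sD schi); congr (_ + _).
    have [->|c0] := eqVneq (chi p) 0; first by rewrite mul0r mulr0.
    rewrite mulrC partial_x_pot//; have [h _] := (supp_squareP _ _).1 nchi p c0.
    exact: le_lt_trans (le_trans (ler_norm _) h) MN.
  have Tc := smooth2_tame schi nchi; have Tcx := smooth2_tame (smooth2_partial_x schi) ncx.
  have TM : tame leb2 (\1_(square M) : R * R -> R).
    by apply: tame_indic; [exact: measurable_square|exact: leb2_square_lty].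
  have TDx : tame leb2 (fun p => D p * partial_x chi p).
    have nDx : supp_square M (D \* partial_x chi) by move=> p pM /=; rewrite ncx// mulr0.
    exact: (smooth2_tame (smooth2M sD (smooth2_partial_x schi)) nDx).
  have Td := tame_err Q bd eps0.
  have bK : bmeas (convol d (K eps)).
    have [C C0 dC] := bmeas_gt0 bd; split; last by exists C => p; exact: convol_kern2_le.
    apply: continuous2_measurable.
    exact: (convol_continuous bd (smooth2_kern2 sth eps) (kern2_supp_square th0 th1 eps0)).
  have TK : tame leb2 (fun p => convol d (K eps) p * chi p) by apply: tameMr.
  have TX : tame leb2 (fun p => d p * chi p) by apply: tameMr.
  have EX : X = - \int[leb2]_p ((convol d (K eps) p * chi p - d p * chi p) + D p * partial_x chi p).
    have <- : \int[leb2]_p (partial_x (D \* chi) p - d p * chi p) =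
       \int[leb2]_p ((convol d (K eps) p * chi p - d p * chi p) + D p * partial_x chi p).
      by apply: eq_Rintegral => p _; rewrite Ex; ring.
    have TP := smooth2_tame (smooth2_partial_x sDc) (supp_square_partial nDc).2.
    by rewrite (tame_RintB TP TX) Ix sub0r opprK.
  have T1 := tameD (tameB TK TX) TDx.
  have T4 : tame leb2 (fun p => \1_(square M) p * pot N eps p ^+ 4).
    have -> : (fun p => \1_(square M) p * pot N eps p ^+ 4) = (fun p => \1_(square M) p * ((D \* D) \* (D \* D)) p).
      by apply/funext => p; rewrite (exprM _ 2 2) !expr2.
    exact: (continuous_square_tame M (smooth2_continuous (smooth2M (smooth2M sD sD) (smooth2M sD sD)))).
  have T2 := tameD (tameZ B Td) (tameD (tameZ (B' * del ^- 3) T4) (tameZ (B' * del) TM)).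
  rewrite EX normrN (le_trans (tame_le_norm_Rint T1))//.
  have pt p : `|(convol d (K eps) p * chi p - d p * chi p) + D p * partial_x chi p| <=
    B * (\1_(square Q) p * `|convol d (K eps) p - d p|) +
    (B' * del ^- 3 * (\1_(square M) p * pot N eps p ^+ 4) + B' * del * \1_(square M) p).
    have [pM|pM] := pselect (square M p); last first.
      rewrite nchi// ncx// !mulr0 subrr add0r normr0 !indicE (memNset pM) !(mul0r, mulr0) !addr0.
      exact: (mulr_ge0 (ltW B0) (mulr_ge0 (ler0n _ _) (normr_ge0 _))).
    have pQ : square Q p.
      by have [h1 h2] := (squareP _ _).1 pM; apply/squareP; split; exact: le_trans MQ.
    rewrite !indicE (mem_set pM) (mem_set pQ) !mul1r mulr1 (le_trans (ler_normD _ _))//.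
    apply: lerD; first by rewrite -mulrBl normrM mulrC ler_wpM2r.
    rewrite normrM mulrC (le_trans (ler_wpM2r (normr_ge0 _) (HB' p)))//.
    rewrite -!mulrA -mulrDr; apply: ler_wpM2l; first exact: ltW.
    have [h|h] := leP `|D p| del.
      apply: (le_trans h); rewrite lerDr; apply: mulr_ge0; last by rewrite (exprM _ 2 2) sqr_ge0.
      by rewrite invr_ge0 exprn_ge0// ltW.
    rewrite (_ : pot N eps p ^+ 4 = `|D p| ^+ 4); last by rewrite (exprM `|_| 2 2) real_normK ?num_real// -exprM.
    apply: (@le_trans _ _ (del ^- 3 * `|D p| ^+ 4)); last by rewrite lerDl ltW.
    rewrite [`|D p| ^+ 4]exprS mulrCA ler_peMr// mulrC ler_pdivlMr ?exprn_gt0// mul1r.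
    by apply: lerXn2r; rewrite ?nnegrE; [exact: ltW| |exact: ltW].
  apply: (le_trans (tame_le_Rint (tame_norm T1) T2 pt)).
  rewrite (tame_RintD (tameZ B Td) (tameD (tameZ (B' * del ^- 3) T4) (tameZ (B' * del) TM))).
  rewrite (tame_RintD (tameZ (B' * del ^- 3) T4) (tameZ (B' * del) TM)).
  rewrite (tame_RintZ _ Td) (tame_RintZ _ T4) (tame_RintZ _ TM) Rint_indic; last exact: measurable_square.
  rewrite -/V addrA -[B' * del * V]mulrA lerD2r mulrDl; apply: lerD.
    apply: ler_wpM2l; first exact: ltW.
    by rewrite /err lerDr addr_ge0// ?(ltW eps0)// err_ge.
  rewrite -!mulrA; apply: ler_wpM2l; first exact: ltW.
  apply: ler_wpM2l; last exact: HA.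
  by rewrite invr_ge0 exprn_ge0// ltW.
have key2 del : 0 < del -> `|X| <= B' * (del * V).
  move=> del0; have cv : (B + B' * (del ^- 3 * A)) * err Q n.+1%:R^-1 + B' * (del * V) @[n --> \oo] -->
      (B + B' * (del ^- 3 * A)) * 0 + B' * (del * V).
    apply: cvgD; last exact: cvg_cst.
    by apply: cvgM; [exact: cvg_cst|exact: err_cvg].
  rewrite -[leRHS]add0r -[X in X + _ ](mulr0 (B + B' * (del ^- 3 * A))).
  apply: (cvgr_to_ge cv); apply: nearW => n; apply: key => //.
  by rewrite invf_le1 ?ltr0n// ler1n.
apply/normr0_eq0/le_anti; rewrite normr_ge0 andbT leNgt; apply/negP => X0.
have BV : 0 <= B' * V := mulr_ge0 (ltW B'0) V0.
have := key2 (`|X| / (2 * (B' * V + 1))).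
have BV1 : 0 < B' * V + 1 by rewrite ltr_wpDl.
rewrite divr_gt0 ?mulr_gt0// => /(_ isT); apply/negP; rewrite -ltNge.
rewrite [ltLHS](_ : _ = `|X| * (B' * V / (2 * (B' * V + 1)))); last by ring.
rewrite -[ltRHS]mulr1 ltr_pM2l// ltr_pdivrMr ?mulr_gt0// mul1r mulrDr mulr1 mulr2n mulrDl mul1r.
by rewrite -addrA ltrDl ltr_wpDl.
Qed.

(** Taking the mollifier itself as test function in [pot_test], all mollifications of d vanish; they
    converge to d in L^1 on every square. *)
Lemma doubled_difference_eq0 : {ae leb2, forall p, d p = 0}.
Proof.
have c0 eps z : 0 < eps -> convol d (K eps) z = 0.
  move=> eps0; have NK := kern2_supp_square th0 th1 eps0.
  apply: (@pot_test (eps + (`|z.1| + `|z.2|)) (fun q => K eps (z - q))).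
  - by rewrite !addr_ge0// ltW.
  - exact: smooth2_refl (smooth2_kern2 sth eps).
  - by apply: (supp_square_refl NK); rewrite ?lerDl ?lerDr.
have I0 N : \int[leb2]_p (\1_(square N) p * `|d p|) = 0.
  pose en (n : nat) : R := n.+1%:R^-1.
  have en0 n : 0 < en n by rewrite invr_gt0.
  have ecv : en n @[n --> \oo] --> 0 by exact: cvg_harmonic.
  have := @moll_cvg0 R th sth th0 th1 dth_ge0 d N en bd en0 ecv.
  rewrite (_ : (fun n => _) = (fun=> \int[leb2]_p (\1_(square N) p * `|d p|))); last first.
    apply/funext => n; apply: eq_Rintegral => p _.
    by rewrite -/(K (en n)) c0// sub0r normrN.
  by move=> /cvg_lim <- //; rewrite lim_cst.
have A0 (N : nat) : {ae leb2, forall p, square (N%:R : R) p -> d p = 0}.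
  have T : tame leb2 (fun p => \1_(square N%:R) p * `|d p|).
    apply: tameM; last exact: bmeas_norm.
    by apply: tame_indic; [exact: measurable_square|exact: leb2_square_lty].
  have E : (\int[leb2]_(p in setT) `|(EFin \o (fun p => \1_(square (N%:R : R)) p * d p)%R) p| = 0)%E.
    rewrite (_ : (fun p => _) = (fun p => (\1_(square (N%:R : R)) p * `|d p|)%R%:E)).
      by rewrite tame_EFin_Rint// I0.
    by apply/funext => p /=; rewrite normrM ger0_norm.
  have /(ae_eq_integral_abs leb2 measurableT)[/(_ E) + _] : measurable_fun setT (EFin \o (fun p => \1_(square (N%:R : R)) p * d p)%R).
    apply/measurable_EFinP; apply: measurable_funM; last by have [] := bd.
    by apply: measurable_indic; exact: measurable_square.
  move=> [A [mA A0 sA]]; exists A; split => // p /= np; apply: sA => /= h; apply: np => pN.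
  by move: (h I); rewrite indicE mem_set// mul1r => -[].
have : {ae leb2, forall p, forall N : nat, square (N%:R : R) p -> d p = 0}.
  exact: ae_foralln.
move=> [A [mA A00 sA]]; exists A; split => // p /= np; apply: sA => /= H; apply: np.
apply: (H (Num.bound (`|p.1| + `|p.2|))); apply/squareP.
have := archi_boundP (addr_ge0 (normr_ge0 p.1) (normr_ge0 p.2)) => /ltW h.
by split; apply: le_trans h; rewrite ?lerDl ?lerDr.
Qed.

End Potential.

(** * Uniqueness of entropy solutions *)

Section BoundedVersion.
Context {R : realType}.
Notation H := (@halfplane R).

Lemma Linfty_ae_bound d (T : measurableType d) (mu : {measure set T -> \bar R}) (D : set T) (f : T -> R) :
  Linfty mu D f -> exists2 C, 0 <= C & {ae mu, forall x, D x -> `|f x| <= C}.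
Proof.
move=> [_]; rewrite /finite_norm unlock; case: ifPn => [m0|]; last first.
  (* When the whole space is null the norm is 0 by convention, and every bound holds almost
     everywhere. *)
  rewrite -leNgt => m0 _; exists 0 => //; exists setT; split => //.
  by apply/eqP; rewrite eq_le m0 measure_ge0.
set E := ess_sup mu _ => Eoo.
have [C C0 EC] : exists2 C : R, 0 <= C & (E <= C%:E)%E.
  case: (E) Eoo => [r _|//|_]; last by exists 0 => //; rewrite leNye.
  by exists `|r| => //; rewrite lee_fin ler_norm.
exists C => //; move/ess_supP : EC => [A [mA A0 sA]]; exists A; split => // x /= nx; apply: sA => /= h.
by apply: nx => Dx; move: h; rewrite patchE mem_set// lee_fin.
Qed.

Lemma measurable_halfplane : measurable H.
Proof. by apply: measurableX => //; exact: measurable_itv. Qed.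

(** The extension by 0 is clamped to the essential bound. Pointwise bounds are what [bmeas] and the
    Lipschitz constant of phi require, and vanishing at negative times lets integrals run over the
    whole plane. *)
Lemma Linfty_bounded_version (w : R * R -> R) : Linfty leb2 H w -> exists (w' : R * R -> R) (C : R),
  [/\ measurable_fun setT w', forall p, `|w' p| <= C, forall p : R * R, p.1 < 0 -> w' p = 0 &
      {ae leb2, forall p, H p -> w' p = w p}].
Proof.
move=> Lw; have [C C0 [A [mA A0 sA]]] := Linfty_ae_bound Lw; have [mw _] := Lw.
exists (fun p => Num.max (- C) (Num.min C ((w \_ H) p))), C; split.
- apply: measurable_maxr; first exact: measurable_cst.
  apply: measurable_minr; first exact: measurable_cst.
  exact: (measurable_restrictT w measurable_halfplane).1 mw.
- move=> p; rewrite ler_norml le_max lexx /= ge_max ge_min lexx /= andbT.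
  by rewrite (le_trans _ C0)// oppr_le0.
- move=> p p0; rewrite patchE memNset; last by move=> [/=]; rewrite in_itv/= andbT leNgt p0.
  by rewrite min_r// max_r// oppr_le0.
- exists A; split => // p /= np; apply: sA => /= h; apply: np => Hp.
  rewrite patchE mem_set//; move: (h Hp); rewrite ler_norml => /andP[h1 h2].
  by rewrite min_r// max_r.
Qed.

Lemma Rint_halfplane (w w' : R * R -> R) (G F : R -> R) (a b : R * R -> R) :
  measurable_fun H w -> measurable_fun setT w' -> {ae leb2, forall p, H p -> w' p = w p} ->
  continuous G -> continuous F -> measurable_fun setT a -> measurable_fun setT b ->
  \int[leb2]_(p in H) (G (w p) * a p + F (w p) * b p) =
  \int[leb2]_p (\1_H p * (G (w' p) * a p + F (w' p) * b p)).
Proof.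
move=> mw mw' [A [mA A0 sA]] cG cF ma mb.
have mH := measurable_halfplane.
have mfun D v : measurable D -> measurable_fun D v -> measurable_fun D (fun p => G (v p) * a p + F (v p) * b p).
  move=> mD mv; have [mG mF] := (continuous_measurable_fun cG, continuous_measurable_fun cF).
  apply: measurable_funD; apply: measurable_funM.
  - exact: measurableT_comp.
  - exact: measurable_funS ma.
  - exact: measurableT_comp.
  - exact: measurable_funS mb.
transitivity (\int[leb2]_(p in H) (G (w' p) * a p + F (w' p) * b p)).
  congr fine; apply: ae_eq_integral => //.
  - by apply/measurable_EFinP; exact: mfun.
  - by apply/measurable_EFinP; apply: mfun => //; exact: measurable_funS mw'.
  - exists A; split => // p /= np; apply: sA => /= h; apply: np => Hp.
    by rewrite h.
rewrite Rintegral_mkcond; apply: eq_Rintegral => p _; rewrite patchE indicE.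
by case: ifPn => _; rewrite ?mul1r ?mul0r.
Qed.

Lemma late_partial (psi : R * R -> R) a : late a psi ->
  forall p : R * R, p.1 < a -> partial_t psi p = 0 /\ partial_x psi p = 0.
Proof.
move=> la p pa.
have n : \forall q \near p, psi q = cst 0 q.
  have : \forall q \near p, q.1 < a.
    apply: (@open_comp _ _ fst `]-oo, a[); last by rewrite /= in_itv.
      by move=> ? _; exact: cvg_fst.
    exact: interval_open.
  by apply: filterS => q qa; rewrite la ?ltW.
split.
  by rewrite /partial_t (@near_eq_derive _ _ _ _ (cst 0)) ?derive_cst//.
by rewrite /partial_x (@near_eq_derive _ _ _ _ (cst 0)) ?derive_cst//.
Qed.

Lemma late_csupp (psi : R * R -> R) a N : 0 < a -> late a psi -> supp_square N psi ->
  csupp_in (`]0, +oo[ `*` setT : set (R * R)) psi.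
Proof.
move=> a0 la Np; split; first exact: supp_square_compact Np.
have cl : closed [set p : R * R | a <= p.1].
  rewrite (_ : mkset _ = fst @^-1` [set x | a <= x])//.
  apply: closed_comp; first by move=> ? _; exact: cvg_fst.
  exact: closed_ge.
have sub : supp psi `<=` [set p : R * R | a <= p.1].
  rewrite [X in _ `<=` X](closure_id _).1//; apply: closure_subset => p /= pp.
  by rewrite leNgt; apply: contra pp => /ltW /la ->.
by move=> p /sub /= ap; split => //=; rewrite in_itv/= (lt_le_trans a0).
Qed.

End BoundedVersion.

(** * Smooth strictly convex approximations of Kruzhkov's entropies *)

Section KruzkovEntropies.
Context {R : realType}.
Variable th : R -> R.
Hypothesis sth : smooth1 th.
Hypothesis th0 : forall x, x <= 0 -> th x = 0.
Hypothesis th1 : forall x, 1 <= x -> th x = 1.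
Hypothesis dth_ge0 : forall x, 0 <= derive1 th x.
Variables (k : R).

(* The derivative of a strictly convex approximation of |x - k|. *)
Definition sgn_approx (n x : R) : R := 2 * th (n * (x - k)) - 1 + n^-1 * (x - k).

Lemma sgn_approx_smooth n : smooth1 (sgn_approx n).
Proof.
have -> : sgn_approx n = (cst 2 \* (fun x => th (n * x + - (n * k)))) \+
    (fun x => n^-1 * x + (- 1 - n^-1 * k)).
  by apply/funext => x; rewrite /sgn_approx /= mulrBr; ring.
apply: smooth1D; last exact: (smooth1_affine _ _ (@smooth1_id R)).
by apply: smooth1M; [exact: smooth1_cst|exact: smooth1_affine].
Qed.

Lemma dsgn_approx_gt0 n x : 0 < n -> 0 < derive1 (sgn_approx n) x.
Proof.
move=> n0.
have [D1 D2] := derive1_affine (smooth1_derivable sth (x := n * x + - (n * k))).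
have D3 : is_derive x 1 (fun x => th (n * x + - (n * k))) (n * derive1 th (n * x + - (n * k))).
  by apply: (DeriveDef D1); rewrite -derive1E.
have D4 : is_derive x 1 (fun x : R => n^-1 * x + (- 1 - n^-1 * k)) (n^-1).
  have [D5 D6] := derive1_affine (smooth1_derivable (@smooth1_id R) (x := n^-1 * x + (- 1 - n^-1 * k))).
  by apply: (DeriveDef D5); rewrite -derive1E [LHS]D6 derive1E derive_id mulr1.
have -> : sgn_approx n = (2 \*: (fun x => th (n * x + - (n * k)))) \+
    (fun x => n^-1 * x + (- 1 - n^-1 * k)).
  by apply/funext => y; rewrite /sgn_approx /= /GRing.scale /= mulrBr; ring.
rewrite derive1E; have [_ ->] := is_deriveD (is_deriveZ 2 D3) D4.
rewrite /GRing.scale /= ltr_wpDl ?invr_gt0//.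
by rewrite !mulr_ge0// ltW.
Qed.

Variables (phi : R -> R) (q : R -> R) (n C L : R).
Hypothesis dphi : forall x : R, is_derive x 1 phi (derive1 phi x).
Hypothesis phiL : forall x, `|x| <= C -> `|derive1 phi x| <= L.
Hypothesis n1 : 1 <= n.
Hypothesis kC : `|k| <= C.
Hypothesis dq : forall x : R, is_derive x 1 q (sgn_approx n x * derive1 phi x).
Hypothesis qk : q k = 0.

Let mvt_on (f df : R -> R) (a b B : R) : (forall x : R, is_derive x 1 f (df x)) -> a <= b ->
  (forall x, a < x < b -> `|df x| <= B) -> `|f b - f a| <= B * (b - a).
Proof.
move=> D; rewrite le_eqVlt => /predU1P[->|ab] H; first by rewrite !subrr normr0 mulr0.
have [c cab ->] := is_derive_mvt D ab.
by rewrite normrM (gtr0_norm (_ : 0 < b - a)) ?subr_gt0// ler_wpM2r ?H// subr_ge0 ltW.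
Qed.

Let n0 : 0 < n. Proof. exact: lt_le_trans n1. Qed.
Let C0 : 0 <= C. Proof. exact: le_trans kC. Qed.
Let L0 : 0 <= L. Proof. by apply: le_trans (phiL (x := k) kC). Qed.
Let v0 : 0 < n^-1. Proof. by rewrite invr_gt0. Qed.
Let coef_ge0 : 0 <= 2 + n^-1 * (2 * C).
Proof. by rewrite addr_ge0// mulr_ge0// ?mulr_ge0// ltW. Qed.
Let in_C x y z : `|x| <= C -> `|z| <= C -> x <= y -> y <= z -> `|y| <= C.
Proof. by rewrite !ler_norml; lra. Qed.
Let dist_C x y : `|x| <= C -> `|y| <= C -> x - y <= 2 * C.
Proof. by rewrite !ler_norml; lra. Qed.

Let small_arith (a b : R) : 0 <= a -> 0 <= b -> a <= 2 * C -> b <= 2 * C ->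
  L * (2 + n^-1 * (2 * C)) * n^-1 + L * (n^-1 * (2 * C)) * b <= L * (2 + 2 * C + 4 * C ^+ 2) * n^-1.
Proof.
move=> a0 b0 aC bC; have v1 : n^-1 <= 1 by rewrite invf_le1.
rewrite -subr_ge0 (_ : _ - _ = L * n^-1 * (2 * C * (1 - n^-1) + 2 * C * (2 * C - b))); last by ring.
have L0' := L0; have C0' := C0.
by rewrite mulr_ge0 ?mulr_ge0 ?(ltW v0)// addr_ge0// !mulr_ge0// subr_ge0.
Qed.

(** Both functions vanish at k, and their derivatives differ by phi' times the error on the sign.
    That error is at most 2 + 2 C / n on [k, k + 1/n], of length 1/n, and at most 2 C / n elsewhere,
    on a length of at most 2 C. With phi the identity the same estimate compares the entropy with |x
    - k|. *)
Lemma kflux_approx x : `|x| <= C -> `|q x - kflux phi x k| <= L * (2 + 2 * C + 4 * C ^+ 2) * n^-1.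
Proof.
move=> xC; have [xk|kx] := leP x k.
  pose f y := q y + phi y.
  have D (y : R) : is_derive y 1 f (sgn_approx n y * derive1 phi y + derive1 phi y).
    exact: (is_deriveD (dq y) (dphi y)).
  have H := mvt_on (B := L * (n^-1 * (2 * C))) D xk.
  rewrite /kflux max_r// min_l// (_ : q x - (phi k - phi x) = - (f k - f x)); last first.
    by rewrite /f qk; ring.
  rewrite normrN; apply: (le_trans (H _)).
    move=> y /andP[xy yk]; have yC : `|y| <= C by apply: in_C xC kC _ _; exact: ltW.
    rewrite (_ : _ + _ = derive1 phi y * (n^-1 * (y - k))); last first.
      by rewrite /sgn_approx th0; [ring|rewrite pmulr_rle0// subr_le0 ltW].
    rewrite normrM; apply: ler_pM; rewrite ?phiL// normrM gtr0_norm// ler_pM2l// distrC ger0_norm ?subr_ge0 ?(ltW yk)//.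
    exact: dist_C.
  have := small_arith (lexx 0) (_ : 0 <= k - x) _ (dist_C kC xC).
  rewrite subr_ge0 => /(_ xk); rewrite mulr_ge0// => /(_ isT).
  apply: le_trans; rewrite lerDr; exact: mulr_ge0 (mulr_ge0 L0 coef_ge0) (ltW v0).
pose f y := q y - phi y.
have D (y : R) : is_derive y 1 f (sgn_approx n y * derive1 phi y - derive1 phi y).
  exact: (is_deriveB (dq y) (dphi y)).
rewrite /kflux max_l ?(ltW kx)// min_r ?(ltW kx)// (_ : q x - (phi x - phi k) = f x - f k); last first.
  by rewrite /f qk; ring.
pose m := Num.min x (k + n^-1).
have km : k <= m by rewrite le_min (ltW kx) lerDl ltW.
have mx : m <= x by rewrite ge_min lexx.
have H1 := mvt_on (B := L * (2 + n^-1 * (2 * C))) D km.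
have H2 := mvt_on (B := L * (n^-1 * (2 * C))) D mx.
have E y : sgn_approx n y * derive1 phi y - derive1 phi y = derive1 phi y * (2 * (th (n * (y - k)) - 1) + n^-1 * (y - k)).
  by rewrite /sgn_approx; ring.
have t0 := step_ge0 sth th0 dth_ge0; have t1 := step_le1 sth th1 dth_ge0.
have I1 : `|f m - f k| <= L * (2 + n^-1 * (2 * C)) * n^-1.
  apply: (le_trans (H1 _)).
    move=> y /andP[ky ym]; have yx : y <= x by rewrite (le_trans (ltW ym)).
    have yC : `|y| <= C by apply: in_C kC xC (ltW ky) yx.
    rewrite E normrM; apply: ler_pM; rewrite ?phiL// (le_trans (ler_normD _ _))//; apply: lerD.
      rewrite normrM [`|2|]ger0_norm// -[leRHS]mulr1 ler_wpM2l// ler_norml.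
      have := t0 (n * (y - k)); have := t1 (n * (y - k)); lra.
    rewrite normrM gtr0_norm// ler_pM2l// ger0_norm ?subr_ge0 ?(ltW ky)//; exact: dist_C.
  apply: ler_wpM2l; first exact: mulr_ge0 L0 coef_ge0.
  by rewrite lerBlDl ge_min lexx orbT.
have I2 : `|f x - f m| <= L * (n^-1 * (2 * C)) * (x - m).
  apply: H2 => y /andP[my yx]; have ky : k < y by rewrite (le_lt_trans km).
  have yC : `|y| <= C by apply: in_C kC xC (ltW ky) (ltW yx).
  have yn : k + n^-1 <= y.
    move: my; rewrite gt_min => /orP[|/ltW//]; by rewrite ltNge (ltW yx).
  rewrite E th1; last by rewrite mulrC -ler_pdivrMr// mul1r lerBrDl.
  rewrite subrr mulr0 add0r normrM; apply: ler_pM; rewrite ?phiL//.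
  rewrite normrM gtr0_norm// ler_pM2l// ger0_norm ?subr_ge0 ?(ltW ky)//; exact: dist_C.
have mC : `|m| <= C by exact: in_C kC xC km mx.
have := small_arith (lexx 0) (_ : 0 <= x - m) _ (dist_C xC mC).
rewrite subr_ge0 => /(_ mx); rewrite mulr_ge0// => /(_ isT).
apply: le_trans; rewrite (_ : f x - f k = (f m - f k) + (f x - f m)); last by ring.
by rewrite (le_trans (ler_normD _ _))// lerD.
Qed.

End KruzkovEntropies.
Section Uniqueness.
Context {R : realType}.
Notation H := (@halfplane R).

Lemma C1_is_derive (phi : R -> R) (x : R) : C1 phi -> is_derive x 1 phi (derive1 phi x).
Proof. by move=> [dphi _]; apply: (DeriveDef (dphi x)); rewrite derive1E. Qed.

Lemma C1_bounded (phi : R -> R) (C : R) : C1 phi ->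
  exists2 L, 0 <= L & forall x, `|x| <= C -> `|derive1 phi x| <= L.
Proof.
move=> [_ cphi]; have /compact_bounded[M [Mr HM]] : compact (derive1 phi @` `[- C, C]).
  apply: continuous_compact; last exact: segment_compact.
  exact: continuous_subspaceT.
exists (`|M| + 1); first by rewrite addr_ge0.
move=> x xC; apply: (HM (`|M| + 1)); first by rewrite (le_lt_trans (ler_norm M))// ltrDl.
by exists x => //=; rewrite in_itv/= -ler_norml.
Qed.

Lemma C1_lip_on (phi : R -> R) (C L : R) : C1 phi ->
  (forall x, `|x| <= C -> `|derive1 phi x| <= L) -> lip_on phi C L.
Proof.
move=> Cphi HL a b aC bC.
have [c [c1 c2 ->]] := is_derive_mvtW b a (fun x => C1_is_derive x Cphi).
rewrite normrM ler_wpM2r// HL// ler_norml; have := norm_min aC bC; have := norm_max aC bC.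
by rewrite !ler_norml minC maxC => /andP[_ h1] /andP[h2 _]; rewrite (le_trans h2)//= (le_trans c2).
Qed.

Lemma C1_continuous (phi : R -> R) : C1 phi -> continuous phi.
Proof. by move=> Cphi; apply: is_derive_continuous => x; exact: C1_is_derive Cphi. Qed.

Lemma normalized_primitive (f : R -> R) (k : R) : continuous f ->
  exists2 F : R -> R, forall x : R, is_derive x 1 F (f x) & F k = 0.
Proof.
move=> /exists_primitive[F D]; exists (fun x => F x - F k); last by rewrite subrr.
by move=> x; apply: (is_derive_eq (is_deriveB (D x) (is_derive_cst (F k) x 1))); rewrite subr0.
Qed.

Lemma is_derive_derive1 (F f : R -> R) : (forall x : R, is_derive x 1 F (f x)) -> derive1 F = f.
Proof. by move=> D; apply/funext => x; rewrite derive1E; have [_ ->] := D x. Qed.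

Variable th : R -> R.
Hypothesis sth : smooth1 th.
Hypothesis th0 : forall x, x <= 0 -> th x = 0.
Hypothesis th1 : forall x, 1 <= x -> th x = 1.
Hypothesis dth_ge0 : forall x, 0 <= derive1 th x.

Lemma entropy_solution_kruzkov (phi u0 : R -> R) (w w' : R * R -> R) (C : R) : C1 phi ->
  entropy_solution phi u0 w -> measurable_fun setT w' -> (forall p, `|w' p| <= C) ->
  {ae leb2, forall p, H p -> w' p = w p} -> kruzkov phi w'.
Proof.
move=> Cphi [[mw _] _ _ ent] mw' wC ae k psi a N spsi a0 la Np psi0.
have C0 : 0 <= C by exact: le_trans (wC (0, 0)).
(* The constant k is arbitrary, so phi' has to be bounded on an interval containing both k and the
   values of the solution. *)
pose Cm := C + `|k|; have wCm p : `|w' p| <= Cm by rewrite (le_trans (wC p))// lerDl.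
have kCm : `|k| <= Cm by rewrite lerDr.
have Cm0 : 0 <= Cm by rewrite addr_ge0.
have [L L0 HL] := C1_bounded Cm Cphi.
have [Npt Npx] := supp_square_partial Np.
have [spt spx] := (smooth2_partial_t spsi, smooth2_partial_x spsi).
have [Tt Tx] := (smooth2_tame spt Npt, smooth2_tame spx Npx).
have cphi := C1_continuous Cphi; have cdphi : continuous (derive1 phi) := Cphi.2.
pose Kc := 2 + 2 * Cm + 4 * Cm ^+ 2; pose K := (L + 1) * Kc.
have Kc0 : 0 <= Kc by rewrite !addr_ge0// !mulr_ge0// exprn_ge0.
set X0 := \int[leb2]_p _.
pose I := \int[leb2]_p (`|partial_t psi p| + `|partial_x psi p|).
have bcomp (G : R -> R) : continuous G -> bmeas (fun p => G (w' p)).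
  move=> cG; have /compact_bounded[M [Mr HM]] : compact (G @` `[- C, C]).
    apply: continuous_compact; last exact: segment_compact.
    exact: continuous_subspaceT.
  split; first exact: (measurableT_comp (continuous_measurable_fun cG)).
  exists (`|M| + 1) => p; apply: (HM (`|M| + 1)); first by rewrite (le_lt_trans (ler_norm M))// ltrDl.
  by exists (w' p) => //=; rewrite in_itv/= -ler_norml.
have Tgen (G F : R -> R) : continuous G -> continuous F ->
    tame leb2 (fun p => G (w' p) * partial_t psi p + F (w' p) * partial_x psi p).
  move=> cG cF; apply: tameD; apply: tameMr; [exact: bcomp|exact: Tt|exact: bcomp|exact: Tx].
have TX : tame leb2 (fun p => `|w' p - k| * partial_t psi p + kflux phi (w' p) k * partial_x psi p).
  apply: tameD; apply: tameMr; [|exact: Tt| |exact: Tx].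
    by apply/bmeas_norm/bmeasB; [split => //; exists C|exact: bmeas_cst].
  apply: (bmeas_kflux (C := Cm) (Lam := L) cphi (C1_lip_on Cphi HL) L0 mw') => //.
have key (n : nat) : - X0 <= K * I * n.+1%:R^-1.
  have n1 : 1 <= n.+1%:R :> R by rewrite ler1n.
  have n0 : 0 < n.+1%:R :> R by rewrite ltr0n.
  have ss := sgn_approx_smooth sth k n.+1%:R.
  have cs := smooth1_continuous ss.
  have [eta deta eta0] := normalized_primitive k cs.
  have cq : continuous (fun x => sgn_approx th k n.+1%:R x * derive1 phi x).
    by move=> x; apply: cvgM; [exact: cs|exact: cdphi].
  have [q dq q0] := normalized_primitive k cq.
  have [E Eq] := (is_derive_derive1 deta, is_derive_derive1 dq).
  have [ceta cqq] := (is_derive_continuous deta, is_derive_continuous dq).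
  have pair : entropy_pair phi eta q.
    split.
    - split; first by split; [move=> x; have [] := deta x|rewrite E].
      rewrite E; split; first exact: smooth1_derivable.
      exact: smooth1_continuous (smooth1_derive ss).
    - move=> x; rewrite derive1nS derive1n1 E; exact: (dsgn_approx_gt0 sth dth_ge0).
    - by move=> x; have [] := dq x.
    - by move=> x; rewrite E Eq.
  have cts := late_csupp a0 la Np.
  have := ent eta q psi pair spsi cts psi0.
  rewrite (Rint_halfplane (a := partial_t psi) (b := partial_x psi) mw mw' ae ceta cqq); last 2 first.
  - exact: (tame_measurable Tt).
  - exact: (tame_measurable Tx).
  have -> : \int[leb2]_p (\1_H p * (eta (w' p) * partial_t psi p + q (w' p) * partial_x psi p)) =
      \int[leb2]_p (eta (w' p) * partial_t psi p + q (w' p) * partial_x psi p).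
    apply: eq_Rintegral => p _; have [p0|p0] := ltP p.1 0.
      by have [-> ->] := late_partial la (lt_trans p0 a0); rewrite !mulr0 addr0 mulr0.
    by rewrite indicE mem_set ?mul1r//=; split => //=; rewrite in_itv/= p0.
  move=> Hge; have TI := tameD (tame_norm Tt) (tame_norm Tx).
  have Te := Tgen _ _ ceta cqq.
  have pt p : eta (w' p) * partial_t psi p + q (w' p) * partial_x psi p <=
      (`|w' p - k| * partial_t psi p + kflux phi (w' p) k * partial_x psi p) +
      K * n.+1%:R^-1 * (`|partial_t psi p| + `|partial_x psi p|).
    have v0 : 0 <= n.+1%:R^-1 :> R by rewrite invr_ge0.
    have B1 : `|eta (w' p) - `|w' p - k| | <= K * n.+1%:R^-1.
      (* The entropy is its own flux for the identity in place of phi, with Lipschitz constant 1;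
         this is why K contains L + 1. *)
      have dI (x : R) : is_derive x 1 (@id R) (derive1 (@id R) x).
        by rewrite derive1E derive_id; exact: is_derive_id.
      have LI (x : R) : `|x| <= Cm -> `|derive1 (@id R) x| <= 1.
        by move=> _; rewrite derive1E derive_id normr1.
      have dE (x : R) : is_derive x 1 eta (sgn_approx th k n.+1%:R x * derive1 (@id R) x).
        by rewrite derive1E derive_id mulr1.
      have := kflux_approx sth th0 th1 dth_ge0 dI LI n1 kCm dE eta0 (wCm p).
      have -> : kflux id (w' p) k = `|w' p - k|.
        rewrite /kflux; have [h|h] := leP (w' p) k.
          by rewrite ler0_norm ?subr_le0// opprB.
        by rewrite gtr0_norm ?subr_gt0.
      move=> /le_trans; apply; rewrite ler_wpM2r// /K ler_wpM2r// lerDr//.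
    have B2 : `|q (w' p) - kflux phi (w' p) k| <= K * n.+1%:R^-1.
      have := kflux_approx sth th0 th1 dth_ge0 (fun x => C1_is_derive x Cphi) HL n1 kCm dq q0 (wCm p).
      by move=> /le_trans; apply; rewrite ler_wpM2r// /K ler_wpM2r// lerDl.
    rewrite -subr_ge0 opprD addrA; rewrite [leRHS](_ : _ = (K * n.+1%:R^-1 * `|partial_t psi p| - (eta (w' p) - `|w' p - k|) * partial_t psi p) +
       (K * n.+1%:R^-1 * `|partial_x psi p| - (q (w' p) - kflux phi (w' p) k) * partial_x psi p)); last by ring.
    by apply: addr_ge0; rewrite subr_ge0 (le_trans (ler_norm _))// normrM ler_wpM2r.
  have := le_trans Hge (tame_le_Rint Te (tameD TX (tameZ (K * n.+1%:R^-1) TI)) pt).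
  rewrite (tame_RintD TX (tameZ (K * n.+1%:R^-1) TI)) (tame_RintZ _ TI) -/X0 -/I.
  by rewrite -lerBlDl sub0r mulrAC.
rewrite -oppr_le0.
have cv : K * I * n.+1%:R^-1 @[n --> \oo] --> 0.
  rewrite -[X in _ --> X](mulr0 (K * I)); apply: cvgM; first exact: cvg_cst.
  exact: cvg_harmonic.
by apply: (cvgr_to_ge cv); apply: nearW.
Qed.

(** The two integrals over the initial line coincide and cancel. The bounded versions both vanish at
    negative times, so the difference equation holds on the whole plane, with test functions that
    need not vanish at t = 0. *)
Lemma weak_difference (phi u0 : R -> R) (w1 w2 w1' w2' : R * R -> R) : continuous phi ->
  weak_solution phi u0 w1 -> weak_solution phi u0 w2 ->
  measurable_fun H w1 -> measurable_fun H w2 ->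
  bmeas w1' -> bmeas w2' -> bmeas (fun p => phi (w1' p)) -> bmeas (fun p => phi (w2' p)) ->
  (forall p : R * R, p.1 < 0 -> w1' p = 0) -> (forall p : R * R, p.1 < 0 -> w2' p = 0) ->
  {ae leb2, forall p, H p -> w1' p = w1 p} -> {ae leb2, forall p, H p -> w2' p = w2 p} ->
  forall psi N, smooth2 psi -> supp_square N psi ->
  \int[leb2]_p ((w1' p - w2' p) * partial_t psi p + (phi (w1' p) - phi (w2' p)) * partial_x psi p) = 0.
Proof.
move=> cphi weak1 weak2 mw1 mw2 bw1 bw2 bp1 bp2 z1 z2 ae1 ae2 psi N spsi Np.
have [Npt Npx] := supp_square_partial Np.
have [spt spx] := (smooth2_partial_t spsi, smooth2_partial_x spsi).
have [Tt Tx] := (smooth2_tame spt Npt, smooth2_tame spx Npx).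
have [mt mx] := (tame_measurable Tt, tame_measurable Tx).
have cid : continuous (@id R) by move=> x; exact: cvg_id.
have [mw1' mw2'] := (bw1.1, bw2.1).
have K := supp_square_compact Np.
have := weak1 psi spsi K; have := weak2 psi spsi K.
rewrite (Rint_halfplane mw1 mw1' ae1 cid cphi mt mx) (Rint_halfplane mw2 mw2' ae2 cid cphi mt mx).
have bH : bmeas (\1_H : R * R -> R).
  split; first by apply: measurable_indic; exact: measurable_halfplane.
  by exists 1 => p; rewrite indicE ger0_norm//; case: (_ \in _).
have T (w : R * R -> R) : bmeas w -> bmeas (fun p => phi (w p)) ->
    tame leb2 (fun p => \1_H p * (w p * partial_t psi p + phi (w p) * partial_x psi p)).
  move=> bw bp; apply: tameMr; first exact: bH.
  by apply: tameD; apply: tameMr; [exact: bw|exact: Tt|exact: bp|exact: Tx].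
have T1 := T _ bw1 bp1; have T2 := T _ bw2 bp2.
move=> E2 E1; have E : \int[leb2]_p (\1_H p * (w1' p * partial_t psi p + phi (w1' p) * partial_x psi p)) -
   \int[leb2]_p (\1_H p * (w2' p * partial_t psi p + phi (w2' p) * partial_x psi p)) = 0.
  by apply/eqP; rewrite subr_eq0; apply/eqP; apply: (addIr (\int[lebesgue_measure]_x (u0 x * psi (0, x)))); rewrite E1.
rewrite -E -(tame_RintB T1 T2); apply: eq_Rintegral => p _.
have [p0|p0] := ltP p.1 0; first by rewrite z1// z2// !subrr !mul0r addr0.
by rewrite indicE mem_set ?mul1r//=; [ring|split => //=; rewrite in_itv/= p0].
Qed.

Lemma entropy_solution_unique (phi u0 : R -> R) (w1 w2 : R * R -> R) : C1 phi ->
  entropy_solution phi u0 w1 -> entropy_solution phi u0 w2 ->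
  {ae leb2, forall p, H p -> w1 p = w2 p}.
Proof.
move=> Cphi e1 e2; have cphi := C1_continuous Cphi.
have [L1 weak1 _ _] := e1; have [L2 weak2 _ _] := e2.
have [v1 [C1' [mv1 v1C v10 ae1]]] := Linfty_bounded_version L1.
have [v2 [C2' [mv2 v2C v20 ae2]]] := Linfty_bounded_version L2.
pose C := Num.max C1' C2'.
have vC1 p : `|v1 p| <= C by rewrite le_max v1C.
have vC2 p : `|v2 p| <= C by rewrite le_max v2C orbT.
have [L L0 HL] := C1_bounded C Cphi; have lip := C1_lip_on Cphi HL.
have k1 := entropy_solution_kruzkov Cphi e1 mv1 vC1 ae1.
have k2 := entropy_solution_kruzkov Cphi e2 mv2 vC2 ae2.
have b1 : bmeas v1 by split => //; exists C.
have b2 : bmeas v2 by split => //; exists C.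
have bphi (v : R * R -> R) : measurable_fun setT v -> (forall p : R * R, `|v p| <= C) -> bmeas (fun p => phi (v p)).
  move=> mv vC; split; first exact: (measurableT_comp (continuous_measurable_fun cphi)).
  have C0 : 0 <= C by exact: le_trans (vC (0, 0)).
  exists (`|phi 0| + L * C) => p; rewrite -{1}(subrK (phi 0) (phi (v p))) addrC (le_trans (ler_normD _ _))// lerD2l.
  rewrite (le_trans (lip (v p) 0 _ _))// ?normr0// subr0 ler_wpM2l//.
have bp1 := bphi _ mv1 vC1; have bp2 := bphi _ mv2 vC2.
have wk := weak_difference cphi weak1 weak2 L1.1 L2.1 b1 b2 bp1 bp2 v10 v20 ae1 ae2.
have D := doubled_difference_eq0 sth th0 th1 dth_ge0 (d := fun p => v1 p - v2 p)
  (e := fun p => phi (v1 p) - phi (v2 p)) (F := fun p => kflux phi (v1 p) (v2 p)) (Lam := L).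
have ae0 : {ae leb2, forall p, v1 p - v2 p = 0}.
  apply: D => //.
  - exact: bmeasB.
  - exact: bmeasB.
  - exact: (bmeas_kflux cphi lip L0 mv1 mv2 vC1 vC2).
  - by move=> p; exact: lip.
  - by move=> p; exact: (kflux_le lip).
  - by move=> p; exact: kflux_normE.
  - by move=> p p0; rewrite v10// v20// subrr.
  - move=> psi a N spsi a0 la Np psi0.
    exact: (kruzkov_pair sth th0 th1 dth_ge0 cphi lip L0 mv1 mv2 vC1 vC2 k1 k2 spsi a0 la Np psi0).
have [A [mA A0 sA]] := negligibleU ae0 (negligibleU ae1 ae2).
exists A; split => // p /= np; apply: sA.
have [h0|h0] := pselect (v1 p - v2 p = 0); last by left.
have [h1|h1] := pselect (H p -> v1 p = w1 p); last by right; left.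
right; right => h2; apply: np => Hp.
by rewrite -h1// -h2//; apply/eqP; rewrite -subr_eq0 h0.
Qed.

End Uniqueness.

(** * Entropy inequality for the scheme *)

Section Translation.
Context {R : realType}.
Notation mu := (@lebesgue_measure R).

Lemma lebesgue_measure_shift (h : R) (A : set R) : measurable A ->
  pushforward mu ((fun x => x + h) : R -> measurableTypeR R) A = mu A.
Proof.
have ms : measurable_fun setT ((fun x => x + h) : R -> measurableTypeR R).
  by apply: measurable_funD; [exact: measurable_id|exact: measurable_cst].
move=> mA; apply/esym/lebesgue_measure_unique => //= _ [[a b]] _ <-.
rewrite /pushforward (_ : _ @^-1` _ = `](a - h), (b - h)]%classic).
  rewrite !lebesgue_measure_itv/= !lte_fin ltrD2r; case: ifPn => // _.
  by rewrite -!EFinD; congr EFin; ring.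
by apply/seteqP; split => x /=; rewrite !in_itv/= ltrBlDr lerBrDr.
Qed.

Lemma tame_shift (f : R -> R) (h : R) : tame mu f -> tame mu (fun x => f (x + h)).
Proof.
move=> [mf [D [C [mD Doo fC]]]].
have ms : measurable_fun setT (fun x : R => x + h).
  by apply: measurable_funD; [exact: measurable_id|exact: measurable_cst].
split; first exact: (measurableT_comp mf ms).
exists ((fun x => x + h) @^-1` D), C; split.
- by rewrite -[X in measurable X]setTI; exact: ms.
- have E := lebesgue_measure_shift h mD.
  by apply: le_lt_trans Doo; rewrite le_eqVlt; apply/orP; left; apply/eqP; exact: E.
- by move=> x; rewrite (le_trans (fC _))// !indicE mem_preimage.
Qed.

Lemma Rint_shift (f : R -> R) (h : R) : tame mu f -> \int[mu]_x f (x + h) = \int[mu]_x f x.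
Proof.
move=> tf; have tfs := tame_shift h tf; congr fine.
have ms : measurable_fun setT ((fun x => x + h) : measurableTypeR R -> measurableTypeR R).
  by apply: measurable_funD; [exact: measurable_id|exact: measurable_cst].
have mf : measurable_fun setT (EFin \o f : measurableTypeR R -> \bar R) by apply/measurable_EFinP; case: tf.
have := integral_pushforward ms (mu := mu) (D := setT) mf (tame_integrable tfs) measurableT.
rewrite preimage_setT => <-.
by apply: eq_measure_integral => //= A mA _; exact: lebesgue_measure_shift.
Qed.

Lemma leb2_Rint_shift (f : R * R -> R) (N : R) (v : R * R) : bmeas f -> supp_square N f ->
  \int[leb2]_p f (p + v) = \int[leb2]_p f p.
Proof.
move=> bf Nf; have [C C0 fC] := bmeas_gt0 bf; have [mf _] := bf.
have T1 : tame_prod mu mu f.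
  by apply: (tame_prod_supp_square (N := N) (C := C)) => //; exact: supp_square_indic.
have T2 : tame_prod mu mu (fun p => f (p + v)).
  apply: (tame_prod_supp_square (N := N + (`|v.1| + `|v.2|)) (C := C)).
    apply: (measurableT_comp mf); apply: measurable_fun_pair.
      by apply: measurable_funD; [exact: measurable_fst|exact: measurable_cst].
    by apply: measurable_funD; [exact: measurable_snd|exact: measurable_cst].
  apply: supp_square_indic => // p np; apply: Nf; apply: contra_not np => /squareP[/= h1 h2].
  apply/squareP; split.
    rewrite -(addrK v.1 p.1) (le_trans (ler_normB _ _))// lerD// lerDl//.
  rewrite -(addrK v.2 p.2) (le_trans (ler_normB _ _))// lerD// lerDr//.
rewrite (leb2_Rint12 T2) (leb2_Rint12 T1).
rewrite -(Rint_shift v.1 (tame_prod_int_fst T1)); apply: eq_Rintegral => x _.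
have Tx : tame mu (fun y => f (x + v.1, y)) by exact: tame_prod_fst T1.
by rewrite -[RHS](Rint_shift v.2 Tx).
Qed.

End Translation.

(** * Kinetic entropies *)

Section KineticEntropy.
Context {R : realType}.
Variables (phi eta q : R -> R) (a b : R).
Hypothesis Cphi : C1 phi.
Hypothesis pair : entropy_pair phi eta q.
Hypothesis ab : a <= b.
Implicit Types (c x y f k w : R).

(** For c = 1 / lambda and c = - 1 / lambda these are the equilibrium values of the two particle
    distributions, reached when v = phi(u). *)
Definition half_flux c w : R := 2^-1 * w + 2^-1 * c * phi w.
Definition half_entropy c w : R := 2^-1 * eta w + 2^-1 * c * q w.

(* The entropy of a particle distribution, extended away from the equilibria half_flux c w as
   the upper envelope of the tangents there. *)
Definition kin_entropy c f : R :=
  sup [set half_entropy c k + derive1 eta k * (f - half_flux c k) | k in `[a, b]].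

Let deta x : is_derive x 1 eta (derive1 eta x).
Proof. by have [[Ceta _] _ _ _] := pair; exact: C1_is_derive. Qed.

Let d2eta x : is_derive x 1 (derive1 eta) (derive1 (derive1 eta) x).
Proof. by have [[_ Ceta] _ _ _] := pair; exact: C1_is_derive. Qed.

Let dq x : is_derive x 1 q (derive1 eta x * derive1 phi x).
Proof. by have [_ _ D E] := pair; apply: (DeriveDef (D x)); rewrite -derive1E -E. Qed.

Lemma deta_ndecr x y : x <= y -> derive1 eta x <= derive1 eta y.
Proof.
rewrite le_eqVlt => /predU1P[->//|xy]; have [z _ E] := is_derive_mvt d2eta xy.
rewrite -subr_ge0 E mulr_ge0// ?subr_ge0 ?(ltW xy)//.
by have [_ /(_ z)/ltW + _ _] := pair; rewrite derive1nS derive1n1.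
Qed.

Lemma deta_bounded : exists2 L, 0 <= L & forall k, a <= k <= b -> `|derive1 eta k| <= L.
Proof.
have [[Ceta _] _ _ _] := pair.
have [L L0 HL] := C1_bounded (`|a| + `|b|) Ceta; exists L => // k /andP[ak kb]; apply: HL.
have := ler_norm b; have := ler_norm (- a); have := normr_ge0 a; have := normr_ge0 b.
by rewrite normrN ler_norml; lra.
Qed.

Lemma is_derive_half_flux c x :
  is_derive x 1 (half_flux c) (2^-1 * (1 + c * derive1 phi x)).
Proof.
have D := is_deriveD (is_deriveZ 2^-1 (is_derive_id x 1)) (is_deriveZ (2^-1 * c) (C1_is_derive x Cphi)).
by apply: (is_derive_eq D); rewrite /GRing.scale /=; ring.
Qed.

Lemma is_derive_half_entropy c x :
  is_derive x 1 (half_entropy c) (derive1 eta x * (2^-1 * (1 + c * derive1 phi x))).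
Proof.
have D := is_deriveD (is_deriveZ 2^-1 (deta x)) (is_deriveZ (2^-1 * c) (dq x)).
by apply: (is_derive_eq D); rewrite /GRing.scale /=; ring.
Qed.

Lemma continuous_is_derive_bounded (g dg : R -> R) : (forall x : R, is_derive x 1 g (dg x)) ->
  exists B, forall k, a <= k <= b -> `|g k| <= B.
Proof.
move=> D; have cg := is_derive_continuous D.
have /compact_bounded[M [Mr HM]] : compact (g @` `[a, b]).
  apply: continuous_compact; last exact: segment_compact.
  exact: continuous_subspaceT.
exists (`|M| + 1) => k kab; apply: (HM (`|M| + 1)); first by rewrite (le_lt_trans (ler_norm M))// ltrDl.
by exists k => //=; rewrite in_itv.
Qed.

Let tangents_has_sup c f :
  has_sup [set half_entropy c k + derive1 eta k * (f - half_flux c k) | k in `[a, b]].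
Proof.
split; first by exists (half_entropy c a + derive1 eta a * (f - half_flux c a)), a => //=; rewrite in_itv/= lexx.
have [B HB] := continuous_is_derive_bounded (is_derive_half_entropy c).
have [B' HB'] := continuous_is_derive_bounded (is_derive_half_flux c).
have [L L0 HL] := deta_bounded.
exists (B + L * (`|f| + B')) => _ [k /= + <-]; rewrite in_itv/= => kab.
apply: lerD; first exact: le_trans (ler_norm _) (HB k kab).
rewrite (le_trans (ler_norm _))// normrM ler_pM ?HL//.
by rewrite (le_trans (ler_normB _ _))// lerD2l HB'.
Qed.

Lemma kin_entropy_ub c f k : a <= k <= b ->
  half_entropy c k + derive1 eta k * (f - half_flux c k) <= kin_entropy c f.
Proof.
by move=> kab; apply: sup_upper_bound; [exact: tangents_has_sup|exists k => //=; rewrite in_itv].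
Qed.

Lemma kin_entropy_le c f y :
  (forall k, a <= k <= b -> half_entropy c k + derive1 eta k * (f - half_flux c k) <= y) ->
  kin_entropy c f <= y.
Proof.
move=> H; apply: ge_sup; first by have [] := tangents_has_sup c f.
by move=> _ [k /= + <-]; rewrite in_itv/= => /H.
Qed.

(** A supremum of affine functions of slope at most L. This is what lets the L^1_loc convergence of
    u and v pass to the kinetic entropies. *)
Lemma kin_entropy_lip c L f f' : (forall k, a <= k <= b -> `|derive1 eta k| <= L) ->
  `|kin_entropy c f - kin_entropy c f'| <= L * `|f - f'|.
Proof.
move=> HL.
have lem x y : kin_entropy c x - kin_entropy c y <= L * `|x - y|.
  rewrite lerBlDr; apply: kin_entropy_le => k kab.
  rewrite (_ : _ + _ = derive1 eta k * (x - y) + (half_entropy c k + derive1 eta k * (y - half_flux c k))); last by ring.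
  apply: lerD; last exact: kin_entropy_ub.
  by rewrite (le_trans (ler_norm _))// normrM ler_wpM2r// HL.
by rewrite ler_norml lem andbT lerNl opprB distrC lem.
Qed.

Lemma kin_entropy_bounded c : exists C : R, forall f,
  half_flux c a <= f <= half_flux c b -> `|kin_entropy c f| <= C.
Proof.
have [L L0 HL] := deta_bounded.
exists (`|kin_entropy c 0| + L * (`|half_flux c a| + `|half_flux c b|)) => f /andP[h1 h2].
rewrite -{1}(subrK (kin_entropy c 0) (kin_entropy c f)).
rewrite addrC (le_trans (ler_normD _ _))// lerD2l (le_trans (kin_entropy_lip _ _ _ HL))//.
rewrite subr0 ler_wpM2l// ler_norml.
have := ler_norm (half_flux c b); have := ler_norm (- half_flux c a).
have := normr_ge0 (half_flux c b); have := normr_ge0 (half_flux c a).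
by rewrite normrN => *; apply/andP; split; lra.
Qed.

Lemma kin_entropy_convex c s f f' : 0 <= s <= 1 ->
  kin_entropy c ((1 - s) * f + s * f') <= (1 - s) * kin_entropy c f + s * kin_entropy c f'.
Proof.
move=> /andP[s0 s1]; apply: kin_entropy_le => k kab.
rewrite [leLHS](_ : _ = (1 - s) * (half_entropy c k + derive1 eta k * (f - half_flux c k)) +
  s * (half_entropy c k + derive1 eta k * (f' - half_flux c k))); last by ring.
by apply: lerD; apply: ler_wpM2l; rewrite ?subr_ge0//; exact: kin_entropy_ub.
Qed.

(* With c = 1 / lambda this is the subcharacteristic condition. *)
Definition subchar c := forall k, a <= k <= b -> `|c * derive1 phi k| <= 1.

Let dh_ge0 c x : subchar c -> a <= x <= b -> 0 <= 2^-1 * (1 + c * derive1 phi x).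
Proof.
move=> sc xab; rewrite mulr_ge0// -lerBlDl sub0r; have := sc x xab.
by rewrite ler_norml => /andP[].
Qed.

Lemma half_flux_ndecr c x y : subchar c -> a <= x -> x <= y -> y <= b ->
  half_flux c x <= half_flux c y.
Proof.
move=> sc ax; rewrite le_eqVlt => /predU1P[->//|xy] yb.
have [z /andP[xz zy] E] := is_derive_mvt (is_derive_half_flux c) xy.
rewrite -subr_ge0 E mulr_ge0// ?subr_ge0 ?(ltW xy)// dh_ge0//.
by rewrite (le_trans ax (ltW xz)) (le_trans (ltW zy) yb).
Qed.

(** The tangent at k stays below the curve x |-> (h(x), g(x)): along the curve the gap has
    derivative (eta'(x) - eta'(k)) h'(x), which has the sign of x - k or vanishes. Points where
    |phi'| = lambda, with h' = 0, are covered. *)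
Lemma kin_entropy_equilibrium c w : subchar c -> a <= w <= b ->
  kin_entropy c (half_flux c w) = half_entropy c w.
Proof.
move=> sc wab; apply/eqP; rewrite eq_le; apply/andP; split; last first.
  by have := kin_entropy_ub c (half_flux c w) wab; rewrite subrr mulr0 addr0.
apply: kin_entropy_le => k kab.
pose F x := half_entropy c x - derive1 eta k * half_flux c x.
have D x : is_derive x 1 F ((derive1 eta x - derive1 eta k) * (2^-1 * (1 + c * derive1 phi x))).
  have D' := is_deriveB (is_derive_half_entropy c x) (is_deriveZ (derive1 eta k) (is_derive_half_flux c x)).
  by apply: (is_derive_eq D'); rewrite /GRing.scale /=; ring.
suff : 0 <= F w - F k by rewrite /F; lra.
have [kw|wk|->] := ltgtP k w; last by rewrite subrr.
- have [z /andP[kz zw] ->] := is_derive_mvt D kw.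
  rewrite mulr_ge0 ?subr_ge0 ?(ltW kw)// mulr_ge0 ?subr_ge0 ?deta_ndecr ?(ltW kz)//.
  apply: dh_ge0 => //; move: kab wab kz zw; lra.
- have [z /andP[kz zw] E] := is_derive_mvt D wk.
  rewrite -opprB E -mulNr mulr_ge0 ?subr_ge0 ?(ltW wk)// -mulNr mulr_ge0//.
    by rewrite opprB subr_ge0 deta_ndecr ?(ltW zw).
  apply: dh_ge0 => //; move: kab wab kz zw; lra.
Qed.

Lemma half_fluxD c w : half_flux c w + half_flux (- c) w = w.
Proof. by rewrite /half_flux; field. Qed.

Lemma half_entropyD c w : half_entropy c w + half_entropy (- c) w = eta w.
Proof. by rewrite /half_entropy; field. Qed.

(** The tangents at f + f' have the same slope for both signs of c, and the deviations of f and f'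
    from the two equilibria add up to 0 by [half_fluxD]. *)
Lemma kin_entropy_ge c f f' : a <= f + f' <= b ->
  eta (f + f') <= kin_entropy c f + kin_entropy (- c) f'.
Proof.
move=> fab; have := lerD (kin_entropy_ub c f fab) (kin_entropy_ub (- c) f' fab).
apply: le_trans; rewrite -(half_entropyD c (f + f')) -subr_ge0.
rewrite (_ : _ - _ = derive1 eta (f + f') * ((f + f') - (half_flux c (f + f') + half_flux (- c) (f + f')))); last by ring.
by rewrite half_fluxD subrr mulr0.
Qed.

(* Convexity and kin_entropy_ge, as both distributions move towards the equilibrium of their sum. *)
Lemma kin_entropy_relax c s f f' (u := f + f') : subchar c -> subchar (- c) -> 0 <= s <= 1 ->
  a <= u <= b ->
  kin_entropy c ((1 - s) * f + s * half_flux c u) +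
  kin_entropy (- c) ((1 - s) * f' + s * half_flux (- c) u) <= kin_entropy c f + kin_entropy (- c) f'.
Proof.
move=> sc scN s01 uab; have /andP[s0 s1] := s01.
apply: (le_trans (lerD (kin_entropy_convex _ _ _ s01) (kin_entropy_convex _ _ _ s01))).
rewrite !kin_entropy_equilibrium//.
have H := kin_entropy_ge c uab; have E := half_entropyD c u.
rewrite -subr_ge0 (_ : _ - _ = s * ((kin_entropy c f + kin_entropy (- c) f') - (half_entropy c u + half_entropy (- c) u))); last by ring.
by rewrite mulr_ge0// subr_ge0 E.
Qed.

End KineticEntropy.
Section Average.
Context {R : realType}.
Notation mu := (@lebesgue_measure R).

Lemma average_bounds (u0 : R -> R) (a b x y : R) : measurable_fun setT u0 ->
  {ae mu, forall x, a <= u0 x} -> {ae mu, forall x, u0 x <= b} -> x < y ->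
  a <= (y - x)^-1 * \int[mu]_(z in `[x, y]) u0 z <= b.
Proof.
move=> mu0 [A [mA A0 sA]] [B [mB B0 sB]] xy.
have mI : measurable (`[x, y]%classic : set R) by exact: measurable_itv.
have TI : tame mu (\1_`[x, y] : R -> R) by apply: tame_indic => //; exact: lebesgue_itv_lty.
have EI : \int[mu]_z \1_`[x, y] z = y - x.
  by rewrite Rint_indic//= lebesgue_measure_itv/= lte_fin xy.
have yx0 : 0 < y - x by rewrite subr_gt0.
have red (w : R -> R) (C : R) : measurable_fun setT w -> (forall z, `|w z| <= C) ->
    (forall z, a <= u0 z -> u0 z <= b -> w z = u0 z) ->
    tame mu (fun z => \1_`[x, y] z * w z) /\
    \int[mu]_(z in `[x, y]) u0 z = \int[mu]_z (\1_`[x, y] z * w z).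
  move=> mw wC wE; split; first by apply: tameM => //; split => //; exists C.
  transitivity (\int[mu]_(z in `[x, y]) w z).
    congr fine; apply: ae_eq_integral => //.
    - by apply/measurable_EFinP; exact: measurable_funS mu0.
    - by apply/measurable_EFinP; exact: measurable_funS mw.
    - have N := negligibleU (_ : mu.-negligible A) (_ : mu.-negligible B).
      have [|| D [mD D0 sD]] := N; [by exists A; split|by exists B; split|].
      exists D; split => // z /= nz; apply: sD.
      have [h|h] := pselect (A z); [by left|right; apply: sB => /= h2].
      apply: nz => _; rewrite wE//; apply: contrapT => h3; apply/h/sA => /= h4.
      by exact: h3.
  rewrite Rintegral_mkcond; apply: eq_Rintegral => z _; rewrite patchE indicE.
  by case: ifPn => _; rewrite ?mul1r ?mul0r.
apply/andP; split.
(* u0 is replaced by a bounded function that agrees with it almost everywhere. With the maximum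
   outermost the lower bound holds at every point whatever the order of a and b; the upper bound
   uses the opposite nesting. *)
- have [||z|T ->] := red (fun z => Num.max a (Num.min b (u0 z))) (`|a| + `|b|).
  + apply: measurable_maxr; first exact: measurable_cst.
    by apply: measurable_minr => //; exact: measurable_cst.
  + move=> z; have := ler_norm a; have := ler_norm b; have := ler_norm (- a); have := ler_norm (- b).
    have := normr_ge0 a; have := normr_ge0 b; rewrite !normrN ler_norml le_max ge_max ge_min.
    move=> h1 h2 h3 h4 h5 h6; apply/and3P; split; [apply/orP; left; lra|lra|apply/orP; left; lra].
  + by move=> az zb; rewrite min_r// max_r.
  rewrite mulrC ler_pdivlMr// -EI -(tame_RintZ _ TI); apply: tame_le_Rint => //; first exact: tameZ.
  by move=> z; rewrite mulrC ler_wpM2l ?indicE// le_max lexx.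
- have [||z|T ->] := red (fun z => Num.min b (Num.max a (u0 z))) (`|a| + `|b|).
  + apply: measurable_minr; first exact: measurable_cst.
    by apply: measurable_maxr => //; exact: measurable_cst.
  + move=> z; have := ler_norm a; have := ler_norm b; have := ler_norm (- a); have := ler_norm (- b).
    have := normr_ge0 a; have := normr_ge0 b; rewrite !normrN ler_norml le_min ge_min le_max.
    move=> h1 h2 h3 h4 h5 h6; apply/andP; split; [apply/andP; split; [lra|apply/orP; left; lra]|apply/orP; left; lra].
  + by move=> az zb; rewrite max_r// min_r.
  rewrite mulrC ler_pdivrMr// -EI -(tame_RintZ _ TI); apply: tame_le_Rint => //; first exact: tameZ.
  by move=> z; rewrite mulrC ler_wpM2r ?indicE// ge_min lexx.
Qed.

End Average.

(** * Invariant interval and entropy inequality of the scheme *)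

Section Scheme.
Context {R : realType}.
Variables (phi u0 : R -> R) (a b s lambda dx : R).
Hypothesis Cphi : C1 phi.
Hypothesis lambda0 : 0 < lambda.
Hypothesis s01 : 0 <= s <= 1.
Hypothesis phi_lambda : forall k, a <= k <= b -> `|derive1 phi k| <= lambda.
Hypothesis dx0 : 0 < dx.
Hypothesis u0_init : forall j, a <= u_init u0 dx j <= b.

Notation c := (lambda^-1).
Notation st n := (d1q2 phi u0 s lambda dx n).
Notation fp n j := (f_plus lambda (st n) j).
Notation fm n j := (f_minus lambda (st n) j).
Notation u n j := ((st n).1 j).

Lemma subchar_pos : subchar phi a b c.
Proof.
move=> k /phi_lambda kl; rewrite normrM gtr0_norm ?invr_gt0// mulrC.
by rewrite ler_pdivrMr// mul1r.
Qed.

Lemma subchar_neg : subchar phi a b (- c).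
Proof. by move=> k /subchar_pos; rewrite mulNr normrN. Qed.

Lemma f_plusE (uv : lattice * lattice) (j : int) :
  f_plus lambda uv j = 2^-1 * uv.1 j + 2^-1 * c * uv.2 j :> R.
Proof. by rewrite /f_plus invfM. Qed.

Lemma f_minusE (uv : lattice * lattice) (j : int) :
  f_minus lambda uv j = 2^-1 * uv.1 j + 2^-1 * (- c) * uv.2 j :> R.
Proof. by rewrite /f_minus invfM; ring. Qed.

Lemma f_sum (uv : lattice * lattice) (j : int) : f_plus lambda uv j + f_minus lambda uv j = uv.1 j :> R.
Proof. by rewrite f_plusE f_minusE; field; rewrite gt_eqF. Qed.

(** In particle variables relaxation is a convex combination with the equilibrium, and transport
    only renames the cell; the index is shifted on the left so that the right-hand side lives in one
    cell. *)
Lemma f_plus_step n j : fp n.+1 (j + 1) = (1 - s) * fp n j + s * half_flux phi c (u n j).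
Proof.
rewrite /d1q2 iterS -/(d1q2 phi u0 s lambda dx n) /transport /moments f_plusE /= addrK.
rewrite !f_plusE f_minusE /half_flux /=; field; rewrite gt_eqF//.
Qed.

Lemma f_minus_step n j : fm n.+1 (j - 1) = (1 - s) * fm n j + s * half_flux phi (- c) (u n j).
Proof.
rewrite /d1q2 iterS -/(d1q2 phi u0 s lambda dx n) /transport /moments f_minusE /= subrK.
rewrite !f_minusE f_plusE /half_flux /=; field; rewrite gt_eqF//.
Qed.

(** The induction is carried by the particle distributions: each new value is a convex combination
    of an old one and an equilibrium, and the equilibria of values in [a, b] lie between those of a
    and b because [half_flux] is nondecreasing. The two bounds add up to a <= u <= b by
    [half_fluxD]. *)
Lemma scheme_invariant n : forall j,
  [/\ half_flux phi c a <= fp n j <= half_flux phi c b,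
      half_flux phi (- c) a <= fm n j <= half_flux phi (- c) b & a <= u n j <= b].
Proof.
have mono d w : subchar phi a b d -> a <= w <= b ->
    half_flux phi d a <= half_flux phi d w <= half_flux phi d b.
  by move=> sd /andP[aw wb]; rewrite !(half_flux_ndecr Cphi sd)// (le_trans aw).
have [s0 s1] := andP s01.
have cvx (x y l r : R) : l <= x <= r -> l <= y <= r -> l <= (1 - s) * x + s * y <= r.
  move=> /andP[lx xr] /andP[ly yr]; have s1' : 0 <= 1 - s by rewrite subr_ge0.
  have := ler_wpM2l s1' lx; have := ler_wpM2l s1' xr; have := ler_wpM2l s0 ly; have := ler_wpM2l s0 yr.
  lra.
have sum n' j : half_flux phi c a <= fp n' j <= half_flux phi c b ->
    half_flux phi (- c) a <= fm n' j <= half_flux phi (- c) b -> a <= u n' j <= b.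
  move=> /andP[h1 h2] /andP[h3 h4]; rewrite -(f_sum (st n') j).
  have Ea := half_fluxD phi c a; have Eb := half_fluxD phi c b.
  by apply/andP; split; [rewrite -[leLHS]Ea|rewrite -[leRHS]Eb]; exact: lerD.
elim: n => [|n IH] j.
  have E1 : fp 0 j = half_flux phi c (u_init u0 dx j) by rewrite f_plusE.
  have E2 : fm 0 j = half_flux phi (- c) (u_init u0 dx j) by rewrite f_minusE.
  have h1 := mono _ _ subchar_pos (u0_init j); have h2 := mono _ _ subchar_neg (u0_init j).
  by rewrite E1 E2; split => //; exact: u0_init.
have h1 : half_flux phi c a <= fp n.+1 j <= half_flux phi c b.
  rewrite -(subrK 1 j) f_plus_step; have [h _ hu] := IH (j - 1).
  exact: cvx h (mono _ _ subchar_pos hu).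
have h2 : half_flux phi (- c) a <= fm n.+1 j <= half_flux phi (- c) b.
  rewrite -(addrK 1 j) f_minus_step; have [_ h hu] := IH (j + 1).
  exact: cvx h (mono _ _ subchar_neg hu).
by split => //; exact: sum.
Qed.

Lemma a_le_b : a <= b.
Proof. by have /andP[h1 h2] := u0_init 0; exact: le_trans h1 h2. Qed.

Variables (eta q : R -> R).
Hypothesis pair : entropy_pair phi eta q.

Definition scheme_entropy_plus n j := kin_entropy phi eta q a b c (fp n j).
Definition scheme_entropy_minus n j := kin_entropy phi eta q a b (- c) (fm n j).

Local Notation A := scheme_entropy_plus.
Local Notation B := scheme_entropy_minus.

Lemma scheme_entropy_step n j : A n.+1 (j + 1) + B n.+1 (j - 1) <= A n j + B n j.
Proof.
rewrite /scheme_entropy_plus /scheme_entropy_minus f_plus_step f_minus_step -(f_sum (st n) j).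
apply: (kin_entropy_relax Cphi pair a_le_b) => //.
- exact: subchar_pos.
- exact: subchar_neg.
- by rewrite f_sum; have [] := scheme_invariant n j.
Qed.

Definition grid_fun (X : nat -> int -> R) (p : R * R) : R :=
  X (Num.truncn (p.1 / dt lambda dx)) (Num.floor (p.2 / dx)).

Lemma measurable_grid_fun X : measurable_fun setT (grid_fun X).
Proof.
(* [truncn] is [floor] with negative values sent to 0. *)
pose G i j := X (if i is Posz n then n else 0%N) j.
have := measurable_step2 G (dt lambda dx)^-1 dx^-1.
by congr measurable_fun; apply/funext => p; rewrite /grid_fun /G truncEfloor.
Qed.

Lemma bmeas_grid_fun X C : (forall n j, `|X n j| <= C) -> bmeas (grid_fun X).
Proof. by move=> XC; split; [exact: measurable_grid_fun|exists C => p; exact: XC]. Qed.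

Lemma dt0 : 0 < dt lambda dx. Proof. by rewrite divr_gt0. Qed.

(** Moving the point by one time step and one cell shifts the indices. At negative times [truncn] is
    constant, whence the condition on p.1. *)
Lemma grid_fun_shift X (p : R * R) : 0 <= p.1 ->
  grid_fun X (p + (dt lambda dx, dx)) = grid_fun (fun n j => X n.+1 (j + 1)) p /\
  grid_fun X (p + (dt lambda dx, - dx)) = grid_fun (fun n j => X n.+1 (j - 1)) p.
Proof.
move=> p0; rewrite /grid_fun /=.
have -> : Num.truncn ((p.1 + dt lambda dx) / dt lambda dx) = (Num.truncn (p.1 / dt lambda dx)).+1.
  apply: truncn_def; rewrite mulrDl divff ?gt_eqF ?dt0//.
  have := truncn_itv (divr_ge0 p0 (ltW dt0)).
  by rewrite -!natr1 => /andP[h1 h2]; rewrite lerD2r h1/= ltrD2r.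
rewrite mulrDl divff ?gt_eqF// floorDrz ?rpred1// floor1; split => //.
by rewrite mulrDl mulNr divff ?gt_eqF// floorDrz ?rpredN ?rpred1// floorN ?rpred1// floor1.
Qed.

Lemma bmeas_scheme_entropy : bmeas (grid_fun A) /\ bmeas (grid_fun B).
Proof.
have [C HC] := kin_entropy_bounded Cphi pair a_le_b c.
have [C' HC'] := kin_entropy_bounded Cphi pair a_le_b (- c).
by split; [apply: (bmeas_grid_fun (C := C)) => n j; apply: HC|apply: (bmeas_grid_fun (C := C')) => n j; apply: HC'];
  have [] := scheme_invariant n j.
Qed.

(** Summation by parts in the form of translation invariance of the plane measure: the cellwise
    inequality is integrated against psi, and the shifts by (dt, dx) and (dt, - dx) are moved onto
    psi. At negative times psi vanishes. *)
Lemma scheme_entropy_ineq (psi : R * R -> R) (t0 N : R) : smooth2 psi -> 0 < t0 -> late t0 psi ->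
  supp_square N psi -> (forall p, 0 <= psi p) ->
  0 <= \int[leb2]_p (grid_fun A p * (psi p - psi (p - (dt lambda dx, dx))) +
                     grid_fun B p * (psi p - psi (p - (dt lambda dx, - dx)))).
Proof.
move=> spsi t00 la Np psi0; have [bA bB] := bmeas_scheme_entropy.
have Tpsi := smooth2_tame spsi Np; have bpsi := smooth2_bmeas spsi Np.
set v := (dt lambda dx, dx); set v' := (dt lambda dx, - dx).
have shift (g : R * R -> R) (w : R * R) : bmeas g ->
    [/\ tame leb2 (fun p => g p * psi (p - w)), tame leb2 (fun p => g (p + w) * psi p) &
    \int[leb2]_p (g (p + w) * psi p) = \int[leb2]_p (g p * psi (p - w))].
  move=> bg; have [sS _ _] := smooth2_shift w spsi.
  have NS : supp_square (N + (`|w.1| + `|w.2|)) (fun p => psi (p - w)) := supp_square_shift (w := w) Np.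
  have T1 : tame leb2 (fun p => g p * psi (p - w)).
    by apply: tameMr => //; exact: (smooth2_tame sS NS).
  have bgw : bmeas (fun p : R * R => g (p + w)).
    have [mg [C gC]] := bg; split; last by exists C => p; exact: gC.
    apply: (measurableT_comp mg); apply: measurable_fun_pair.
      by apply: measurable_funD; [exact: measurable_fst|exact: measurable_cst].
    by apply: measurable_funD; [exact: measurable_snd|exact: measurable_cst].
  split => //; first by apply: tameMr.
  have bgS : bmeas (fun p => g p * psi (p - w)) by apply: bmeasM => //; exact: (smooth2_bmeas sS NS).
  have NgS : supp_square (N + (`|w.1| + `|w.2|)) (fun p => g p * psi (p - w)) by move=> p /NS ->; rewrite mulr0.
  rewrite -[RHS](leb2_Rint_shift w bgS NgS).
  by apply: eq_Rintegral => p _; rewrite addrK.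
have [TA TA' EA] := shift _ v bA; have [TB TB' EB] := shift _ v' bB.
have TAp : tame leb2 (fun p => grid_fun A p * psi p) by apply: tameMr.
have TBp : tame leb2 (fun p => grid_fun B p * psi p) by apply: tameMr.
have -> : \int[leb2]_p (grid_fun A p * (psi p - psi (p - v)) + grid_fun B p * (psi p - psi (p - v'))) =
  \int[leb2]_p ((grid_fun A p * psi p + grid_fun B p * psi p) - (grid_fun A (p + v) * psi p + grid_fun B (p + v') * psi p)).
  rewrite (tame_RintB (tameD TAp TBp) (tameD TA' TB')) (tame_RintD TA' TB') EA EB.
  rewrite -(tame_RintD TA TB) -(tame_RintB (tameD TAp TBp) (tameD TA TB)).
  by apply: eq_Rintegral => p _; ring.
apply: Rintegral_ge0 => p _.
have [p0|p0] := ltP p.1 0; first by rewrite la ?mulr0 ?addr0 ?subrr// ltW// (lt_trans p0).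
have [EA' _] := grid_fun_shift A p0; have [_ EB'] := grid_fun_shift B p0.
rewrite subr_ge0 -!mulrDl ler_wpM2r// EA' EB' /grid_fun.
exact: scheme_entropy_step.
Qed.

End Scheme.

(** * Passage to the limit in the entropy inequality *)

Section EntropyLimit.
Context {R : realType}.
Notation H := (@halfplane R).

Lemma smooth2_taylor (psi : R * R -> R) (N : R) : smooth2 psi -> supp_square N psi ->
  exists2 B, 0 < B & forall p h : R * R,
    `|psi p - psi (p - h) - (h.1 * partial_t psi p + h.2 * partial_x psi p)| <=
    B * (`|h.1| + `|h.2|) ^+ 2.
Proof.
move=> spsi Np; have [Npt Npx] := supp_square_partial Np.
have [Bt Bt0 HBt] := smooth2_lipschitz (smooth2_partial_t spsi) Npt.
have [Bx Bx0 HBx] := smooth2_lipschitz (smooth2_partial_x spsi) Npx.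
exists (Bt + Bx); first exact: addr_gt0.
move=> [t x] [h k] /=.
have [c1 [c1l c1r E1]] := is_derive_mvtW (t - h) t (fun t => smooth2_is_derive_t x t spsi).
have [c2 [c2l c2r E2]] := is_derive_mvtW (x - k) x (fun x => smooth2_is_derive_x (t - h) x spsi).
have near (y z w : R) : Num.min (y - z) y <= w -> w <= Num.max (y - z) y -> `|w - y| <= `|z|.
  rewrite ge_min le_max ler_norml; have := ler_norm z; have := ler_norm (- z); rewrite normrN.
  by move=> h1 h2 /orP[] ? /orP[] ?; apply/andP; split; lra.
have d1 := near _ _ _ c1l c1r; have d2 := near _ _ _ c2l c2r.
rewrite (_ : psi (t, x) - psi ((t, x) - (h, k)) - _ =
  (partial_t psi (c1, x) - partial_t psi (t, x)) * h + (partial_x psi (t - h, c2) - partial_x psi (t, x)) * k); last first.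
  have -> : psi ((t, x) - (h, k)) = psi (t - h, x - k) by [].
  have E1' : psi (t, x) - psi (t - h, x) = partial_t psi (c1, x) * h by rewrite E1; ring.
  have E2' : psi (t - h, x) - psi (t - h, x - k) = partial_x psi (t - h, c2) * k by rewrite E2; ring.
  rewrite (_ : psi (t, x) - _ = (psi (t, x) - psi (t - h, x)) + (psi (t - h, x) - psi (t - h, x - k))); last by ring.
  by rewrite E1' E2'; ring.
have S0 : `|h| <= `|h| + `|k| by rewrite lerDl.
have S1 : `|k| <= `|h| + `|k| by rewrite lerDr.
have S2 : 0 <= `|h| + `|k| by rewrite addr_ge0.
rewrite (le_trans (ler_normD _ _))// !normrM mulrDl expr2; apply: lerD; rewrite mulrA; apply: ler_pM => //.
  apply: (le_trans (HBt _ _)); apply: ler_wpM2l; first exact: ltW.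
  rewrite /= subrr normr0 addr0; exact: le_trans d1 S0.
apply: (le_trans (HBx _ _)); apply: ler_wpM2l; first exact: ltW.
have -> : ((t - h, c2).1 - (t, x).1) = - h by rewrite /=; ring.
by rewrite normrN lerD2l.
Qed.

(** The function 1 / t is continuous on the compact support, hence bounded there. *)
Lemma csupp_late (psi : R * R -> R) : csupp_in (`]0, +oo[ `*` setT : set (R * R)) psi ->
  exists2 t0 : R, 0 < t0 & late t0 psi.
Proof.
move=> [cs sub].
have pos p : supp psi p -> 0 < p.1 by move=> /sub[/=]; rewrite in_itv/= andbT.
have /compact_bounded[M [Mr HM]] : compact ((fun p : R * R => p.1^-1) @` supp psi).
  apply: continuous_compact => //; apply: continuous_in_subspaceT => p /set_mem /pos p0.
  by apply: cvgV; [rewrite gt_eqF|exact: cvg_fst].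
exists ((`|M| + 2)^-1); first by rewrite invr_gt0 ltr_wpDl.
move=> p pt; apply: contrapT => /eqP np.
have sp : supp psi p by apply: subset_closure.
have p0 := pos p sp; have : `|p.1^-1| <= `|M| + 1.
  by apply: (HM (`|M| + 1)); [rewrite (le_lt_trans (ler_norm M))// ltrDl|exists p].
rewrite gtr0_norm ?invr_gt0// leNgt => /negP; apply.
have M2 : 0 < `|M| + 2 by rewrite ltr_wpDl.
apply: (@lt_le_trans _ _ (`|M| + 2)); first by rewrite ltrD2l ltr1n.
by rewrite -[leLHS]invrK lef_pV2// posrE invr_gt0.
Qed.

Definition half_square (N : R) : set (R * R) := `[0, N] `*` `[- N, N].

Lemma half_square_sub N : half_square N `<=` H.
Proof. by move=> p [/= + _]; rewrite !in_itv/= => /andP[p0 _]; split => //=; rewrite in_itv/= p0. Qed.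

Lemma half_square_square N : half_square N `<=` square N.
Proof.
move=> p [/=]; rewrite !in_itv/= => /andP[p0 pN] h; split; rewrite /= in_itv//= pN andbT.
by rewrite (le_trans _ p0)// oppr_le0 (le_trans p0).
Qed.

Lemma measurable_half_square N : measurable (half_square N).
Proof. by apply: measurableX; exact: measurable_itv. Qed.

Lemma compact_half_square N : compact (half_square N).
Proof. by apply: compact_setX; exact: segment_compact. Qed.

Lemma tame_half_square N : tame leb2 (\1_(half_square N) : R * R -> R).
Proof.
apply: tame_indic; first exact: measurable_half_square.
apply: le_lt_trans (leb2_square_lty N); apply: le_measure; rewrite ?inE.
- exact: measurable_half_square.
- exact: measurable_square.
- exact: half_square_square.
Qed.

Lemma half_square_Rint (f : R * R -> R) N : bmeas f ->
  (\int[leb2]_(p in half_square N) (f p)%:E = (\int[leb2]_p (\1_(half_square N) p * f p))%:E)%E.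
Proof.
move=> bf; rewrite -tame_EFin_Rint; last by apply: tameM => //; exact: tame_half_square.
rewrite [LHS]integral_mkcond; congr (integral _ _ _); apply/funext => p; rewrite patchE indicE.
by case: ifPn => _; rewrite ?mul1r ?mul0r.
Qed.

Lemma clamp_dist (a b x y : R) : a <= y <= b ->
  `|y - Num.max a (Num.min b x)| <= `|y - x| /\ `|x - Num.max a (Num.min b x)| <= `|y - x|.
Proof.
move=> /andP[ay yb]; have ab := le_trans ay yb.
have [bx|xb] := leP b x.
  rewrite max_r// !(distrC y) !ger0_norm ?subr_ge0//; [lra|exact: le_trans bx].
have [ax|xa] := leP a x; first by rewrite subrr normr0.
by rewrite (distrC x) !ger0_norm ?subr_ge0 ?(ltW xa)//; [lra|exact: le_trans (ltW xa) ay].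
Qed.

Variables (phi u0 : R -> R) (a b s lambda : R) (dx : nat -> R) (u : R * R -> R).
Hypothesis Cphi : C1 phi.
Hypothesis lambda0 : 0 < lambda.
Hypothesis s01 : 0 <= s <= 1.
Hypothesis phi_lambda : forall k, a <= k <= b -> `|derive1 phi k| <= lambda.
Hypothesis dx0 : forall k, 0 < dx k.
Hypothesis dx_cvg : dx @ \oo --> 0.
Hypothesis u0_init : forall k j, a <= u_init u0 (dx k) j <= b.
Hypothesis mu : measurable_fun H u.
Hypothesis ucvg : cvg_L1loc H (fun k => u_approx phi u0 s lambda (dx k)) u.
Hypothesis vcvg : cvg_L1loc H (fun k => v_approx phi u0 s lambda (dx k)) (phi \o u).

Notation uk k := (u_approx phi u0 s lambda (dx k)).
Notation vk k := (v_approx phi u0 s lambda (dx k)).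

(** phi' is controlled by lambda on [a, b], so the limit is replaced by a version with values in
    [a, b] at every point. *)
Definition clamped (p : R * R) : R := Num.max a (Num.min b ((u \_ H) p)).
Notation U := clamped.

Let ab : a <= b. Proof. exact: a_le_b (u0_init 0). Qed.

Lemma clamped_itv p : a <= U p <= b.
Proof. by rewrite /clamped le_max lexx/= ge_max ab ge_min lexx. Qed.

Lemma measurable_clamped : measurable_fun setT U.
Proof.
apply: measurable_maxr; first exact: measurable_cst.
apply: measurable_minr; first exact: measurable_cst.
exact: (measurable_restrictT u measurable_halfplane).1 mu.
Qed.

Let bounded_ab x : a <= x <= b -> `|x| <= `|a| + `|b|.
Proof.
have := ler_norm b; have := ler_norm (- a); have := normr_ge0 a; have := normr_ge0 b.
by rewrite normrN ler_norml; lra.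
Qed.

Let bU : bmeas U.
Proof. by split; [exact: measurable_clamped|exists (`|a| + `|b|) => p; exact/bounded_ab/clamped_itv]. Qed.

Lemma u_approx_itv k p : a <= uk k p <= b.
Proof. by have [] := scheme_invariant Cphi lambda0 s01 phi_lambda (u0_init k) (Num.truncn (p.1 / dt lambda (dx k))) (Num.floor (p.2 / dx k)). Qed.

Let buk k : bmeas (uk k).
Proof.
apply: (bmeas_grid_fun lambda (dx k) (X := fun n j => (d1q2 phi u0 s lambda (dx k) n).1 j) (C := `|a| + `|b|)) => n j.
by apply: bounded_ab; have [] := scheme_invariant Cphi lambda0 s01 phi_lambda (u0_init k) n j.
Qed.

Let bvk k : bmeas (vk k).
Proof.
set ha := fun c => `|half_flux phi c a| + `|half_flux phi c b|.
apply: (bmeas_grid_fun lambda (dx k) (X := fun n j => (d1q2 phi u0 s lambda (dx k) n).2 j)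
  (C := lambda * (ha lambda^-1 + ha (- lambda^-1)))) => n j.
have [h1 h2 _] := scheme_invariant Cphi lambda0 s01 phi_lambda (u0_init k) n j.
have gen c x : half_flux phi c a <= x <= half_flux phi c b -> `|x| <= ha c.
  rewrite /ha; have := ler_norm (half_flux phi c b); have := ler_norm (- half_flux phi c a).
  have := normr_ge0 (half_flux phi c a); have := normr_ge0 (half_flux phi c b).
  by rewrite normrN ler_norml; lra.
have g1 := gen _ _ h1; have g2 := gen _ _ h2.
set st := d1q2 _ _ _ _ _ _ in h1 h2 g1 g2 *.
have -> : st.2 j = lambda * (f_plus lambda st j - f_minus lambda st j).
  by rewrite /f_plus /f_minus; field; rewrite gt_eqF.
by rewrite normrM gtr0_norm// ler_pM2l// (le_trans (ler_normB _ _))// lerD.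
Qed.

Let mK N : measurable (half_square N). Proof. exact: measurable_half_square. Qed.

Let muK N : measurable_fun (half_square N) u.
Proof. exact: measurable_funS measurable_halfplane (@half_square_sub N) mu. Qed.

Let dist_le k N (f : R * R -> R) : measurable_fun (half_square N) f ->
  (forall p, half_square N p -> `|f p| <= `|uk k p - u p|) ->
  (\int[leb2]_(p in half_square N) `|f p|%:E <= \int[leb2]_(p in half_square N) `|uk k p - u p|%:E)%E.
Proof.
move=> mf fu; apply: ge0_le_integral => //.
- exact: mK.
- by apply/measurable_EFinP; exact: measurableT_comp.
- apply/measurable_EFinP; apply: measurableT_comp => //; apply: measurable_funB => //.
    by have [h _] := buk k; exact: measurable_funS h.
  exact: muK.
Qed.

Let UE p : H p -> U p = Num.max a (Num.min b (u p)).
Proof. by move=> Hp; rewrite /clamped patchE mem_set. Qed.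

(** Clamping is the projection onto [a, b], which contains the values of the approximations. Hence
    |u - U| is at most the distance from u to each approximation, whose integral over a half square
    tends to 0. *)
Lemma clamped_ae : {ae leb2, forall p, H p -> U p = u p}.
Proof.
have mUK N : measurable_fun (half_square N) U by apply: measurable_funS measurable_clamped.
have A0 (N : nat) : {ae leb2, forall p, half_square (N%:R : R) p -> u p - U p = 0}.
  have mf : measurable_fun (half_square (N%:R : R)) (fun p => u p - U p) by exact: measurable_funB.
  have E : (\int[leb2]_(p in half_square N%:R) `|(EFin \o (fun p => u p - U p)%R) p| = 0)%E.
    apply/eqP; rewrite eq_le integral_ge0 ?andbT//.
    have cv := ucvg (@half_square_sub N%:R) (@compact_half_square N%:R).
    apply: (cvge_to_ge cv); apply: nearW => k; apply: dist_le => // p pK.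
    rewrite UE; last exact: half_square_sub pK.
    by have [] := clamp_dist (u p) (u_approx_itv k p).
  have /(ae_eq_integral_abs leb2 (mK N%:R))[/(_ E) + _] : measurable_fun (half_square (N%:R : R)) (EFin \o (fun p => u p - U p)%R).
    exact/measurable_EFinP.
  move=> [A [mA A0 sA]]; exists A; split => // p /= np; apply: sA => /= h; apply: np => pN.
  by have [] := h pN.
have [A [mA A00 sA]] : {ae leb2, forall p, forall N : nat, half_square (N%:R : R) p -> u p - U p = 0}.
  exact: ae_foralln.
exists A; split => // p /= np; apply: sA => /= h; apply: np => Hp.
apply/esym/eqP; rewrite -subr_eq0; apply/eqP; apply: (h (Num.bound (`|p.1| + `|p.2|))).
have := archi_boundP (addr_ge0 (normr_ge0 p.1) (normr_ge0 p.2)) => /ltW g.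
have g1 : `|p.1| <= (Num.bound (`|p.1| + `|p.2|))%:R by rewrite (le_trans _ g)// lerDl.
have g2 : `|p.2| <= (Num.bound (`|p.1| + `|p.2|))%:R by rewrite (le_trans _ g)// lerDr.
have [/= + _] := Hp; rewrite in_itv/= andbT => p0.
by split; rewrite /= in_itv/= -?ler_norml// p0 (le_trans (ler_norm _)).
Qed.

Let cphi : continuous phi. Proof. exact: C1_continuous. Qed.

Let bphiU : bmeas (fun p => phi (U p)).
Proof.
have [L L0 HL] := C1_bounded (`|a| + `|b|) Cphi; have lip := C1_lip_on Cphi HL.
split; first exact: (measurableT_comp (continuous_measurable_fun cphi) measurable_clamped).
exists (`|phi a| + L * (`|a| + `|b| + `|a|)) => p.
rewrite -{1}(subrK (phi a) (phi (U p))) addrC (le_trans (ler_normD _ _))// lerD2l.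
have h1 := bounded_ab (clamped_itv p); have h2 : `|a| <= `|a| + `|b| by rewrite lerDl.
by rewrite (le_trans (lip _ _ h1 h2))// ler_wpM2l// (le_trans (ler_normB _ _))// lerD.
Qed.

Let cvg_half_square (f_ : nat -> R * R -> R) N : (forall k, bmeas (f_ k)) ->
  (\int[leb2]_(p in half_square N) (f_ k p)%:E)%E @[k --> \oo] --> 0%E ->
  \int[leb2]_p (\1_(half_square N) p * f_ k p) @[k --> \oo] --> 0.
Proof.
move=> bf; rewrite (_ : (fun k => _) = (fun k => (\int[leb2]_p (\1_(half_square N) p * f_ k p))%:E)).
  by move=> /fine_cvgP[_].
by apply/funext => k; exact: half_square_Rint.
Qed.

Lemma u_approx_cvg N : \int[leb2]_p (\1_(half_square N) p * `|uk k p - U p|) @[k --> \oo] --> 0.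
Proof.
apply: (@cvg_half_square (fun k p => `|uk k p - U p|)).
  by move=> k; apply/bmeas_norm/bmeasB.
have cv := ucvg (@half_square_sub N) (@compact_half_square N).
apply: (squeeze_cvge _ (cvg_cst 0%E) cv); apply: nearW => k.
rewrite integral_ge0//=; apply: dist_le.
  apply: measurable_funS (measurableT) _ _ => //.
  by have [] : bmeas (fun p => uk k p - U p) by exact: bmeasB.
move=> p pK; rewrite UE; last exact: half_square_sub pK.
by have [] := clamp_dist (u p) (u_approx_itv k p).
Qed.

Lemma v_approx_cvg N : \int[leb2]_p (\1_(half_square N) p * `|vk k p - phi (U p)|) @[k --> \oo] --> 0.
Proof.
apply: (@cvg_half_square (fun k p => `|vk k p - phi (U p)|)).
  by move=> k; apply/bmeas_norm/bmeasB.
have cv := vcvg (@half_square_sub N) (@compact_half_square N).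
rewrite (_ : (fun k => _) = (fun k => (\int[leb2]_(p in half_square N) `|vk k p - (phi \o u) p|%:E)%E))//.
apply/funext => k; have [mv _] := bvk k; have [mp _] := bphiU.
apply: ae_eq_integral => //.
- exact: mK.
- apply/measurable_EFinP; apply: measurableT_comp => //; apply: measurable_funB.
    exact: measurable_funS mv.
  exact: measurable_funS mp.
- apply/measurable_EFinP; apply: measurableT_comp => //; apply: measurable_funB.
    exact: measurable_funS mv.
  by apply: (measurableT_comp (continuous_measurable_fun cphi)); exact: muK.
- have [A [mA A0 sA]] := clamped_ae; exists A; split => // p /= np; apply: sA => /= h; apply: np => pK.
  by rewrite h//; exact: half_square_sub pK.
Qed.

Lemma entropy_limit (eta q : R -> R) (psi : R * R -> R) : entropy_pair phi eta q ->
  smooth2 psi -> csupp_in (`]0, +oo[ `*` setT : set (R * R)) psi -> (forall p, 0 <= psi p) ->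
  0 <= \int[leb2]_(p in H) (eta (u p) * partial_t psi p + q (u p) * partial_x psi p).
Proof.
move=> pair spsi csup psi0; have [t0 t00 la] := csupp_late csup.
have [N N0 Np] := compact_supp_square csup.1.
have [Npt Npx] := supp_square_partial Np.
have [spt spx] := (smooth2_partial_t spsi, smooth2_partial_x spsi).
have [Tt Tx] := (smooth2_tame spt Npt, smooth2_tame spx Npx).
have ceta : continuous eta by have [[Ceta _] _ _ _] := pair; exact: C1_continuous.
have cq : continuous q.
  by have [_ _ D _] := pair; move=> x; apply: differentiable_continuous; exact/derivable1_diffP.
rewrite (Rint_halfplane (a := partial_t psi) (b := partial_x psi) mu measurable_clamped clamped_ae ceta cq); last 2 first.
- exact: (tame_measurable Tt).
- exact: (tame_measurable Tx).
have -> : \int[leb2]_p (\1_H p * (eta (U p) * partial_t psi p + q (U p) * partial_x psi p)) =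
      \int[leb2]_p (eta (U p) * partial_t psi p + q (U p) * partial_x psi p).
    apply: eq_Rintegral => p _; have [p0|p0] := ltP p.1 0.
      by have [-> ->] := late_partial la (lt_trans p0 t00); rewrite !mulr0 addr0 mulr0.
    by rewrite indicE mem_set ?mul1r//=; split => //=; rewrite in_itv/= p0.
set X := \int[leb2]_p _.
pose c := lambda^-1; have c0 : 0 < c by rewrite invr_gt0.
have sp := subchar_pos lambda0 phi_lambda; have sn := subchar_neg lambda0 phi_lambda.
have [L L0 HL] := deta_bounded a b pair.
have [CA HCA] := kin_entropy_bounded Cphi pair ab c.
have [CB HCB] := kin_entropy_bounded Cphi pair ab (- c).
have [B B0 HB] := smooth2_taylor spsi Np.
have [Ct Ct0 HCt] := smooth2_bounded spt Npt; have [Cx Cx0 HCx] := smooth2_bounded spx Npx.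
(* [al] and [be] are the derivatives of psi along the particle velocities lambda and - lambda. The
   increments of psi along (tau, dx) and (tau, - dx) are tau * al and tau * be up to O(tau ^ 2). *)
pose al p := partial_t psi p + lambda * partial_x psi p.
pose be p := partial_t psi p - lambda * partial_x psi p.
pose Cab := Ct + lambda * Cx.
have Cab0 : 0 <= Cab by rewrite addr_ge0 ?mulr_ge0// ltW.
have alC p : `|al p| <= Cab.
  by rewrite (le_trans (ler_normD _ _))// lerD// normrM gtr0_norm// ler_pM2l.
have beC p : `|be p| <= Cab.
  by rewrite (le_trans (ler_normB _ _))// lerD// normrM gtr0_norm// ler_pM2l.
have Tal : tame leb2 al := tameD Tt (tameZ lambda Tx).
have Tbe : tame leb2 be := tameB Tt (tameZ lambda Tx).
(* Both steps will be at most 1, so the increments of psi are supported in [square (N + 1)]. *)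
pose V := fine (leb2 (square (N + 1) : set (R * R))).
have V0 : 0 <= V by exact: fine_ge0.
have TQ : tame leb2 (\1_(square (N + 1)) : R * R -> R).
  by apply: tame_indic; [exact: measurable_square|exact: leb2_square_lty].
pose D1 := L * (2^-1 + 2^-1 * c) * (Cab + Cab).
have D10 : 0 <= D1.
  apply: (mulr_ge0 (mulr_ge0 L0 _) (addr_ge0 Cab0 Cab0)).
  by rewrite addr_ge0 ?mulr_ge0 ?invr_ge0// ltW.
pose D2 := (`|CA| + `|CB|) * (B * (1 + lambda) ^+ 2) * V.
pose EU k := \int[leb2]_p (\1_(half_square N) p * `|uk k p - U p|).
pose EV k := \int[leb2]_p (\1_(half_square N) p * `|vk k p - phi (U p)|).
have TK := tame_half_square N.
have key k : dx k <= 1 -> dt lambda (dx k) <= 1 -> - X <= D1 * (EU k + EV k) + D2 * dt lambda (dx k).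
  move=> dx1 dt1; set tau := dt lambda (dx k).
  have tau0 : 0 < tau := dt0 lambda0 (dx0 k).
  have dxE : dx k = lambda * tau by rewrite /tau /dt mulrC divfK// gt_eqF.
  pose A := grid_fun lambda (dx k) (scheme_entropy_plus phi u0 a b s lambda (dx k) eta q).
  pose A' := grid_fun lambda (dx k) (scheme_entropy_minus phi u0 a b s lambda (dx k) eta q).
  have [bA bA'] : bmeas A /\ bmeas A' := bmeas_scheme_entropy Cphi lambda0 s01 phi_lambda (u0_init k) pair.
  have ineq : 0 <= \int[leb2]_p (A p * (psi p - psi (p - (tau, dx k))) + A' p * (psi p - psi (p - (tau, - dx k)))).
    exact: (scheme_entropy_ineq Cphi lambda0 s01 phi_lambda (dx0 k) (u0_init k) pair spsi t00 la Np psi0).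
  have inv p := scheme_invariant Cphi lambda0 s01 phi_lambda (u0_init k) (Num.truncn (p.1 / dt lambda (dx k))) (Num.floor (p.2 / dx k)).
  have AC p : `|A p| <= `|CA|.
    by apply: le_trans (ler_norm _); apply: HCA; have [] := inv p.
  have A'C p : `|A' p| <= `|CB|.
    by apply: le_trans (ler_norm _); apply: HCB; have [] := inv p.
  have tay (h : R) p : `|h| = dx k -> `|psi p - psi (p - (tau, h)) - (tau * partial_t psi p + h * partial_x psi p)| <=
      B * (1 + lambda) ^+ 2 * tau ^+ 2 * \1_(square (N + 1)) p.
    move=> hd; rewrite indicE; have [/set_mem pQ|/negP pQ] := boolP (p \in _).
      rewrite mulr1 (le_trans (HB p (tau, h)))//= hd (gtr0_norm tau0) dxE.
      have -> : tau + lambda * tau = (1 + lambda) * tau by ring.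
      by rewrite exprMn mulrA.
    have nQ : ~ square (N + 1) p by move=> h'; apply/pQ/mem_set.
    have nN : ~ square N p.
      apply: contra_not nQ => /squareP[h1 h2]; apply/squareP; split; [apply: le_trans h1 _|apply: le_trans h2 _]; by rewrite lerDl.
    have nS : ~ square N (p - (tau, h)).
      apply: contra_not nQ => /squareP[/= h1 h2]; apply/squareP; split.
        by rewrite -(subrK tau p.1) (le_trans (ler_normD _ _))// lerD// gtr0_norm.
      by rewrite -(subrK h p.2) (le_trans (ler_normD _ _))// lerD// hd.
    by rewrite mulr0 Npt// Npx// !Np// !mulr0 addr0 !subrr normr0.
  have TAal : tame leb2 (fun p => A p * al p) by apply: tameMr.
  have TAbe : tame leb2 (fun p => A' p * be p) by apply: tameMr.
  have step1 : 0 <= tau * (\int[leb2]_p (A p * al p) + \int[leb2]_p (A' p * be p)) + tau * (D2 * tau).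
    have TS (w : R * R) : tame leb2 (fun p => psi p - psi (p - w)).
      have [sS _ _] := smooth2_shift w spsi.
      have NS : supp_square (N + (`|w.1| + `|w.2|)) (fun p => psi (p - w)) := supp_square_shift (w := w) Np.
      by apply: tameB; [exact: (smooth2_tame spsi Np)|exact: (smooth2_tame sS NS)].
    have TL : tame leb2 (fun p => A p * (psi p - psi (p - (tau, dx k))) + A' p * (psi p - psi (p - (tau, - dx k)))).
      by apply: tameD; apply: tameMr => //; exact: TS.
    have TR := tameD (tameZ tau (tameD TAal TAbe)) (tameZ ((`|CA| + `|CB|) * (B * (1 + lambda) ^+ 2 * tau ^+ 2)) TQ).
    have := le_trans ineq (tame_le_Rint TL TR _).
    rewrite (tame_RintD (tameZ tau (tameD TAal TAbe)) (tameZ ((`|CA| + `|CB|) * (B * (1 + lambda) ^+ 2 * tau ^+ 2)) TQ)).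
    rewrite (tame_RintZ _ (tameD TAal TAbe)) (tame_RintD TAal TAbe) (tame_RintZ _ TQ) Rint_indic; last exact: measurable_square.
    rewrite (_ : (`|CA| + `|CB|) * (B * (1 + lambda) ^+ 2 * tau ^+ 2) * fine _ = tau * (D2 * tau)); last by rewrite /D2 /V; ring.
    apply => p.
    have t1 := tay (dx k) p (gtr0_norm (dx0 k)).
    have t2 := tay (- dx k) p (etrans (normrN _) (gtr0_norm (dx0 k))).
    rewrite -subr_ge0 [leRHS](_ : _ = (`|CA| * (B * (1 + lambda) ^+ 2 * tau ^+ 2 * \1_(square (N + 1)) p) -
        A p * (psi p - psi (p - (tau, dx k)) - (tau * partial_t psi p + dx k * partial_x psi p))) +
       (`|CB| * (B * (1 + lambda) ^+ 2 * tau ^+ 2 * \1_(square (N + 1)) p) -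
        A' p * (psi p - psi (p - (tau, - dx k)) - (tau * partial_t psi p + - dx k * partial_x psi p)))); last first.
      by rewrite /al /be dxE; ring.
    by apply: addr_ge0; rewrite subr_ge0 (le_trans (ler_norm _))// normrM ler_pM.
  have step2 : 0 <= (\int[leb2]_p (A p * al p) + \int[leb2]_p (A' p * be p)) + D2 * tau.
    by move: step1; rewrite -mulrDr pmulr_rge0.
  have TU : tame leb2 (fun p => \1_(half_square N) p * `|uk k p - U p|).
    by apply: tameM; [exact: TK|apply/bmeas_norm/bmeasB; [exact: buk|exact: bU]].
  have TV : tame leb2 (fun p => \1_(half_square N) p * `|vk k p - phi (U p)|).
    by apply: tameM; [exact: TK|apply/bmeas_norm/bmeasB; [exact: bvk|exact: bphiU]].
  have bg (g : R -> R) : continuous g -> bmeas (fun p => g (U p)).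
    move=> cg; have /compact_bounded[M [Mr HM]] : compact (g @` `[a, b]).
      apply: continuous_compact; last exact: segment_compact.
      exact: continuous_subspaceT.
    split; first exact: (measurableT_comp (continuous_measurable_fun cg) measurable_clamped).
    exists (`|M| + 1) => p; apply: (HM (`|M| + 1)); first by rewrite (le_lt_trans (ler_norm M))// ltrDl.
    by exists (U p) => //=; rewrite in_itv/= clamped_itv.
  have TX : tame leb2 (fun p => eta (U p) * partial_t psi p + q (U p) * partial_x psi p).
    by apply: tameD; apply: tameMr; [exact: bg|exact: Tt|exact: bg|exact: Tx].
  have TD := tameZ D1 (tameD TU TV).
  (* The kinetic entropies are compared with their values at the equilibria of U. A particle
     distribution differs from such an equilibrium by a combination of u - U and v - phi(U), so the
     convergence of v enters here along with that of u. *)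
  have step3 : \int[leb2]_p (A p * al p) + \int[leb2]_p (A' p * be p) <= X + D1 * (EU k + EV k).
    rewrite -(tame_RintD TAal TAbe) /EU /EV -(tame_RintD TU TV) -(tame_RintZ _ (tameD TU TV)) -(tame_RintD TX TD).
    apply: tame_le_Rint; [exact: tameD|exact: tameD|move=> p].
    have i0 : 0 <= \1_(half_square N) p :> R by rewrite indicE.
    have nnD := mulr_ge0 D10 (addr_ge0 (mulr_ge0 i0 (normr_ge0 (uk k p - U p))) (mulr_ge0 i0 (normr_ge0 (vk k p - phi (U p))))).
    have [p0|p0] := ltP p.1 0.
      have [E1 E2] := late_partial la (lt_trans p0 t00).
      by rewrite /al /be E1 E2 !mulr0 subrr !addr0 !mulr0 !addr0 add0r.
    have [pN|pN] := pselect (square N p); last first.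
      by rewrite /al /be Npt// Npx// !mulr0 subrr !addr0 !mulr0 !addr0 add0r.
    have pK : half_square N p.
      have [/= + h2] := pN; rewrite in_itv/= => /andP[_ h1]; split => //=.
      by rewrite in_itv/= p0.
    rewrite !indicE (mem_set pK) !mul1r.
    have [h1 h2 h3] := inv p.
    have Up := clamped_itv p.
    have lipgen d (f v w : R) : `|d| = c -> f = 2^-1 * w + 2^-1 * d * v ->
       `|kin_entropy phi eta q a b d f - kin_entropy phi eta q a b d (half_flux phi d (U p))| <=
       L * (2^-1 + 2^-1 * c) * (`|w - U p| + `|v - phi (U p)|).
      move=> dc ->; rewrite (le_trans (kin_entropy_lip Cphi pair ab _ _ _ HL))// -[leRHS]mulrA; apply: ler_wpM2l => //.
      rewrite /half_flux (_ : _ - _ = 2^-1 * (w - U p) + 2^-1 * d * (v - phi (U p))); last by ring.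
      rewrite (le_trans (ler_normD _ _))// !normrM dc (ger0_norm (_ : 0 <= 2^-1 :> R)) ?invr_ge0//.
      rewrite -subr_ge0 [leRHS](_ : _ = 2^-1 * `|v - phi (U p)| + 2^-1 * c * `|w - U p|); last by ring.
      by rewrite addr_ge0 ?mulr_ge0 ?invr_ge0// ltW.
    have l1 : `|A p - half_entropy eta q c (U p)| <= L * (2^-1 + 2^-1 * c) * (`|uk k p - U p| + `|vk k p - phi (U p)|).
      rewrite -(kin_entropy_equilibrium Cphi pair ab sp Up); apply: lipgen; first exact: gtr0_norm.
      by rewrite f_plusE.
    have l2 : `|A' p - half_entropy eta q (- c) (U p)| <= L * (2^-1 + 2^-1 * c) * (`|uk k p - U p| + `|vk k p - phi (U p)|).
      rewrite -(kin_entropy_equilibrium Cphi pair ab sn Up); apply: lipgen; first by rewrite normrN; exact: gtr0_norm.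
      by rewrite f_minusE.
    (* Since c * lambda = 1, the two halves recombine into eta and q. *)
    have E : eta (U p) * partial_t psi p + q (U p) * partial_x psi p =
       half_entropy eta q c (U p) * al p + half_entropy eta q (- c) (U p) * be p.
      by rewrite /half_entropy /al /be /c; field; rewrite gt_eqF.
    rewrite E -subr_ge0 [leRHS](_ : _ =
      (L * (2^-1 + 2^-1 * c) * (`|uk k p - U p| + `|vk k p - phi (U p)|) * Cab - (A p - half_entropy eta q c (U p)) * al p) +
      (L * (2^-1 + 2^-1 * c) * (`|uk k p - U p| + `|vk k p - phi (U p)|) * Cab - (A' p - half_entropy eta q (- c) (U p)) * be p)); last first.
      by rewrite /D1; ring.
    by apply: addr_ge0; rewrite subr_ge0 (le_trans (ler_norm _))// normrM ler_pM.
  by rewrite -sub0r lerBlDl addrA; exact: le_trans step2 (lerD step3 (lexx _)).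
have dt_cvg : dt lambda (dx k) @[k --> \oo] --> 0.
  rewrite -[X in _ --> X](mul0r lambda^-1); apply: cvgM; [exact: dx_cvg|exact: cvg_cst].
have cvR : D1 * (EU k + EV k) + D2 * dt lambda (dx k) @[k --> \oo] --> D1 * (0 + 0) + D2 * 0.
  apply: cvgD; apply: cvgM; [exact: cvg_cst| |exact: cvg_cst|exact: dt_cvg].
  by apply: cvgD; [exact: u_approx_cvg|exact: v_approx_cvg].
have tau0 k : 0 < dt lambda (dx k) := dt0 lambda0 (dx0 k).
have : - X <= D1 * (0 + 0) + D2 * 0.
  apply: (cvgr_to_ge cvR); have n1 := cvg0_le dx0 dx_cvg (ltr01 : 0 < 1 :> R).
  have n2 := cvg0_le tau0 dt_cvg (ltr01 : 0 < 1 :> R).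
  by near=> k; apply: key; near: k.
by rewrite addr0 !mulr0 addr0 oppr_le0.
Unshelve. all: by end_near. Qed.

End EntropyLimit.

(** * Slices of a function of bounded variation *)

Section BVSlices.
Context {R : realType}.
Notation mu := (@lebesgue_measure R).
Variable th : R -> R.
Hypothesis sth : smooth1 th.
Hypothesis th0 : forall x, x <= 0 -> th x = 0.
Hypothesis th1 : forall x, 1 <= x -> th x = 1.
Hypothesis dth_ge0 : forall x, 0 <= derive1 th x.

Lemma Rint_kern1_0 e : 0 < e -> \int[mu]_s kern1 th e s = 1.
Proof.
move=> e0.
have -> : \int[mu]_s kern1 th e s = \int[mu]_(s in `[0, e]) kern1 th e s.
  rewrite [RHS]Rintegral_mkcond; apply: eq_Rintegral => s _; rewrite patchE.
  case: ifPn => // /negP ns; apply/eqP; apply/negPn/negP => /(kern1_supp th0 th1 e0) H.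
  by apply: ns; apply/mem_set; rewrite /= in_itv/=.
have D (s : R) := is_derive_step_scale sth e s.
have cth := is_derive_continuous D.
rewrite /Rintegral (@continuous_FTC2 R _ (fun s => th (e^-1 * s)) 0 e e0).
- by rewrite /= mulr0 mulVf ?gt_eqF// (th0 (lexx 0)) (th1 (lexx 1)) subr0.
- exact: (continuous_subspaceT (@continuous_kern1 _ _ sth e)).
- split.
  + by move=> s _; have [] := D s.
  + exact/cvg_at_right_filter/cth.
  + exact/cvg_at_left_filter/cth.
- by move=> s _; rewrite derive1E; have [_ ->] := D s.
Qed.

Lemma Rint_kern2_shift e (q : R * R) : 0 < e -> \int[leb2]_p kern2 th e (p - q) = 1.
Proof.
move=> e0; have sK := smooth2_kern2 sth e; have NK := kern2_supp_square th0 th1 e0.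
have [C C0 HC] := smooth2_bounded sK NK.
have bK : bmeas (kern2 th e).
  by split; [apply: continuous2_measurable; exact: smooth2_continuous|exists C].
rewrite (leb2_Rint_shift (- q) bK NK) leb2_Rint12; last first.
  apply: (tame_prod_supp_square (N := e) (C := C)); first by have [] := bK.
  exact: supp_square_indic.
have T : tame mu (kern1 th e).
  have [B B0 HB] := kern1_bounded sth th0 th1 dth_ge0 e0.
  split; first exact: continuous_measurable_fun (@continuous_kern1 _ _ sth e).
  exists `[0, e]%classic, B; split => //; first exact: lebesgue_itv_lty.
  move=> s; rewrite indicE; have [->|/(kern1_supp th0 th1 e0) H] := eqVneq (kern1 th e s) 0.
    by rewrite normr0 mulr_ge0// ltW.
  by rewrite mem_set ?mulr1//= in_itv/=.
rewrite -[RHS](Rint_kern1_0 e0); apply: eq_Rintegral => x _.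
transitivity (\int[mu]_y (kern1 th e x * kern1 th e y)); first exact: eq_Rintegral.
by rewrite (tame_RintZ _ T) Rint_kern1_0// mulr1.
Qed.

Variables (U : R * R -> R) (C V T : R).
Hypothesis mU : measurable_fun setT U.
Hypothesis UC : forall p, `|U p| <= C.
Hypothesis dual : forall (psi : R * R -> R) t1 t2 N, smooth2 psi -> supp_square N psi ->
  0 < t1 -> t2 < T -> (forall p : R * R, psi p != 0 -> t1 <= p.1 <= t2) -> (forall p, `|psi p| <= 1) ->
  \int[leb2]_p (U p * partial_x psi p) <= V.

Let bU : bmeas U. Proof. by split => //; exists C. Qed.

Let box t1 t2 N : set (R * R) := `[t1, t2] `*` `[- N, N].

Let measurable_box t1 t2 N : measurable (box t1 t2 N).
Proof. by apply: measurableX; exact: measurable_itv. Qed.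

Let box_square t1 t2 N (p : R * R) : 0 < t1 -> t2 <= N -> box t1 t2 N p -> square N p.
Proof.
move=> t10 tN [/=]; rewrite !in_itv/= => /andP[h1 h2] h; split => //=; rewrite in_itv/=.
have p0 := le_trans (ltW t10) h1.
by rewrite (le_trans h2)// andbT (le_trans _ p0)// oppr_le0 (le_trans p0)// (le_trans h2).
Qed.

(* Tests u with the mollification of sgn (d_x u_e) restricted to a box. *)
Lemma mollified_dx_le e t1 t2 N : 0 < e -> e < t1 -> t2 < T -> t2 <= N ->
  \int[leb2]_p (\1_(box t1 t2 N) p * `|partial_x (convol U (kern2 th e)) p|) <= V.
Proof.
move=> e0 et1 t2T t2N; have t10 : 0 < t1 := lt_trans e0 et1.
have sK := smooth2_kern2 sth e; have NK := kern2_supp_square th0 th1 e0.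
have [_ NKx] := supp_square_partial NK; have sKx := smooth2_partial_x sK.
have K0 p : 0 <= kern2 th e p by exact: (kern2_ge0 dth_ge0).
have [sUe _ dxE] := convol_smooth2 bU sK NK.
move gE : (partial_x (convol U (kern2 th e))) => g.
have cg : continuous g by rewrite -gE; exact: smooth2_continuous (smooth2_partial_x sUe).
pose sg (p : R * R) : R := \1_[set p | 0 <= g p] p * 2 - 1.
have sgE p : sg p * g p = `|g p|.
  rewrite /sg indicE; have [h|h] := leP 0 (g p).
    by rewrite mem_set//= ger0_norm//; ring.
  by rewrite memNset ?ltr0_norm//=; [ring|move=> h'; move: h; rewrite ltNge h'].
have sg1 p : `|sg p| <= 1.
  rewrite /sg indicE; case: (_ \in _); first by rewrite mul1r (_ : 2 - 1 = 1) ?normr1//; ring.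
  by rewrite mul0r sub0r normrN normr1.
pose chi p := - (\1_(box t1 t2 N) p * sg p).
have chi1 p : `|chi p| <= 1.
  by rewrite normrN normrM -[leRHS]mul1r ler_pM// indicE; case: (_ \in _); rewrite ?normr1 ?normr0.
have mchi : measurable_fun setT chi.
  apply: measurableT_comp => //; apply: measurable_funM.
    by apply: measurable_indic; exact: measurable_box.
  apply: measurable_funB => //; apply: measurable_funM => //; apply: measurable_indic.
  rewrite (_ : mkset _ = g @^-1` `[0, +oo[).
    by rewrite -[X in measurable X]setTI; apply: continuous2_measurable.
  by apply/seteqP; split => p /=; rewrite in_itv/= andbT.
have bchi : bmeas chi by split => //; exists 1.
have chi_box p : chi p != 0 -> box t1 t2 N p.
  move=> cp; apply: contrapT => nb; move: cp.
  by rewrite /chi indicE memNset// mul0r oppr0 eqxx.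
have Nchi : supp_square N chi.
  move=> p np; apply/eqP; apply: contra_notT np => /chi_box; exact: box_square.
(* The reflected kernel makes psi the adjoint mollification of chi. The minus sign in chi offsets
   the one produced by differentiating through the reflection. *)
pose K' (z : R * R) := kern2 th e (0 - z).
have sK' : smooth2 K' := smooth2_refl 0 sK.
have K'x z : partial_x K' z = - partial_x (kern2 th e) (0 - z) := (partial_x_refl 0 z (smooth2_derivable_x sK)).2.
have NK' : supp_square (e + 0) K' by apply: (supp_square_refl NK); rewrite normr0.
pose psi := convol chi K'.
have psiE q : psi q = \int[leb2]_p (chi p * kern2 th e (p - q)).
  by apply: eq_Rintegral => p _; rewrite /K' sub0r opprB.
have [spsi _ psix] := convol_smooth2 bchi sK' NK'.
have psi_supp q : psi q != 0 -> exists2 p, box t1 t2 N p & 0 <= (p - q).1 <= e /\ 0 <= (p - q).2 <= e.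
  move=> nq; apply: contrapT => nex; move/eqP: nq; apply.
  rewrite psiE (_ : (fun p => _) = (fun=> 0)); first by rewrite Rintegral_cst// mul0r.
  apply/funext => p; have [->|cp] := eqVneq (chi p) 0; first by rewrite mul0r.
  have [->|kp] := eqVneq (kern2 th e (p - q)) 0; first by rewrite mulr0.
  by exfalso; apply: nex; exists p; [exact: chi_box|move/(kern2_supp th0 th1 e0): kp].
have Npsi : supp_square (N + e) psi.
  apply/supp_squareP => q /psi_supp[p /(box_square t10 t2N)/squareP[h1 h2] [/andP[k1 k2] /andP[k3 k4]]].
  split.
    by rewrite -(subKr p.1 q.1) (le_trans (ler_normB _ _))// lerD// ger0_norm.
  by rewrite -(subKr p.2 q.2) (le_trans (ler_normB _ _))// lerD// ger0_norm.
(* The reflected kernel spreads chi towards earlier times only, so t2 is kept and t1 drops by e. *)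
have tpsi q : psi q != 0 -> t1 - e <= q.1 <= t2.
  move=> /psi_supp[p [/= + _] [/andP[/= k1 k2] _]]; rewrite in_itv/= => /andP[h1 h2].
  by apply/andP; split; lra.
have psi1 q : `|psi q| <= 1.
  rewrite psiE.
  have TK : tame leb2 (fun p => kern2 th e (p - q)).
    have [sS _ _] := smooth2_shift q sK.
    have NS : supp_square (e + (`|q.1| + `|q.2|)) (fun p => kern2 th e (p - q)) := supp_square_shift (w := q) NK.
    exact: (smooth2_tame sS NS).
  have TcK : tame leb2 (fun p => chi p * kern2 th e (p - q)) by apply: tameMr.
  rewrite (le_trans (tame_le_norm_Rint TcK))// -[leRHS](Rint_kern2_shift q e0).
  apply: tame_le_Rint => //; first exact: tame_norm.
  by move=> p; rewrite normrM (ger0_norm (K0 _)) ler_piMl.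
have t1e : 0 < t1 - e by rewrite subr_gt0.
have := dual spsi Npsi t1e t2T tpsi psi1; apply: le_trans; rewrite le_eqVlt; apply/orP; left; apply/eqP.
have bA : bmeas (fun z : (R * R) * (R * R) => - U z.2).
  split; last by exists C => z; rewrite normrN.
  by apply: measurableT_comp => //; exact: (measurableT_comp mU measurable_snd).
have TP := tame_prod_convol bA bchi Nchi sKx NKx.
have SW : \int[leb2]_p \int[leb2]_q (- U q * (chi p * partial_x (kern2 th e) (p - q))) =
    \int[leb2]_q \int[leb2]_p (- U q * (chi p * partial_x (kern2 th e) (p - q))) := leb2_tame_prod_swap TP.
have E1 : \int[leb2]_p \int[leb2]_q (- U q * (chi p * partial_x (kern2 th e) (p - q))) =
    \int[leb2]_p (\1_(box t1 t2 N) p * `|g p|).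
  apply: eq_Rintegral => p _; rewrite -sgE -gE dxE /convol.
  rewrite (_ : (fun q => _) = (fun q => (\1_(box t1 t2 N) p * sg p) * (U q * partial_x (kern2 th e) (p - q)))).
    by rewrite (tame_RintZ _ (convol_tame p bU sKx NKx)) mulrA.
  by apply/funext => q; rewrite /chi; ring.
rewrite -E1 SW; apply: eq_Rintegral => q _; rewrite psix /convol.
have NK'x := (supp_square_partial NK').2; have sK'x := smooth2_partial_x sK'.
rewrite -(tame_RintZ _ (convol_tame q bchi sK'x NK'x)); apply: eq_Rintegral => p _.
by rewrite K'x sub0r opprB; ring.
Qed.

Lemma C1_csupp (phi : R -> R) : C1 phi -> compact (supp phi) -> exists r B : R, [/\ 0 < r, 0 <= B,
  forall x, `|derive1 phi x| <= B, forall x, r <= `|x| -> phi x = 0 & forall x, r < `|x| -> derive1 phi x = 0].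
Proof.
move=> Cphi /compact_bounded[M [Mr HM]].
pose r := `|M| + 2.
have r0 : 0 < r by rewrite ltr_wpDl.
have z x : `|M| + 1 < `|x| -> phi x = 0.
  move=> xr; apply: contrapT => /eqP nx; have := HM (`|M| + 1).
  rewrite (le_lt_trans (ler_norm M)) ?ltrDl// => /(_ isT x) h.
  have : `|x| <= `|M| + 1 by apply: h; apply: subset_closure.
  by rewrite leNgt xr.
have z' x : r <= `|x| -> phi x = 0 by move=> h; apply: z; apply: lt_le_trans h; rewrite ltrD2l ltr1n.
have dz x : r < `|x| -> derive1 phi x = 0.
  move=> rx; rewrite derive1E (@near_eq_derive _ _ _ _ (cst 0)) ?derive_cst//.
  have : \forall y \near x, r < `|y| by apply: (cvgr_gt _ (@norm_continuous _ R x)).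
  by apply: filterS => y ry; rewrite z'// ltW.
have [B B0 HB] := C1_bounded r Cphi.
exists r, B; split => // x; have [h|h] := leP `|x| r; first exact: HB.
by rewrite dz// normr0.
Qed.

Let W e p := convol U (kern2 th e) p - U p.

Let slice1 e t1 t2 N t : R := \int[mu]_x (\1_(box t1 t2 N) (t, x) * `|partial_x (convol U (kern2 th e)) (t, x)|).
Let slice2 e t1 t2 N t : R := \int[mu]_x (\1_(box t1 t2 N) (t, x) * `|W e (t, x)|).

Let tame_prod_box (f : R * R -> R) t1 t2 N : 0 < t1 -> t2 <= N -> measurable_fun setT f ->
  (exists B, forall p, square N p -> `|f p| <= B) -> tame_prod mu mu (fun p => \1_(box t1 t2 N) p * f p).
Proof.
move=> t10 t2N mf [B HB]; apply: (tame_prod_supp_square (N := N) (C := B)).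
  by apply: measurable_funM => //; apply: measurable_indic; exact: measurable_box.
move=> p; rewrite !indicE; have [/set_mem h|h] := boolP (p \in box t1 t2 N).
  have h' := box_square t10 t2N h; rewrite (mem_set h') mul1r mulr1; exact: HB.
rewrite mul0r normr0; have [/set_mem h'|_] := boolP (p \in square N); last by rewrite mulr0.
by rewrite mulr1 (le_trans _ (HB p h')).
Qed.

Let tame_dx e t1 t2 N : 0 < e -> 0 < t1 -> t2 <= N ->
  tame_prod mu mu (fun p => \1_(box t1 t2 N) p * `|partial_x (convol U (kern2 th e)) p|).
Proof.
move=> e0 t10 t2N; have [sUe _ _] := convol_smooth2 bU (smooth2_kern2 sth e) (kern2_supp_square th0 th1 e0).
have cg := smooth2_continuous (smooth2_partial_x sUe).
apply: tame_prod_box => //.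
  by apply: measurableT_comp => //; exact: continuous2_measurable.
by have [B B0 HB] := continuous_bounded_square N cg; exists B => p; rewrite normr_id; exact: HB.
Qed.

Let tame_W e t1 t2 N : 0 < e -> 0 < t1 -> t2 <= N ->
  tame_prod mu mu (fun p => \1_(box t1 t2 N) p * `|W e p|).
Proof.
move=> e0 t10 t2N; have [sUe _ _] := convol_smooth2 bU (smooth2_kern2 sth e) (kern2_supp_square th0 th1 e0).
have cg := smooth2_continuous sUe.
apply: tame_prod_box => //.
  by apply: measurableT_comp => //; apply: measurable_funB => //; exact: continuous2_measurable.
have [B B0 HB] := continuous_bounded_square N cg; exists (B + C) => p pN; rewrite normr_id.
by rewrite (le_trans (ler_normB _ _))// lerD// HB.
Qed.

(** Integration by parts bounds the integral of U phi' by [slice1] + B * [slice2], where B bounds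
    |phi'|. The weight n + 1 forces [slice2] <= Ct / (n + 1), so an n beyond the radius of the
    support and beyond B * Ct leaves at most Ct + 1. Both depend on phi, hence the hypothesis
    provides arbitrarily large n. *)
Lemma slice_TV1_le t t1 t2 (Ct : R) (e : nat -> R) : 0 < t1 -> 0 <= t2 -> t1 <= t <= t2 ->
  (forall n, 0 < e n) ->
  (forall n0, exists2 n, (n0 <= n)%N &
    slice1 (e n) t1 t2 (n%:R + t2) t + n.+1%:R * slice2 (e n) t1 t2 (n%:R + t2) t <= Ct) ->
  (TV1 setT (fun x => U (t, x)) <= (Ct + 1)%:E)%E.
Proof.
move=> t10 t20 tt e0 H; apply: ge_ereal_sup => _ [phi [Cphi [cs _] phi1] <-].
have [r [B [r0 B0 HB pz dz]]] := C1_csupp Cphi cs.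
have [n nb Hn] := H (Num.bound (r + `|B * Ct|)).
have rB : r + `|B * Ct| <= n%:R.
  by rewrite (le_trans (ltW (archi_boundP _))) ?ler_nat// addr_ge0// ltW.
have rn : r <= n%:R by rewrite (le_trans _ rB)// lerDl.
have Bn : `|B * Ct| <= n%:R by rewrite (le_trans _ rB)// lerDr ltW.
set N := n%:R + t2 in Hn; have t2N : t2 <= N by rewrite lerDr.
have rN : r <= N by rewrite (le_trans rn)// lerDl.
have sK := smooth2_kern2 sth (e n); have NK := kern2_supp_square th0 th1 (e0 n).
have [sUe _ _] := convol_smooth2 bU sK NK.
pose Ue := convol U (kern2 th (e n)); pose g := partial_x Ue.
have cdphi : continuous (derive1 phi) := Cphi.2; have cphi := C1_continuous Cphi.
have cUe x : {for x, continuous (fun x => Ue (t, x))}.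
  exact: (is_derive_continuous (fun x => smooth2_is_derive_x t x sUe)).
have cg x : {for x, continuous (fun x => g (t, x))}.
  exact: (is_derive_continuous (fun x => smooth2_is_derive_x t x (smooth2_partial_x sUe))).
have tame_supp (f : R -> R) (D : R) : measurable_fun setT f -> (forall x, `|f x| <= D) ->
    (forall x, r < `|x| -> f x = 0) -> tame mu f.
  move=> mf fD f0; split => //; exists `[- r, r]%classic, D; split => //; first exact: lebesgue_itv_lty.
  move=> x; rewrite indicE; have [h|h] := leP `|x| r.
    by rewrite mem_set ?mulr1//= in_itv/= -ler_norml.
  by rewrite f0// normr0 mulr_ge0// (le_trans _ (fD 0)).
have bslice (f : R * R -> R) : bmeas f -> bmeas (fun x => f (t, x)).
  by move=> [mf [D fD]]; split; [exact: (measurableT_comp mf (pair1_measurable t))|exists D].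
have bUe : bmeas Ue.
  split; last by exists C => p; exact: (convol_kern2_le sth th0 th1 dth_ge0 _ bU UC (e0 n)).
  by apply: continuous2_measurable; exact: smooth2_continuous.
have Tphi : tame mu phi.
  by apply: (tame_supp _ 1) => //; [exact: continuous_measurable_fun|move=> x /ltW /pz].
have Tdphi : tame mu (derive1 phi) by apply: (tame_supp _ B) => //; exact: continuous_measurable_fun.
have TU : tame mu (fun x => U (t, x) * derive1 phi x).
  by apply: tameMr; [exact: (bslice U bU)|exact: Tdphi].
have TUe : tame mu (fun x => Ue (t, x) * derive1 phi x).
  by apply: tameMr; [exact: (bslice Ue bUe)|exact: Tdphi].
have TW : tame mu (fun x => W (e n) (t, x) * derive1 phi x).
  by apply: tameMr; [exact: (bslice (W (e n)) (bmeasB bUe bU))|exact: Tdphi].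
have [Bg Bg0 HBg] := continuous_bounded_square (Num.max N `|t|) (smooth2_continuous (smooth2_partial_x sUe)).
have Tg : tame mu (fun x => g (t, x) * phi x).
  apply: (tame_supp _ (Bg * 1)).
  - apply: measurable_funM; last exact: continuous_measurable_fun.
    exact: continuous_measurable_fun.
  - move=> x; rewrite normrM; have [h|h] := leP `|x| r; last by rewrite (pz _ (ltW h)) normr0 mulr0 mulr1; exact: ltW.
    apply: ler_pM => //; apply: HBg; apply/squareP; split; rewrite le_max ?lexx ?orbT//.
    by rewrite (le_trans h rN).
  - by move=> x /ltW /pz ->; rewrite mulr0.
have parts : \int[mu]_x (Ue (t, x) * derive1 phi x) = - (\int[mu]_x (g (t, x) * phi x)).
  have D (x : R) : is_derive x 1 (fun x => Ue (t, x) * phi x) (g (t, x) * phi x + Ue (t, x) * derive1 phi x).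
    apply: (is_derive_eq (is_deriveM (smooth2_is_derive_x t x sUe) (C1_is_derive x Cphi))).
    by rewrite /GRing.scale /= addrC [phi x * _]mulrC.
  have : \int[mu]_x (g (t, x) * phi x + Ue (t, x) * derive1 phi x) = 0.
    apply: (Rint_derive0 D _ r0).
    - move=> x; apply: cvgD; apply: cvgM; [exact: cg|exact: cphi|exact: cUe|exact: cdphi].
    - by move=> x /pz ->; rewrite mulr0.
    - by move=> x rx; rewrite pz ?ltW// dz// !mulr0 addr0.
  by rewrite (tame_RintD Tg TUe) addrC => /eqP; rewrite addr_eq0 => /eqP.
rewrite tame_EFin_Rint// lee_fin.
have T1 : tame mu (fun x => \1_(box t1 t2 N) (t, x) * `|g (t, x)|).
  exact: tame_prod_fst (tame_dx (e0 n) t10 t2N).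
have T2 : tame mu (fun x => \1_(box t1 t2 N) (t, x) * `|W (e n) (t, x)|).
  exact: tame_prod_fst (tame_W (e0 n) t10 t2N).
have inbox x : `|x| <= r -> \1_(box t1 t2 N) (t, x) = 1 :> R.
  move=> xr; rewrite indicE mem_set//; split; rewrite /= in_itv//= -ler_norml; exact: le_trans xr rN.
have E : \int[mu]_x (U (t, x) * derive1 phi x) =
    - (\int[mu]_x (g (t, x) * phi x)) - \int[mu]_x (W (e n) (t, x) * derive1 phi x).
  by rewrite -parts -(tame_RintB TUe TW); apply: eq_Rintegral => x _; rewrite /W -/Ue; ring.
have i0 x : 0 <= \1_(box t1 t2 N) (t, x) :> R by rewrite indicE.
have s10 : 0 <= slice1 (e n) t1 t2 N t by apply: Rintegral_ge0 => x _; rewrite mulr_ge0.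
have s20 : 0 <= slice2 (e n) t1 t2 N t by apply: Rintegral_ge0 => x _; rewrite mulr_ge0.
have n0 : 0 < n.+1%:R :> R by rewrite ltr0n.
have Ig : - (\int[mu]_x (g (t, x) * phi x)) <= slice1 (e n) t1 t2 N t.
  rewrite -mulN1r -(tame_RintZ _ Tg); apply: tame_le_Rint; [exact: tameZ|exact: T1|move=> x].
  rewrite mulN1r (le_trans (ler_norm _))// normrN normrM; have [h|h] := leP `|x| r.
    by rewrite inbox// mul1r ler_piMr.
  by rewrite (pz _ (ltW h)) normr0 mulr0; exact: mulr_ge0.
have IW : - (\int[mu]_x (W (e n) (t, x) * derive1 phi x)) <= B * slice2 (e n) t1 t2 N t.
  rewrite -mulN1r -(tame_RintZ _ TW) -(tame_RintZ _ T2); apply: tame_le_Rint; [exact: tameZ|exact: tameZ|move=> x].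
  rewrite mulN1r (le_trans (ler_norm _))// normrN normrM mulrC; have [h|h] := leP `|x| r.
    by rewrite inbox// mul1r ler_wpM2r.
  by rewrite dz// normr0 mul0r !mulr_ge0.
have s1C : slice1 (e n) t1 t2 N t <= Ct.
  by rewrite (le_trans _ Hn)// lerDl mulr_ge0// ltW.
have s2C : B * slice2 (e n) t1 t2 N t <= 1.
  have h : n.+1%:R * slice2 (e n) t1 t2 N t <= Ct by rewrite (le_trans _ Hn)// lerDr.
  rewrite -(ler_pM2l n0) mulr1 mulrCA (le_trans (ler_wpM2l B0 h))// (le_trans (ler_norm _))//.
  by rewrite (le_trans Bn)// ler_nat.
by rewrite E (le_trans (lerD Ig IW))// lerD.
Qed.

(** The scale e n is chosen so that the mollification error on [square (n%:R + t2)] is at most 1 /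
    (n + 1); then [F n] has integral at most V + 1. Fatou's lemma makes the lower limit of [F n t]
    finite for almost every t, which means that one bound holds for infinitely many n. Adding t2 to
    n ensures that the boxes lie in these squares. *)
Lemma ae_slice_TV1 t1 t2 : 0 < t1 -> 0 <= t2 -> t2 < T ->
  {ae mu, forall t, t1 <= t <= t2 -> (TV1 setT (fun x => U (t, x)) < +oo)%E}.
Proof.
move=> t10 t20 t2T.
have exe (n : nat) : exists e, [/\ 0 < e, e < t1 &
    \int[leb2]_p (\1_(square (n%:R + t2)) p * `|W e p|) <= n.+1%:R^-1].
  pose en (k : nat) : R := t1 / 2 * k.+1%:R^-1.
  have en0 k : 0 < en k by rewrite mulr_gt0 ?divr_gt0 ?invr_gt0.
  have ecv : en k @[k --> \oo] --> 0.
    by rewrite -[X in _ --> X](mulr0 (t1 / 2)); apply: cvgM; [exact: cvg_cst|exact: cvg_harmonic].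
  have cv := @moll_cvg0 R th sth th0 th1 dth_ge0 U (n%:R + t2) en bU en0 ecv.
  have n0 : 0 < n.+1%:R^-1 :> R by rewrite invr_gt0 ltr0n.
  have [k _ Hk] := cvgr_le _ cv _ n0.
  exists (en k); split; [exact: en0| |exact: (Hk k (leqnn k))].
  rewrite /en (le_lt_trans (ler_piMr _ _)) ?invf_le1 ?ltr0n ?ler1n ?divr_ge0 ?(ltW t10)//.
  by rewrite ltr_pdivrMr// mulrDr mulr1 ltrDl.
have [e He] := choice exe.
have e0 n : 0 < e n by have [] := He n.
pose F n t := slice1 (e n) t1 t2 (n%:R + t2) t + n.+1%:R * slice2 (e n) t1 t2 (n%:R + t2) t.
have t2N (n : nat) : t2 <= n%:R + t2 by rewrite lerDr.
have T1 n := tame_dx (e0 n) t10 (t2N n); have T2 n := tame_W (e0 n) t10 (t2N n).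
have I1 n : tame mu (slice1 (e n) t1 t2 (n%:R + t2)) := tame_prod_int_fst (T1 n).
have I2 n : tame mu (slice2 (e n) t1 t2 (n%:R + t2)) := tame_prod_int_fst (T2 n).
have TF n : tame mu (F n) := tameD (I1 n) (tameZ n.+1%:R (I2 n)).
have i0 t x n : 0 <= \1_(box t1 t2 (n%:R + t2)) (t, x) :> R by rewrite indicE.
have F0 n t : 0 <= F n t.
  rewrite addr_ge0//; first by apply: Rintegral_ge0 => x _; rewrite mulr_ge0.
  by rewrite mulr_ge0//; apply: Rintegral_ge0 => x _; rewrite mulr_ge0.
have IF n : \int[mu]_t F n t <= V + 1.
  rewrite (tame_RintD (I1 n) (tameZ n.+1%:R (I2 n))) (tame_RintZ _ (I2 n)).
  rewrite -(leb2_Rint12 (T1 n)) -(leb2_Rint12 (T2 n)); have [_ et1 eW] := He n.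
  apply: lerD; first exact: mollified_dx_le.
  apply: (@le_trans _ _ (n.+1%:R * n.+1%:R^-1)); last by rewrite mulfV// pnatr_eq0.
  apply: ler_wpM2l; first exact: ler0n.
  apply: le_trans eW.
  have bW : bmeas (W (e n)).
    have [sUe _ _] := convol_smooth2 bU (smooth2_kern2 sth (e n)) (kern2_supp_square th0 th1 (e0 n)).
    split; first by apply: measurable_funB => //; apply: continuous2_measurable; exact: smooth2_continuous.
    exists (C + C) => p; rewrite (le_trans (ler_normB _ _))// lerD//.
    exact: (convol_kern2_le sth th0 th1 dth_ge0 _ bU UC (e0 n)).
  apply: tame_le_Rint.
  - by apply: tameM; [apply: tame_indic; [exact: measurable_box|apply: le_lt_trans (leb2_square_lty (n%:R + t2)); apply: le_measure; rewrite ?inE; [exact: measurable_box|exact: measurable_square|move=> p; exact: box_square]]|exact: bmeas_norm].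
  - by apply: tameM; [apply: tame_indic; [exact: measurable_square|exact: leb2_square_lty]|exact: bmeas_norm].
  - move=> p; rewrite ler_wpM2r// !indicE; have [/set_mem h|_] := boolP (p \in box _ _ _); last by [].
    by rewrite mem_set//; exact: box_square h.
pose f n t := (F n t)%:E.
have mf n : measurable_fun setT (f n) by apply/measurable_EFinP; have [] := TF n.
have f0 n t : setT t -> (0 <= f n t)%E by rewrite lee_fin.
pose g t := limn_einf (f^~ t).
have mg : measurable_fun setT g.
  have -> : g = (fun t => - limn_esup (fun n => (- f n t)%E))%E.
    by apply/funext => t; rewrite [limn_esup _](limn_esupN (f^~ t)) oppeK.
  apply: measurableT_comp => //; apply: measurable_fun_limn_esup => n.
  exact: measurableT_comp.
have g0 t : (0 <= g t)%E.
  rewrite /g limn_einf_lim; apply: lime_ge; first exact: is_cvg_einfs.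
  by apply: nearW => n; apply: le_ereal_inf_tmp => _ [k _ <-]; exact: f0.
have ig : mu.-integrable setT g.
  apply/integrableP; split => //.
  have -> : (fun t => `|g t|)%E = g by apply/funext => t; rewrite gee0_abs.
  apply: le_lt_trans (fatou mu measurableT mf f0) _.
  apply: (@le_lt_trans _ _ (V + 1)%:E); last exact: ltry.
  rewrite limn_einf_lim; apply: lime_le; first exact: is_cvg_einfs.
  apply: nearW => n; apply: (@le_trans _ _ (\int[mu]_t f n t)%E).
    by apply: ereal_inf_lbound; exists n => /=.
  by rewrite tame_EFin_Rint// lee_fin.
have [A [mA A0 sA]] := integrable_ae measurableT ig.
exists A; split => // t /= nt; apply: sA => /= /(_ I) fin; apply: nt => tt.
(* Otherwise [F n t] would tend to +oo, and its lower limit with it. *)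
have [Ct HCt] : exists Ct, forall n0, exists2 n, (n0 <= n)%N & F n t <= Ct.
  apply: contrapT => nex; have : f n t @[n --> \oo] --> +oo%E.
    apply/cvgeyPge => D; apply: contrapT => nn; apply: nex; exists D => n0.
    apply: contrapT => nex; apply: nn; exists n0 => // n /= n0n.
    rewrite lee_fin leNgt; apply/negP => h; apply: nex; exists n => //; exact: ltW.
  by move=> /cvg_limn_einf_sup[h _]; move: fin; rewrite /g h.
apply: (@le_lt_trans _ _ (Ct + 1)%:E); last exact: ltry.
exact: slice_TV1_le t10 t20 tt e0 HCt.
Qed.

End BVSlices.

Section Slices.
Context {R : realType}.
Notation mu := (@lebesgue_measure R).
Notation H := (@halfplane R).

Lemma TV1_ae (f g : R -> R) : measurable_fun setT f -> measurable_fun setT g ->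
  {ae mu, forall x, f x = g x} -> TV1 setT f = TV1 setT g.
Proof.
move=> mf mg [A [mA A0 sA]]; congr ereal_sup; apply: eq_imagel => phi [Cphi _ _].
have mphi : measurable_fun setT (derive1 phi) := continuous_measurable_fun Cphi.2.
apply: ae_eq_integral => //.
- by apply/measurable_EFinP; exact: measurable_funM.
- by apply/measurable_EFinP; exact: measurable_funM.
- exists A; split => // x /= nx; apply: sA => /= h; apply: nx => _; by rewrite h.
Qed.

Lemma locally_integrable_ae_bounded (f g : R -> R) C : measurable_fun setT f -> measurable_fun setT g ->
  (forall x, `|g x| <= C) -> {ae mu, forall x, f x = g x} -> locally_integrable setT f.
Proof.
move=> mf mg gC [A [mA A0 sA]]; split => //; first exact: openT.
move=> K _ cK; have mK : measurable K := compact_measurable cK.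
have -> : (\int[mu]_(x in K) `|f x|%:E = \int[mu]_(x in K) `|g x|%:E)%E.
  apply: ae_eq_integral => //.
  - by apply/measurable_EFinP; apply: measurableT_comp => //; exact: measurable_funS mf.
  - by apply/measurable_EFinP; apply: measurableT_comp => //; exact: measurable_funS mg.
  - exists A; split => // x /= nx; apply: sA => /= h; apply: nx => _; by rewrite h.
have Koo : (mu K < +oo)%E := compact_finite_measure cK.
have T : tame mu (fun x => \1_K x * `|g x|).
  by apply: tameM; [exact: tame_indic|apply/bmeas_norm; split => //; exists C].
rewrite integral_mkcond (_ : _ \_ K = (fun x => (\1_K x * `|g x|)%:E)).
  by rewrite tame_EFin_Rint// ltry.
by apply/funext => x; rewrite patchE indicE; case: ifPn => _; rewrite ?mul1r ?mul0r.
Qed.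

Lemma ae_slice (P : R * R -> Prop) : {ae leb2, forall p, P p} ->
  {ae mu, forall t, {ae mu, forall x, P (t, x)}}.
Proof.
move=> [A [mA A0 sA]].
have mx := measurable_fun_xsection mu mA.
have E : (\int[mu]_(t in setT) `|(mu \o xsection A) t| = 0)%E.
  rewrite -[RHS]A0; apply: eq_integral => t _; by rewrite gee0_abs.
have /(ae_eq_integral_abs mu measurableT mx)[B [mB B0 sB]] := E.
exists B; split => // t /= nt; apply: sB => /= /(_ I) h; apply: nt.
exists (xsection A t); split => //; first exact: measurable_xsection.
by move=> x /= nx; rewrite /xsection /= inE; exact: sA.
Qed.

(** The vector field (0, psi), with zero time component, is admissible in the definition of [TV2],
    and its divergence is the x-derivative of psi. *)
Lemma BV2_dual (u U : R * R -> R) (T : R) : measurable_fun H u -> measurable_fun setT U ->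
  (exists C, forall p, `|U p| <= C) -> {ae leb2, forall p, H p -> U p = u p} ->
  (TV2 (`]0%R, T[ `*` setT) u < +oo)%E ->
  exists V, forall (psi : R * R -> R) t1 t2 N, smooth2 psi -> supp_square N psi ->
  0 < t1 -> t2 < T -> (forall p : R * R, psi p != 0 -> t1 <= p.1 <= t2) -> (forall p, `|psi p| <= 1) ->
  \int[leb2]_p (U p * partial_x psi p) <= V.
Proof.
move=> mu' mU [C UC] [A [mA A0 sA]] TVoo; set Om := `]0, T[ `*` setT in TVoo.
have [V HV] : exists V : R, (TV2 Om u <= V%:E)%E.
  by case: (TV2 Om u) TVoo => [r _|//|_]; [exists r|exists 0; rewrite leNye].
exists V => psi t1 t2 N spsi Np t10 t2T psit psi1.
have [_ Npx] := supp_square_partial Np; have spx := smooth2_partial_x spsi.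
have Tx := smooth2_tame spx Npx.
have px0 p : ~ Om p -> partial_x psi p = 0.
  move=> np; have [_ ->] := derive_xE psi p.
  rewrite (_ : (fun x => _) = cst 0) ?derive1_cst//; apply/funext => x /=.
  apply/eqP; apply: contra_notT np => /psit /= /andP[h1 h2]; split => //=.
  by rewrite in_itv/= (lt_le_trans t10 h1) (le_lt_trans h2 t2T).
have OmH : Om `<=` H.
  by move=> p [/= + _]; rewrite in_itv/= => /andP[p0 _]; split => //=; rewrite in_itv/= ltW.
have mOm : measurable Om by apply: measurableX => //; exact: measurable_itv.
have c0 k : Ck2 k (cst 0 : R * R -> R) by exact: Ck2_cst.
have zt p : partial_t (cst 0 : R * R -> R) p = 0 by exact: derive_cst.
rewrite -lee_fin; apply: le_trans HV; apply: ereal_sup_ubound.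
exists (cst 0, psi); first split.
  - by split; [exact: c0|exact: spsi].
  - split.
      rewrite /csupp_in /supp (_ : mkset _ = set0) ?closure0.
        by split; [exact: compact0|exact: sub0set].
      by apply/seteqP; split => p //=; rewrite eqxx.
    split; first exact: supp_square_compact Np.
    have cl : closed [set p : R * R | t1 <= p.1 <= t2].
      rewrite (_ : mkset _ = fst @^-1` `[t1, t2]).
        by apply: closed_comp; [move=> ? _; exact: cvg_fst|exact: interval_closed].
      by apply/seteqP; split => p /=; rewrite in_itv.
    have sub : supp psi `<=` [set p : R * R | t1 <= p.1 <= t2].
      by rewrite [X in _ `<=` X](closure_id _).1//; apply: closure_subset => p /= /psit.
    move=> p /sub /= /andP[h1 h2]; split => //=.
    by rewrite in_itv/= (lt_le_trans t10 h1) (le_lt_trans h2 t2T).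
  - by move=> p; rewrite expr0n add0r sqrtr_sqr.
have TU : tame leb2 (fun p => U p * partial_x psi p).
  by apply: tameMr => //; split => //; exists C.
rewrite -tame_EFin_Rint//.
have -> : (fun p => (u p * (partial_t (cst 0 : R * R -> R, psi).1 p + partial_x (cst 0 : R * R -> R, psi).2 p))%:E) =
    (fun p => (u p * partial_x psi p)%:E : \bar R).
  by apply/funext => p; rewrite /= zt add0r.
transitivity (\int[leb2]_(p in Om) (U p * partial_x psi p)%:E)%E.
  have mpx : measurable_fun setT (partial_x psi) := tame_measurable Tx.
  apply: ae_eq_integral => //.
  - apply/measurable_EFinP; apply: measurable_funM.
      exact: (measurable_funS measurable_halfplane OmH mu').
    exact: measurable_funS mpx.
  - apply/measurable_EFinP; apply: measurable_funM; first exact: measurable_funS mU.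
    exact: measurable_funS mpx.
  - exists A; split => // p /= np; apply: sA => /= h; apply: np => pOm.
    by rewrite h//; exact: OmH.
rewrite [LHS]integral_mkcond; congr (integral _ _ _); apply/funext => p; rewrite patchE.
by case: ifPn => // /negP np; rewrite px0 ?mulr0// => h; apply/np/mem_set.
Qed.

Lemma BV2_slices (u : R * R -> R) : Linfty leb2 H u ->
  (forall T, 0 < T -> BV2 (`]0, T[ `*` setT) u) ->
  {ae mu, forall t, 0 < t -> BV1 setT (fun x => u (t, x))}.
Proof.
move=> Lu BVu; have [mu' _] := Lu.
have [th [sth th0 th1 dth]] := @exists_smooth_step R.
have [U [C [mU UC _ ae]]] := Linfty_bounded_version Lu.
have sl : {ae mu, forall t, forall m : nat, m.+1%:R^-1 <= t <= m.+1%:R ->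
    (TV1 setT (fun x => U (t, x)) < +oo)%E}.
  apply: ae_foralln => m.
  (* The strips [1 / (m + 1), m + 1] exhaust t > 0; each has to end strictly before T, hence T = m +
     2. *)
  have T0 : 0 < m.+2%:R :> R by rewrite ltr0n.
  have [_ TVoo] := BVu _ T0.
  have [V dual] := BV2_dual mu' mU (ex_intro _ C UC) ae TVoo.
  apply: (ae_slice_TV1 sth th0 th1 dth mU UC dual) => //.
  by rewrite ltr_nat.
have [A [mA A0 sA]] := sl; have [B [mB B0 sB]] := ae_slice ae.
have [D [mD D0 sD]] := negligibleU sl (ae_slice ae).
exists D; split => // t /= nt; apply: sD.
have [h1|h1] := pselect (forall m : nat, m.+1%:R^-1 <= t <= m.+1%:R ->
    (TV1 setT (fun x => U (t, x)) < +oo)%E); last by left.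
right => /= h2; apply: nt => t0.
have mUt : measurable_fun setT (fun x => U (t, x)) := measurableT_comp mU (pair1_measurable t).
have mut : measurable_fun setT (fun x => u (t, x)).
  have -> : (fun x => u (t, x)) = (fun x => (u \_ H) (t, x)).
    by apply/funext => x; rewrite patchE mem_set//; split => //=; rewrite in_itv/= ltW.
  have mr := (measurable_restrictT u measurable_halfplane).1 mu'.
  exact: (measurableT_comp mr (pair1_measurable t)).
have aet : {ae mu, forall x, u (t, x) = U (t, x)}.
  have [E [mE E0 sE]] := h2; exists E; split => // x /= nx; apply: sE => /= h; apply: nx.
  by rewrite h//; split => //=; rewrite in_itv/= ltW.
split; first exact: (locally_integrable_ae_bounded mut mUt (fun x => UC (t, x)) aet).
rewrite (TV1_ae mut mUt aet); apply: (h1 (Num.bound (t + t^-1))).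
have ti : 0 < t^-1 by rewrite invr_gt0.
have := archi_boundP (addr_ge0 (ltW t0) (ltW ti)); set m := Num.bound _ => hm.
have hm1 : t + t^-1 <= m.+1%:R by rewrite -natr1 (le_trans (ltW hm))// lerDl.
apply/andP; split; last by rewrite (le_trans _ hm1)// lerDl ltW.
rewrite -[leRHS]invrK lef_pV2 ?posrE// ?ltr0n//.
by rewrite (le_trans _ hm1)// lerDr ltW.
Qed.

End Slices.

(** * Limits of the scheme are the unique entropy solution *)

Theorem mainTheorem2 (R : realType) (phi u0 : R -> R) (alpha beta M s lambda : R)
    (u : R * R -> R) (dx : nat -> R) :
  C1 phi ->
  Linfty lebesgue_measure setT u0 ->
  BV1 setT u0 ->
  ess_inf lebesgue_measure (EFin \o u0) = alpha%:E ->
  ess_sup lebesgue_measure (EFin \o u0) = beta%:E ->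
  [set `|phi^`()%classic xi| | xi in `[alpha, beta]] M ->
  ubound [set `|phi^`()%classic xi| | xi in `[alpha, beta]] M ->
  0 < s <= 1 ->
  0 < lambda ->
  M <= lambda ->
  Linfty leb2 halfplane u ->
  (forall T, 0 < T -> BV2 (`]0, T[ `*` setT) u) ->
  weak_solution phi u0 u ->
  (forall k, 0 < dx k) ->
  dx @ \oo --> 0 ->
  cvg_L1loc halfplane (fun k => u_approx phi u0 s lambda (dx k)) u ->
  cvg_L1loc halfplane (fun k => v_approx phi u0 s lambda (dx k)) (phi \o u) ->
  unique_entropy_solution phi u0 u.
Proof.
move=> Cphi Lu0 _ infE supE _ ubM /andP[s0 s1] lambda0 Ml Lu BVu weak dx0 dx_cvg ucvg vcvg.
have phi_lambda k : alpha <= k <= beta -> `|derive1 phi k| <= lambda.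
  by move=> kab; apply: le_trans Ml; apply: ubM; exists k => //=; rewrite in_itv.
have s01 : 0 <= s <= 1 by rewrite (ltW s0).
have ae_inf : {ae lebesgue_measure, forall x, alpha <= u0 x}.
  have [A [mA A0 sA]] := ess_inf_le lebesgue_measure (EFin \o u0).
  exists A; split => // x /= nx; apply: sA => /= h; apply: nx.
  by move: h; rewrite infE lee_fin.
have ae_sup : {ae lebesgue_measure, forall x, u0 x <= beta}.
  have [A [mA A0 sA]] := ess_sup_ge lebesgue_measure (EFin \o u0).
  exists A; split => // x /= nx; apply: sA => /= h; apply: nx.
  by move: h; rewrite supE lee_fin.
(* Cell averages inherit the essential bounds of u0, and [alpha, beta] becomes the invariant
   interval of the scheme. *)
have init k j : alpha <= u_init u0 (dx k) j <= beta.
  have d : space_node (dx k) (j + 1) - space_node (dx k) j = dx k.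
    by rewrite /space_node intrD; ring.
  have lt : space_node (dx k) j < space_node (dx k) (j + 1) by rewrite -subr_gt0 d.
  by have := average_bounds Lu0.1 ae_inf ae_sup lt; rewrite d.
have eu : entropy_solution phi u0 u.
  split => //; first exact: BV2_slices.
  move=> eta q psi.
  exact: (entropy_limit Cphi lambda0 s01 phi_lambda dx0 dx_cvg init Lu.1 ucvg vcvg).
split => // w ew; have [th [sth th0 th1 dth]] := @exists_smooth_step R.
exact: (entropy_solution_unique sth th0 th1 dth Cphi ew eu).
Qed.
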